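(* Let $\lambda,\mu$ be partitions with lengths $r_1,r_2$ and associated sequences $(n_i)_{i=1}^{r_1}$, $(m_j)_{j=1}^{r_2}$, set $r=r_1+r_2$, and let $\alpha,\beta\in\mathbb{R}$ be such that $$\alpha+\beta+n_i\notin\{-1,\dots,-n_i\}\ (1\le i\le r_1),\qquad \alpha-\beta+m_j\notin\{-1,\dots,-m_j\}\ (1\le j\le r_2),$$ $$\beta\ne m_j-n_i\ (1\le i\le r_1,\ 1\le j\le r_2).$$ Assume that $\alpha+r>-1$ and $\beta+r>-1$. Then for every positive integer $k$ there is an integer $n_0$ such that for all $n\in\mathbb{N}_{\lambda,\mu}$ with $n\ge n_0$ the polynomial $P^{(\alpha,\beta)}_{\lambda,\mu,n}$ has at least $k$ zeros in $(-1,1)$. Set $\alpha'=\alpha+\mu_1+r_2$ and $\beta'=\beta-\mu_1-r_2$ (with $\mu_1=0$ if $r_2=0$). Limits below are along $n\in\mathbb{N}_{\lambda,\mu}$. (a) Let $x^{(\alpha,\beta)}_{k,n}$ denote the zero of $P^{(\alpha,\beta)}_{\lambda,\mu,n}$ in $(-1,1)$ that is the $k$-th closest to $1$, counting multiplicity, and let $\theta^{(\alpha,\beta)}_{k,n}\in[0,\pi]$ be the unique number with $\cos\theta^{(\alpha,\beta)}_{k,n}=x^{(\alpha,\beta)}_{k,n}$. If $\Omega^{(\alpha,\beta)}_{\lambda,\mu}(1)\ne0$, then $$\lim_{n\to\infty}n\,\theta^{(\alpha,\beta)}_{k,n}=j_{\alpha+r_1+r_2,k}.$$ (b) Let $\mu'$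 be the conjugate partition of $\mu$, with length $r(\mu')$ and associated sequence $(m'_j)_{j=1}^{r(\mu')}$. Assume that for all sufficiently large $n\in\mathbb{N}_{\lambda,\mu}$, with $s=n-|\lambda|-|\mu|+r_1$, $$\alpha'+\beta'+n_i\notin\{-1,\dots,-n_i\}\ (1\le i\le r_1),\qquad \alpha'+\beta'+s\notin\{-1,\dots,-s\},$$ $$-\alpha'+\beta'+m_j'\notin\{-1,\dots,-m_j'\}\ (1\le j\le r(\mu')),$$ $$\alpha'\ne m_j'-n_i\ (1\le i\le r_1,\ 1\le j\le r(\mu')),\qquad \alpha'\neq m_j'-s\ (1\le j\le r(\mu')).$$ Let $y^{(\alpha,\beta)}_{k,n}$ denote the zero of $P^{(\alpha,\beta)}_{\lambda,\mu,n}$ in $(-1,1)$ that is the $k$-th closest to $-1$, counting multiplicity, and let $\Theta^{(\alpha,\beta)}_{k,n}\in[0,\pi]$ be the unique number with $\cos\Theta^{(\alpha,\beta)}_{k,n}=-y^{(\alpha,\beta)}_{k,n}$. If $\bar\Omega^{(\alpha',\beta')}_{\lambda,\mu'}(-1)\neq0$, then $$\lim_{n\to\infty}n\,\Theta^{(\alpha,\beta)}_{k,n}=j_{\beta+r_1-r_2,k}.$$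
   Context: Jacobi polynomials: for $\alpha,\beta\in\mathbb{R}$ and an integer $n\ge 0$, $P_n^{(\alpha,\beta)}(x)=2^{-n}\sum_{j=0}^n\binom{n+\alpha}{j}\binom{n+\beta}{n-j}(x-1)^{n-j}(x+1)^j$ (generalized binomial coefficients). A set $\{-1,-2,\dots,-k\}$ is empty when $k=0$. Wronskian: $\mathrm{Wr}[g_1,\dots,g_k]=\det\big(\tfrac{d^{i-1}}{dx^{i-1}}g_j\big)_{1\le i,j\le k}$, equal to $1$ when $k=0$. Partitions: a partition $\lambda$ is a weakly decreasing finite (possibly empty) sequence of positive integers $\lambda_1\ge\dots\ge\lambda_{r_1}$; $r_1$ is its length, $|\lambda|=\sum_i\lambda_i$, and its associated strictly decreasing sequence is $n_i=\lambda_i+r_1-i$, $1\le i\le r_1$. Likewise $\mu$ has length $r_2$ and associated sequence $m_j=\mu_j+r_2-j$. The conjugate partition $\mu'$ is given by $\mu'_i=\#\{j:\mu_j\ge i\}$, $1\le i\le\mu_1$; its length is $r(\mu')=\mu_1$ and its associated sequence is $m_i'=\mu_i'+r(\mu')-i$. Degree sequence: $\mathbb{N}_{\lambda,\mu}=\{n\in\mathbb{Z}_{\ge0}: n\ge|\lambda|+|\mu|-r_1\text{ and }n-|\lambda|-|\mu|\ne\lambda_j-j\text{ for }j=1,\dots,r_1\}$. Generalized and exceptional Jacobi polynomials: let $r=r_1+r_2$, $f_j(x)=P^{(\alpha,\beta)}_{n_j}(x)$ for $1\le j\le r_1$ and $f_{r_1+j}(x)=(1+x)^{-\beta}P^{(\alpha,-\beta)}_{m_j}(x)$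 for $1\le j\le r_2$. Then $$\Omega^{(\alpha,\beta)}_{\lambda,\mu}(x)=(1+x)^{(\beta+r_1)r_2}\,\mathrm{Wr}[f_1,\dots,f_r],$$ and for $n\in\mathbb{N}_{\lambda,\mu}$, with $s=n-|\lambda|-|\mu|+r_1$, $$P^{(\alpha,\beta)}_{\lambda,\mu,n}(x)=(1+x)^{(\beta+r_1+1)r_2}\,\mathrm{Wr}[f_1,\dots,f_r,P_s^{(\alpha,\beta)}].$$ For a partition $\nu$ of length $\ell$ with associated sequence $(k_j)_{j=1}^{\ell}$ and $a,b\in\mathbb{R}$, $$\bar\Omega^{(a,b)}_{\lambda,\nu}(x)=(1-x)^{(a+r_1)\ell}\,\mathrm{Wr}\big[P^{(a,b)}_{n_1},\dots,P^{(a,b)}_{n_{r_1}},(1-x)^{-a}P^{(-a,b)}_{k_1},\dots,(1-x)^{-a}P^{(-a,b)}_{k_\ell}\big].$$ All of these are polynomials in $x$ (computed on $(-1,1)$ and extended to $\mathbb{C}$). $j_{\nu,k}$ denotes the $k$-th positive zero of the Bessel function of the first kind $J_\nu$, $\nu\in\mathbb{R}$. *)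

(* Defs.v *)
From HB Require Import structures.
From mathcomp Require Import all_boot all_order all_algebra.
From mathcomp Require Import all_classical all_reals all_analysis.
From mathcomp Require polyrcf.
Set Implicit Arguments.
Unset Strict Implicit.
Unset Printing Implicit Defensive.
Import Order.TTheory GRing.Theory Num.Theory.
Import numFieldNormedType.Exports.
Local Open Scope classical_set_scope.
Local Open Scope ring_scope.

(* Lists are indexed from 0 here, whereas the mathematical sequences
   lambda_1, lambda_2, ... are indexed from 1. *)

Definition is_partition (la : seq nat) : bool :=
  sorted geq la && (0%N \notin la).

(* n_i = lambda_i + length - i *)
Definition assoc_seq (la : seq nat) : seq nat :=
  [seq (nth 0 la i + (size la - i.+1))%N | i <- iota 0 (size la)].

(* lambda'_i = #{j : lambda_j >= i} for 1 <= i <= lambda_1 *)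
Definition conj_part (la : seq nat) : seq nat :=
  [seq count (fun l => i < l)%N la | i <- iota 0 (head 0%N la)].

Definition degree_seq (la mu : seq nat) : set nat :=
  [set n | (sumn la)%:Z + (sumn mu)%:Z - (size la)%:Z <= n%:Z /\
     forall j, (j < size la)%N ->
       n%:Z - (sumn la)%:Z - (sumn mu)%:Z != (nth 0%N la j)%:Z - j.+1%:Z].

(* s = n - |lambda| - |mu| + r_1; the natural subtraction does not truncate
   when n belongs to degree_seq la mu. *)
Definition shifted_degree (la mu : seq nat) (n : nat) : nat :=
  (n + size la - (sumn la + sumn mu))%N.

(* x does not belong to {-1, ..., -k} *)
Definition avoids (R : realType) (x : R) (k : nat) : Prop :=
  forall i, (1 <= i <= k)%N -> x != - i%:R.

Definition gbinom (R : realType) (a : R) (j : nat) : R :=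
  (\prod_(i < j) (a - i%:R)) / (j`!)%:R.

Definition jacobi (R : realType) (a b : R) (n : nat) : {poly R} :=
  (2 ^- n) *: \sum_(j < n.+1)
    (gbinom (n%:R + a) j * gbinom (n%:R + b) (n - j)) *:
      (('X - 1) ^+ (n - j) * ('X + 1) ^+ j).

Definition wronskian (R : realType) (fs : seq (R -> R)) (x : R) : R :=
  \det (\matrix_(i < size fs, j < size fs)
          derive1n i (nth (fun=> 0) fs j) x).

(* The polynomial that coincides with f on (-1, 1); it is unique when it
   exists, and 0 is returned when it does not exist. *)
Definition poly_ext (R : realType) (f : R -> R) : {poly R} :=
  xget 0 [set p : {poly R} | forall x, -1 < x < 1 -> p.[x] = f x].

(* On (-1, 1) the real power powR, written `^, has a positive base in all the
   formulas below. *)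
Definition jacobi_family (R : realType) (a b : R) (la mu : seq nat) :
    seq (R -> R) :=
  [seq horner (jacobi a b n) | n <- assoc_seq la] ++
  [seq (fun x => (1 + x) `^ (- b) * (jacobi a (- b) m).[x])
    | m <- assoc_seq mu].

Definition Omega (R : realType) (a b : R) (la mu : seq nat) : {poly R} :=
  poly_ext (fun x => (1 + x) `^ ((b + (size la)%:R) * (size mu)%:R) *
    wronskian (jacobi_family a b la mu) x).

Definition Omega_bar (R : realType) (a b : R) (la nu : seq nat) : {poly R} :=
  poly_ext (fun x => (1 - x) `^ ((a + (size la)%:R) * (size nu)%:R) *
    wronskian ([seq horner (jacobi a b n) | n <- assoc_seq la] ++
               [seq (fun x => (1 - x) `^ (- a) * (jacobi (- a) b k).[x])
                 | k <- assoc_seq nu]) x).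

Definition exceptional_jacobi (R : realType) (a b : R) (la mu : seq nat)
    (n : nat) : {poly R} :=
  poly_ext (fun x => (1 + x) `^ ((b + (size la)%:R + 1) * (size mu)%:R) *
    wronskian (rcons (jacobi_family a b la mu)
                     (horner (jacobi a b (shifted_degree la mu n)))) x).

(* The distinct roots of p in (-1, 1), in increasing order ([::] if p = 0). *)
Definition zeros (R : realType) (p : {poly R}) : seq R :=
  polyrcf.roots p (-1) 1.

Definition zeros_mult (R : realType) (p : {poly R}) : seq R :=
  flatten [seq nseq (mup x p) x | x <- zeros p].

(* Counting with multiplicity and starting from k = 1. *)
Definition zero_near_m1 (R : realType) (p : {poly R}) (k : nat) : R :=
  nth 0 (zeros_mult p) k.-1.

Definition zero_near_1 (R : realType) (p : {poly R}) (k : nat) : R :=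
  nth 0 (rev (zeros_mult p)) k.-1.

(* The entire function 1 / Gamma, by Gauss's limit formula
   Gamma(z) = lim_n n! n^z / (z (z + 1) ... (z + n)). *)
Definition inv_Gamma (R : realType) (z : R) : R :=
  limn (fun n : nat =>
    (\prod_(i < n.+1) (z + i%:R)) / ((n`!)%:R * n%:R `^ z)).

(* J_nu(x) for x > 0 *)
Definition bessel_J (R : realType) (nu x : R) : R :=
  limn (series (fun m : nat =>
    (-1) ^+ m / (m`!)%:R * inv_Gamma (m%:R + nu + 1) *
    (x / 2) `^ (2 * m%:R + nu))).

(* j_{nu,k}: the zero x > 0 such that exactly k zeros lie in (0, x]. *)
Definition bessel_zero (R : realType) (nu : R) (k : nat) : R :=
  xget 0 [set x | [/\ 0 < x, bessel_J nu x = 0 &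
    ([set y | 0 < y <= x /\ bessel_J nu y = 0] #= `I_k)%card]].

(* Main.v *)
(** Write s for the shifted degree.  Expanding the Wronskian along its last
    column, P_n is (1+x)^e times sum_(i <= r) B_i D^i P_s^(a,b), where the
    B_i do not depend on n and B_r(1) <> 0 is the hypothesis on Omega.  Near
    x = 1 put x = 1 - 2t/s^2.  The coefficients in t of
    s^(-a) P_s^(a,b)(1 - 2t/s^2) converge, dominated by those of an
    exponential, to the ones of t^(-a/2) J_a(2 sqrt t) (Mehler-Heine).
    Differentiating k times multiplies the scale by s^(2k) and replaces a by
    a + k, so the term i = r dominates, and the zeros converge to those of
    J_(a+r)(2 sqrt t), which are simple.

    At -1, one passes from (a, b, mu) to (a', b', mu') and then replaces x
    by -x.  The passage is done in T = mu_1 + r_2 steps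
    (a, b) -> (a + 1, b - 1): each of the three families P_n^(a,b),
    (1+x)^(-b) P_m^(a,-b), (1-x)^(-a) P_k^(-a,b), multiplied by (1+x)^b and
    differentiated, gives a multiple of the corresponding family for
    (a + 1, b - 1), and the reverse step uses (1-x)^(a+1).  A member of
    degree 0 of the second (resp. third) family becomes the constant 1 and
    drops out of the Wronskian.  The indices m are thus replaced by the
    numbers T - 1 - t, for t < T not among the m.

    For the number of zeros, the functions (1+x)^c p(x) with distinct
    exponents c + deg p are stable under f |-> (f / f_0)' up to a common
    factor, so Rolle's theorem bounds from below the zeros of the Wronskian
    by those of P_s minus r. *)
Require Import Defs.
From HB Require Import structures.
From mathcomp Require Import all_boot all_order all_algebra.
From mathcomp Require Import all_classical all_reals all_analysis.
From mathcomp Require Import ring lra zify.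
From mathcomp Require Import perm.
From mathcomp Require polyrcf.
Set Implicit Arguments.
Unset Strict Implicit.
Unset Printing Implicit Defensive.
Import Order.TTheory GRing.Theory Num.Theory.
Import numFieldNormedType.Exports.
Local Open Scope classical_set_scope.
Local Open Scope ring_scope.

(** * Gauss's product and 1/Gamma *)

Section GaussLimit.
Variable R : realType.
Implicit Types z : R.

(** Everything stays over the reals, without Hurwitz's theorem. Uniform convergence on a real
    interval does not pass to derivatives, whereas dominated convergence of coefficients does
    ([dcvg]). Each simple zero of the limit then attracts exactly one zero, by the intermediate
    value theorem and Rolle; these zeros are simple, so counting with multiplicity is harmless. The
    order b + r_1 - r_2 reached at -1 may be a negative integer -l. Then 1/Gamma kills the first l
    coefficients of the limit; for large s the same coefficients of the rescaled polynomials vanish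
    exactly, and t^l is divided out on both sides before zeros are compared. Wronskians carry real
    powers of 1 + x and 1 - x, so they are compared on (-1, 1) up to a factor C (1+x)^e (1-x)^e'
    with C <> 0 ([wsim]), which preserves zeros and their simplicity. [poly_ext] returns 0 when no
    polynomial exists. For P_n existence comes from the divisibility of a determinant by a power of
    1 + X; for Omega and its dual, a nonzero value at the endpoint excludes the default. *)

Lemma fact_neq0 (n : nat) : (n`!)%:R != 0 :> R.
Proof. by rewrite pnatr_eq0 -lt0n fact_gt0. Qed.

Definition gauss_seq z (n : nat) : R :=
  (\prod_(i < n.+1) (z + i%:R)) / ((n`!)%:R * n%:R `^ z).

Lemma ln1Dx_approx (x : R) : `|x| <= 1 / 2 -> `|ln (1 + x) - x| <= 2 * x ^+ 2.
Proof.
rewrite ler_norml => /andP[x1 x2].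
have l1 : ln (1 + x) <= x by apply: le_ln1Dx; lra.
have p1 : 0 < 1 + x by lra.
have l2 : - ln (1 + x) <= - x / (1 + x).
  have e : (1 + x)^-1 = 1 + (- x / (1 + x)) by field; lra.
  rewrite -lnV ?posrE // {1}e.
  apply: le_ln1Dx; rewrite ltr_pdivlMr //; lra.
have : - x / (1 + x) <= - x + 2 * x ^+ 2.
  rewrite ler_pdivrMr //.
  suff : 0 <= x ^+ 2 * (1 + 2 * x) by lra.
  by rewrite mulr_ge0 ?sqr_ge0 //; lra.
rewrite ler_norml => h; apply/andP; split; first by lra.
have : 0 <= x ^+ 2 by rewrite sqr_ge0. lra.
Qed.

Lemma ln1DV_ge (n : nat) : (0 < n)%N -> n.+1%:R^-1 <= ln (1 + n%:R^-1 : R).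
Proof.
move=> n0; have p0 : 0 < n%:R :> R by rewrite ltr0n.
have q0 : 0 < 1 + n%:R^-1 :> R by rewrite ltr_wpDr // invr_ge0 ltW.
have e : (1 + n%:R^-1)^-1 = 1 + (- n.+1%:R^-1) :> R.
  by rewrite -natr1; field; apply/andP; split; lra.
rewrite -lerN2 -lnV ?posrE // e.
by apply: le_ln1Dx; rewrite ltrN2 invf_lt1 ?ltr0n// ltr1n ltnS.
Qed.

Lemma ln1DV_approx (n : nat) : (0 < n)%N ->
  `|n.+1%:R^-1 - ln (1 + n%:R^-1 : R)| <= (n%:R * n.+1%:R)^-1.
Proof.
move=> n0; have p0 : 0 < n%:R :> R by rewrite ltr0n.
have l1 : ln (1 + n%:R^-1 : R) <= n%:R^-1.
  apply: le_ln1Dx; have : 0 < n%:R^-1 :> R by rewrite invr_gt0. lra.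
have l2 := ln1DV_ge n0.
have -> : (n%:R * n.+1%:R)^-1 = n%:R^-1 - n.+1%:R^-1 :> R.
  by rewrite -natr1; field; apply/andP; split; lra.
move: l1 l2; move: (n.+1%:R^-1) (n%:R^-1 : R) (ln _) => u v w l1 l2.
by rewrite ler_norml; apply/andP; split; lra.
Qed.

(** For large n this is the logarithm of the ratio of consecutive terms of [gauss_seq z]; it is
    O(1/n^2). *)
Definition gauss_dlog z (n : nat) : R := ln (1 + z / n.+1%:R) - z * ln (1 + n%:R^-1).

Lemma norm_gauss_dlog z n : (0 < n)%N -> 2 * `|z| <= n%:R ->
  `|gauss_dlog z n| <= (2 * z ^+ 2 + `|z|) / (n%:R * n.+1%:R).
Proof.
move=> n0 zn; have p0 : 0 < n%:R :> R by rewrite ltr0n.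
have p1 : 0 < n.+1%:R :> R by rewrite ltr0n.
have -> : gauss_dlog z n = (ln (1 + z / n.+1%:R) - z / n.+1%:R) +
   z * (n.+1%:R^-1 - ln (1 + n%:R^-1)) by rewrite /gauss_dlog; ring.
apply: (le_trans (ler_normD _ _)); rewrite mulrDl lerD //.
  have h : `|z / n.+1%:R| <= 1 / 2.
    rewrite normrM normfV (ger0_norm (ltW p1)) ler_pdivrMr //.
    rewrite -[n.+1%:R]natr1; move: (n%:R : R) (`|z|) zn p0 => N u zn p0; lra.
  apply: (le_trans (ln1Dx_approx h)).
  rewrite expr_div_n mulrA ler_wpM2l //; first by rewrite mulr_ge0 ?sqr_ge0 ?ler0n.
  by rewrite expr2 lef_pV2 ?posrE ?mulr_gt0 // ler_pM2r // ler_nat.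
rewrite normrM ler_wpM2l //; exact: ln1DV_approx.
Qed.

(** Domination by a constant times 1/(k+1) - 1/(k+2), whose sum telescopes. *)
Lemma cvg_series_gauss_dlog z (N : nat) : (0 < N)%N -> 2 * `|z| <= N%:R ->
  cvgn (series (fun k => gauss_dlog z (N + k))).
Proof.
move=> N0 Nz; apply: normed_cvg.
pose C := 2 * z ^+ 2 + `|z|.
have C0 : 0 <= C by rewrite /C addr_ge0 // mulr_ge0 // sqr_ge0.
apply: (@series_le_cvg _ _ (fun k => C * (k.+1%:R^-1 - k.+2%:R^-1))) => [k|k|k|].
- exact: normr_ge0.
- by rewrite mulr_ge0 // subr_ge0 lef_pV2 ?posrE ?ltr0n // ler_nat.
- apply: (le_trans (norm_gauss_dlog _ _)); first by rewrite addn_gt0 N0.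
    by apply: (le_trans Nz); rewrite ler_nat leq_addr.
  rewrite ler_wpM2l //.
  have -> : k.+1%:R^-1 - k.+2%:R^-1 = (k.+1%:R * k.+2%:R)^-1 :> R.
    by rewrite -!natr1; field; rewrite !natr1; apply/andP; split; rewrite pnatr_eq0.
  rewrite lef_pV2 ?posrE ?mulr_gt0 ?ltr0n ?addn_gt0 ?N0 //.
  by rewrite -!natrM ler_nat; apply: leq_mul; rewrite ?ltnS -add1n leq_add2r.
have -> : series (fun k => C * (k.+1%:R^-1 - k.+2%:R^-1)) = (fun n => C * (1 - n.+1%:R^-1)).
  apply/funext => n; rewrite /series /= -mulr_sumr; congr (_ * _).
  elim: n => [|n IH]; first by rewrite big_geq // invr1 subrr.
  by rewrite big_nat_recr //= IH; ring.
apply: is_cvgMr; apply: is_cvgB; first exact: is_cvg_cst.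
by apply/cvg_ex; exists 0; exact: cvg_harmonic.
Qed.

Lemma gauss_seqS z (n : nat) : (0 < n)%N -> 2 * `|z| <= n%:R ->
  gauss_seq z n.+1 = gauss_seq z n * expR (gauss_dlog z n).
Proof.
move=> n0 zn; have p0 : 0 < n%:R :> R by rewrite ltr0n.
have p1 : 0 < n.+1%:R :> R by rewrite ltr0n.
have h : 0 < 1 + z / n.+1%:R.
  have : `|z / n.+1%:R| < 1.
    rewrite normrM normfV (ger0_norm (ltW p1)) ltr_pdivrMr //.
    rewrite -[n.+1%:R]natr1; move: (n%:R : R) (`|z|) (normr_ge0 z) zn p0 => N u u0 zn p0; lra.
  rewrite ltr_norml; move: (z / _) => u; lra.
rewrite /gauss_dlog expRB lnK ?posrE // /gauss_seq big_ord_recr /= factS natrM.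
have -> : expR (z * ln (1 + n%:R^-1)) = n.+1%:R `^ z / n%:R `^ z.
  have -> : 1 + n%:R^-1 = n.+1%:R / n%:R :> R by rewrite -natr1; field; lra.
  rewrite ln_div ?posrE // /powR !gt_eqF // -expRB; congr expR; ring.
have := powR_gt0 z p0; have := powR_gt0 z p1.
set A := _ `^ z; set B := _ `^ z => A0 B0.
have f0 : (n`!)%:R != 0 :> R by exact: fact_neq0.
by field; rewrite f0 !gt_eqF.
Qed.

(** From N on, the sequence is its N-th term times the exponential of a convergent series, so the
    limit can vanish only through a factor z + i. The bound N >= 2|z| keeps the arguments of the
    logarithms positive. *)
Lemma cvg_gauss_seq z : exists2 l, gauss_seq z @ \oo --> l &
  ((forall i : nat, z != - i%:R) -> l != 0).
Proof.
pose N := (Num.bound (2 * `|z|)).+1.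
have N0 : (0 < N)%N by [].
have Nz : 2 * `|z| <= N%:R.
  have h0 : 0 <= 2 * `|z| by rewrite mulr_ge0.
  by apply: (le_trans (ltW (archi_boundP h0))); rewrite ler_nat.
have E k : gauss_seq z (N + k) = gauss_seq z N * expR (series (fun k => gauss_dlog z (N + k)) k).
  elim: k => [|k IH]; first by rewrite addn0 /series /= big_geq // expR0 mulr1.
  rewrite addnS gauss_seqS ?addn_gt0 ?N0 //; last first.
    by apply: (le_trans Nz); rewrite ler_nat leq_addr.
  by rewrite IH seriesSr [in RHS]expRD mulrA.
have /cvg_ex [S hS] := cvg_series_gauss_dlog N0 Nz.
exists (gauss_seq z N * expR S).
  rewrite -(cvg_shiftn N) /=.
  have -> : (fun n => gauss_seq z (n + N)) = (fun k => gauss_seq z N *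
      expR (series (fun k => gauss_dlog z (N + k)) k)).
    by apply/funext => k; rewrite addnC E.
  apply: cvgMr; apply: continuous_cvg => //; exact: continuous_expR.
move=> zi; apply: mulf_neq0; last by rewrite gt_eqF ?expR_gt0.
apply: mulf_neq0.
  apply/prodf_neq0 => i _; apply: contra (zi i); rewrite addr_eq0 => /eqP ->; exact: eqxx.
by rewrite invr_eq0 gt_eqF // mulr_gt0 // ?powR_gt0 ?ltr0n ?fact_gt0.
Qed.

Lemma cvg_inv_Gamma z : gauss_seq z @ \oo --> inv_Gamma z.
Proof. by have [l h _] := cvg_gauss_seq z; rewrite /inv_Gamma (cvg_lim _ h). Qed.

Lemma inv_Gamma_neq0 z : (forall i : nat, z != - i%:R) -> inv_Gamma z != 0.
Proof.
move=> zi; have [l h /(_ zi)] := cvg_gauss_seq z.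
by rewrite /inv_Gamma (cvg_lim _ h).
Qed.

Lemma cvg_ratio (c d : R) : (fun n : nat => (n%:R + c) / (n%:R + d)) @ \oo --> (1 : R).
Proof.
have h e : (fun n : nat => 1 + e * n%:R^-1 : R) @ \oo --> (1 : R).
  rewrite -[X in _ --> X]addr0 -(mulr0 e); apply: cvgD; first exact: cvg_cst.
  apply: cvgMr; rewrite -cvg_shiftS /=; exact: cvg_harmonic.
have : (fun n : nat => (1 + c * n%:R^-1) / (1 + d * n%:R^-1)) @ \oo --> (1 / 1 : R).
  apply: cvgM; first exact: h.
  by apply: cvgV; [rewrite oner_eq0 | exact: h].
rewrite divr1; apply: cvg_trans; apply: near_eq_cvg.
near=> n.
have n0 : 0 < n%:R :> R by rewrite ltr0n; near: n; exact: nbhs_infty_gt.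
have n1 : n%:R + d != 0 :> R.
  rewrite gt_eqF // -ltrBlDr sub0r (@lt_le_trans _ _ (Num.bound `|d|)%:R) //.
    rewrite (le_lt_trans _ (archi_boundP (normr_ge0 d))) // -normrN ler_norm //.
  by rewrite ler_nat; near: n; exact: nbhs_infty_ge.
by field; rewrite n1 gt_eqF.
Unshelve. all: by end_near. Qed.

Lemma near_addr_gt0 (d : R) : \forall n \near \oo, 0 < n%:R + d.
Proof.
near=> n.
rewrite -ltrBlDr sub0r (@lt_le_trans _ _ (Num.bound `|d|)%:R) //.
  by rewrite (le_lt_trans _ (archi_boundP (normr_ge0 d))) // -normrN ler_norm.
by rewrite ler_nat; near: n; exact: nbhs_infty_ge.
Unshelve. all: by end_near. Qed.

(** The terms of [gauss_seq z] are those of [gauss_seq (z + 1)] times z n / (n + z + 1), and n / (n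
    + z + 1) tends to 1. *)
Lemma inv_GammaS z : inv_Gamma z = z * inv_Gamma (z + 1).
Proof.
suff : gauss_seq z @ \oo --> z * inv_Gamma (z + 1).
  by move=> /cvg_lim <- //; rewrite (cvg_lim _ (@cvg_inv_Gamma z)).
have h : (fun n => z * gauss_seq (z + 1) n * ((n%:R + 0) / (n%:R + (z + 1))))
    @ \oo --> z * inv_Gamma (z + 1).
  rewrite -[X in _ --> X]mulr1; apply: cvgM; last exact: cvg_ratio.
  apply: cvgMr; exact: cvg_inv_Gamma.
apply: cvg_trans h; apply: near_eq_cvg; near=> n.
have n0 : 0 < n%:R :> R by rewrite ltr0n; near: n; exact: nbhs_infty_gt.
have n1 : 0 < n%:R + (z + 1) by near: n; exact: near_addr_gt0.
have f0 : (n`!)%:R != 0 :> R by exact: fact_neq0.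
rewrite /gauss_seq [in RHS]big_ord_recl /= addr0 [in LHS]big_ord_recr /=.
have -> : \prod_(i < n) (z + (bump 0 i)%:R) = \prod_(i < n) (z + 1 + i%:R).
  by apply: eq_bigr => i _; rewrite /bump /= natrD addrA.
have pz : 0 < n%:R `^ z by rewrite powR_gt0.
rewrite powRD ?(gt_eqF n0) ?implybT // powRr1 ?ltW // addr0.
field; rewrite f0 !gt_eqF // addrA addrC.
Unshelve. all: by end_near. Qed.

Lemma inv_Gamma0 (n : nat) : inv_Gamma (- n%:R : R) = 0.
Proof.
elim: n => [|n IH]; first by rewrite oppr0 inv_GammaS mul0r.
rewrite inv_GammaS -[n.+1%:R]natr1.
by have -> : - (n%:R + 1) + 1 = - n%:R :> R; [ring | rewrite IH mulr0].
Qed.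

(** Up to the last factor of the product this is [gauss_seq]; the present form is that of the
    binomials [gbinom (m + z - 1) m], see [gbinom_prodE]. *)
Lemma cvg_prod_inv_Gamma z :
  (fun m : nat => (\prod_(i < m) (z + i%:R)) / (m`!)%:R * m%:R `^ (1 - z))
    @ \oo --> inv_Gamma z.
Proof.
have h : (fun n => gauss_seq z n * ((n%:R + 0) / (n%:R + z))) @ \oo --> inv_Gamma z.
  rewrite -[X in _ --> X]mulr1; apply: cvgM; last exact: cvg_ratio.
  exact: cvg_inv_Gamma.
apply: cvg_trans h; apply: near_eq_cvg; near=> n.
have n0 : 0 < n%:R :> R by rewrite ltr0n; near: n; exact: nbhs_infty_gt.
have n1 : 0 < n%:R + z by near: n; exact: near_addr_gt0.
have f0 : (n`!)%:R != 0 :> R by exact: fact_neq0.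
rewrite /gauss_seq [in LHS]big_ord_recr /=.
have pz : 0 < n%:R `^ z by rewrite powR_gt0.
rewrite powRB ?(gt_eqF n0) ?implybT // powRr1 ?ltW // addr0.
by field; rewrite f0 !gt_eqF // addrC.
Unshelve. all: by end_near. Qed.

Lemma cvg_powR_ratio (k : nat) (c : R) :
  (fun s : nat => ((s - k)%:R / s%:R) `^ c) @ \oo --> (1 : R).
Proof.
have h : (fun s : nat => expR (c * ln ((s%:R + - k%:R) / (s%:R + 0)))) @ \oo --> (1 : R).
  rewrite -[X in _ --> X]expR0 -(mulr0 c) -ln1.
  apply: continuous_cvg; first exact: continuous_expR.
  apply: cvgMr; apply: continuous_cvg; first exact: continuous_ln.
  exact: cvg_ratio.
apply: cvg_trans h; apply: near_eq_cvg; near=> s.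
have ks : (k < s)%N by near: s; exact: nbhs_infty_gt.
rewrite addr0 natrB 1?ltnW // /powR gt_eqF // divr_gt0 ?subr_gt0 ?ltr_nat // ltr0n.
exact: leq_ltn_trans ks.
Unshelve. all: by end_near. Qed.

End GaussLimit.

(** * Jacobi polynomials *)

Section GeneralizedBinomial.
Variable R : realType.
Implicit Types (a b : R) (n j : nat).

Lemma natS_neq0 (n : nat) : n.+1%:R != 0 :> R.
Proof. by rewrite pnatr_eq0. Qed.

Lemma gbinom0 a : gbinom a 0 = 1.
Proof. by rewrite /gbinom big_ord0 fact0 divr1. Qed.

Lemma gbinomS a j : j.+1%:R * gbinom a j.+1 = (a - j%:R) * gbinom a j.
Proof.
rewrite /gbinom big_ord_recr /= factS natrM.
have h1 := natS_neq0 j; have h2 : (j`!)%:R != 0 :> R by exact: fact_neq0.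
by field; rewrite h2 addrC natr1 h1.
Qed.

Lemma gbinom_absorb a j : a * gbinom (a - 1) j = (a - j%:R) * gbinom a j.
Proof.
rewrite /gbinom !mulrA; congr (_ / _).
have -> : a * \prod_(i < j) (a - 1 - i%:R) = \prod_(i < j.+1) (a - i%:R).
  rewrite big_ord_recl /= subr0; congr (_ * _).
  by apply: eq_bigr => i _; rewrite /bump /= natrD; ring.
by rewrite big_ord_recr /= mulrC.
Qed.

Lemma gbinom_pascal a j : gbinom (a + 1) j.+1 = gbinom a j + gbinom a j.+1.
Proof.
apply: (mulfI (natS_neq0 j)).
rewrite gbinomS mulrDr gbinomS.
have /= := gbinom_absorb (a + 1) j; rewrite addrK => h.
have -> : (a + 1 - j%:R) * gbinom (a + 1) j = (a + 1) * gbinom a j by rewrite h.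
by rewrite -natr1; ring.
Qed.

(** Forms of degree n in X - 1 and X + 1. Multiplication by either factor and derivation act on the
    coefficient sequence, so each relation between Jacobi polynomials becomes an identity between
    neighbouring binomials. *)
Definition hsum (n : nat) (u : nat -> R) : {poly R} :=
  \sum_(j < n.+1) u j *: (('X - 1) ^+ (n - j) * ('X + 1) ^+ j).

Lemma jacobi_hsum a b n : jacobi a b n = (2 ^- n) *:
  hsum n (fun j => gbinom (n%:R + a) j * gbinom (n%:R + b) (n - j)).
Proof. by []. Qed.

Lemma eq_hsum n u v : (forall j, (j <= n)%N -> u j = v j) -> hsum n u = hsum n v.
Proof. by move=> e; apply: eq_bigr => j _; rewrite e // -ltnS. Qed.

Lemma hsumZ n c u : c *: hsum n u = hsum n (fun j => c * u j).
Proof. by rewrite /hsum scaler_sumr; apply: eq_bigr => j _; rewrite scalerA. Qed.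

Lemma hsumD n u v : hsum n u + hsum n v = hsum n (fun j => u j + v j).
Proof. by rewrite /hsum -big_split; apply: eq_bigr => j _; rewrite scalerDl. Qed.

Lemma mulXD1_hsum n u :
  ('X + 1) * hsum n u = hsum n.+1 (fun j => if j is j'.+1 then u j' else 0).
Proof.
rewrite /hsum [in RHS]big_ord_recl /= scale0r add0r mulr_sumr.
by apply: eq_bigr => j _ /=; rewrite subSS -scalerAr; congr (_ *: _); rewrite exprS; ring.
Qed.

Lemma mulXB1_hsum n u :
  ('X - 1) * hsum n u = hsum n.+1 (fun j => if j == n.+1 then 0 else u j).
Proof.
rewrite /hsum [in RHS]big_ord_recr /= eqxx scale0r addr0 mulr_sumr.
apply: eq_bigr => j _ /=; rewrite ltn_eqF ?ltn_ord// -scalerAr; congr (_ *: _).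
by rewrite subSn ?exprS; [ring | rewrite -ltnS].
Qed.

Lemma derivXB1 : ('X - 1 : {poly R})^`() = 1.
Proof. by rewrite -polyC1 derivXsubC. Qed.

Lemma derivXD1 : ('X + 1 : {poly R})^`() = 1.
Proof. by rewrite -polyC1 derivD derivX derivC addr0. Qed.

Lemma scale_mulrn (c : R) (A B : {poly R}) m :
  c *: (A *+ m * B) = (m%:R * c) *: (A * B).
Proof. by rewrite -scaler_nat -scalerAl scalerA mulrC. Qed.

Lemma scale_mulrnr (c : R) (A B : {poly R}) m :
  c *: (A * (B *+ m)) = (m%:R * c) *: (A * B).
Proof. by rewrite [A * _]mulrC scale_mulrn [B * _]mulrC. Qed.

Lemma deriv_hsum n u :
  (hsum n.+1 u)^`() = hsum n (fun j => (n.+1 - j)%:R * u j + j.+1%:R * u j.+1).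
Proof.
rewrite -hsumD /hsum raddf_sum /=.
have E (j : 'I_n.+2) : (u j *: (('X - 1) ^+ (n.+1 - j) * ('X + 1) ^+ j))^`() =
   ((n.+1 - j)%:R * u j) *: (('X - 1) ^+ (n.+1 - j).-1 * ('X + 1) ^+ j)
   + (j%:R * u j) *: (('X - 1) ^+ (n.+1 - j) * ('X + 1) ^+ j.-1).
  rewrite derivZ derivM !deriv_exp derivXB1 derivXD1.
  by rewrite !mul1r scalerDr scale_mulrn scale_mulrnr.
rewrite (eq_bigr _ (fun (j : 'I_n.+2) _ => E j)) big_split /=; congr (_ + _).
  rewrite big_ord_recr /= subnn mul0r scale0r addr0.
  by apply: eq_bigr => j _; rewrite subSn // -ltnS.
rewrite big_ord_recl /= mul0r scale0r add0r.
by apply: eq_bigr => j _.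
Qed.

Lemma exp2_neq0 n : (2 : R) ^+ n != 0.
Proof. by rewrite expf_neq0 // pnatr_eq0. Qed.

Lemma deriv_jacobi a b n :
  (jacobi a b n.+1)^`() = ((n.+1%:R + a + b + 1) / 2) *: jacobi (a + 1) (b + 1) n.
Proof.
rewrite !jacobi_hsum derivZ deriv_hsum scalerA.
rewrite exprS invfM !hsumZ; apply: eq_hsum => j jn.
rewrite subSn //.
have e : n%:R + (a + 1) = n.+1%:R + a by rewrite -[n.+1%:R]natr1; ring.
have e' : n%:R + (b + 1) = n.+1%:R + b by rewrite -[n.+1%:R]natr1; ring.
rewrite e e'.
have := gbinomS (n.+1%:R + b) (n - j).
have := gbinomS (n.+1%:R + a) j.
rewrite natrB // => h1 h2.
set G := gbinom _ j in h1 *; set G' := gbinom _ j.+1 in h1 *.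
set H := gbinom _ (n - j) in h2 *; set H' := gbinom _ (n - j).+1 in h2 *.
transitivity (2^-1 / 2 ^+ n * (G * ((n - j).+1%:R * H') + (j.+1%:R * G') * H)); first by ring.
by rewrite h1 h2 -[n.+1%:R]natr1; field; rewrite exp2_neq0.
Qed.

Lemma deriv_hsum_mulXD1 n u : ('X + 1) * (hsum n u)^`() =
  hsum n (fun j => (if j is j'.+1 then (n - j')%:R * u j' else 0) + j%:R * u j).
Proof.
case: n => [|n].
  rewrite /hsum !big_ord1 /= subn0 !expr0 !mulr1 -polyC1 -mul_polyC derivM !derivC.
  by rewrite !mul0r mulr0 !addr0 mulr0 scale0r.
rewrite deriv_hsum mulXD1_hsum; apply: eq_hsum => -[|j] jn //=.
by rewrite mul0r addr0.
Qed.

(** This is the rule ((1+x)^b P_n^(a,b))' = (n+b) (1+x)^(b-1) P_n^(a+1,b-1) with the powers of 1 + x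
    removed. *)
Lemma jacobi_mulXD1 a b n :
  b *: jacobi a b n + ('X + 1) * (jacobi a b n)^`() =
  (n%:R + b) *: jacobi (a + 1) (b - 1) n.
Proof.
rewrite !jacobi_hsum derivZ -scalerAr deriv_hsum_mulXD1 !hsumZ hsumD.
apply: eq_hsum => -[|j] jn.
  rewrite !gbinom0 subn0 !mul0r !addr0 mulr0 addr0 !mul1r.
  have h := gbinom_absorb (n%:R + b) n.
  by rewrite -[_ + (b - 1)]/(_) addrA [RHS]mulrCA h; ring.
have e : n%:R + (a + 1) = n%:R + a + 1 by rewrite addrA.
have e' : n%:R + (b - 1) = n%:R + b - 1 by rewrite addrA.
rewrite e e' gbinom_pascal.
have h := gbinom_absorb (n%:R + b) (n - j.+1).
have g := gbinomS (n%:R + b) (n - j.+1).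
rewrite -subSn // subSS in g.
have k : (n - j.+1)%:R = n%:R - j%:R - 1 :> R by rewrite natrB // -natr1; ring.
rewrite natrB ?(ltnW jn)// in g *.
rewrite k in h g *.
set G := gbinom (n%:R + b) (n - j) in g *.
set H := gbinom (n%:R + b) (n - j.+1) in h g *.
set K := gbinom (n%:R + b - 1) (n - j.+1) in h *.
set A := gbinom _ j; set A' := gbinom _ j.+1.
transitivity ((2 ^- n) * (((n%:R - j%:R) * G) * A + (b + j.+1%:R) * A' * H)); first by ring.
rewrite g; transitivity ((2^-n) * (A + A') * ((n%:R + b) * K)); last by ring.
by rewrite h -natr1; ring.
Qed.

(** This is one step of Rodrigues' formula, ((1-x)^a (1+x)^b P_n^(a,b))' = -2(n+1) (1-x)^(a-1)
    (1+x)^(b-1) P_(n+1)^(a-1,b-1), with the powers removed. *)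
Lemma jacobi_lift a b n :
  (b%:P * (1 - 'X) - a%:P * (1 + 'X)) * jacobi a b n +
     (1 - 'X ^+ 2) * (jacobi a b n)^`() =
  (- 2 * n.+1%:R) *: jacobi (a - 1) (b - 1) n.+1.
Proof.
have -> : (b%:P * (1 - 'X) - a%:P * (1 + 'X)) * jacobi a b n +
     (1 - 'X ^+ 2) * (jacobi a b n)^`() =
  - (('X - 1) * (b *: jacobi a b n + ('X + 1) * (jacobi a b n)^`()) +
    a *: (('X + 1) * jacobi a b n)).
  by rewrite -!mul_polyC; ring.
rewrite jacobi_mulXD1 !jacobi_hsum -!scalerAr mulXB1_hsum mulXD1_hsum.
rewrite -scaleN1r !hsumZ hsumD hsumZ; apply: eq_hsum => j jn.
have e (c : R) : n.+1%:R + (c - 1) = n%:R + c by rewrite -[n.+1%:R]natr1; ring.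
have e1 : n%:R + (a + 1) = n%:R + a + 1 by rewrite addrA.
have e2 : n%:R + (b - 1) = n%:R + b - 1 by rewrite addrA.
rewrite !e e1 e2 exprS invfM.
have h2 := exp2_neq0 n.
case: j jn => [|j] jn.
  rewrite !gbinom0 !subn0 /=.
  have h := gbinom_absorb (n%:R + b) n.
  have g := gbinomS (n%:R + b) n.
  transitivity (- (2 ^-n) * ((n%:R + b) * gbinom (n%:R + b - 1) n)); first by ring.
  rewrite h -g; by field.
rewrite subSS eqSS.
(* In the top coefficient the multiple of X - 1 contributes nothing. *)
have [->|jn'] := eqVneq j n.
  rewrite subnn !gbinom0.
  have := gbinomS (n%:R + a) n => g.
  transitivity (- (2 ^- n) * (n.+1%:R * gbinom (n%:R + a) n.+1)); last by field.
  by rewrite g; ring.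
have {jn jn'}jn : (j < n)%N by rewrite ltn_neqAle jn' -ltnS.
rewrite gbinom_pascal.
have h := gbinom_absorb (n%:R + b) (n - j.+1).
have g := gbinomS (n%:R + b) (n - j.+1).
have g' := gbinomS (n%:R + a) j.
rewrite -subSn // subSS in g.
have k : (n - j.+1)%:R = n%:R - j%:R - 1 :> R by rewrite natrB // -natr1; ring.
rewrite natrB ?(ltnW jn)// in g *.
rewrite k in h g *.
set G := gbinom (n%:R + b) (n - j) in g *.
set H := gbinom (n%:R + b) (n - j.+1) in h g *.
set K := gbinom (n%:R + b - 1) (n - j.+1) in h *.
set A := gbinom _ j in g' *; set A' := gbinom _ j.+1 in g' *.
transitivity (-(2 ^- n) * ((A + A') * ((n%:R + b) * K) + a * A * G)); first by ring.
transitivity (-(2 ^- n) * (((j.+1%:R * A') + (n%:R - j%:R) * A') * G)); last first.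
  by rewrite -!natr1; field.
rewrite h; have -> : (n%:R + b - (n%:R - j%:R - 1)) * H = (n%:R - j%:R) * G.
  by rewrite g; ring.
by rewrite g'; ring.
Qed.

Lemma scaleM (c d : R) (A B : {poly R}) : (c *: A) * (d *: B) = (c * d) *: (A * B).
Proof. by rewrite -scalerAl -scalerAr scalerA. Qed.

Lemma jacobi_flip a b n : jacobi a b n \Po (- 'X) = (-1) ^+ n *: jacobi b a n.
Proof.
rewrite !jacobi_hsum comp_polyZ scalerA mulrC -scalerA; congr (_ *: _).
rewrite /hsum raddf_sum /= (reindex_inj rev_ord_inj) scaler_sumr /=.
apply: eq_bigr => j _; rewrite subSS.
have jn : (j <= n)%N by rewrite -ltnS.
rewrite comp_polyZ subKn // scalerA rmorphM /= !rmorphXn /= !rmorphD /= !rmorphN /= comp_polyX.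
rewrite rmorph1.
have -> : - 'X - 1 = (-1) *: ('X + 1) :> {poly R} by rewrite scaleN1r; ring.
have -> : - 'X + 1 = (-1) *: ('X - 1) :> {poly R} by rewrite scaleN1r; ring.
have -> : (-1) ^+ n = (-1) ^+ j * (-1) ^+ (n - j) :> R by rewrite -exprD subnKC.
rewrite !exprZn scaleM scalerA.
congr (_ *: _); last exact: mulrC.
by move: (gbinom _ _) (gbinom _ _) ((-1) ^+ _) ((-1) ^+ _) => c d e f; ring.
Qed.

(** The mirror image of [jacobi_mulXD1] under x -> -x: it computes the derivative of (1-x)^a
    P_n^(a,b). *)
Lemma jacobi_mulXB1 a b n :
  - a *: jacobi a b n + (1 - 'X) * (jacobi a b n)^`() =
  - (n%:R + a) *: jacobi (a - 1) (b + 1) n.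
Proof.
have := congr1 (comp_poly (- 'X)) (jacobi_mulXD1 b a n).
rewrite comp_polyD comp_polyM (comp_polyZ a) (comp_polyZ (n%:R + a)) !jacobi_flip comp_polyD comp_polyX rmorph1.
have -> : (jacobi b a n)^`() \Po (-'X) = - ((-1)^+n *: (jacobi a b n)^`()).
  rewrite -derivZ -jacobi_flip deriv_comp derivN derivX.
  by rewrite mulrN1 opprK.
have s : (-1) ^+ n != 0 :> R by rewrite signr_eq0.
move=> h; apply: (scalerI s).
move: h; rewrite mulrN -scalerAr !scalerDr => h.
have swap (c d : R) (p : {poly R}) : c *: (d *: p) = d *: (c *: p).
  by rewrite !scalerA mulrC.
rewrite [in LHS](swap _ (- a)) [in RHS]swap !scaleNr -h opprB addrC.
by rewrite [- 'X + 1]addrC.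
Qed.

Lemma jacobi_at1 a b n : (jacobi a b n).[1] = gbinom (n%:R + a) n.
Proof.
have h0 : ('X - 1 : {poly R}).[1] = 0 by rewrite -polyC1 hornerXsubC subrr.
have h2 : ('X + 1 : {poly R}).[1] = 2 by rewrite -polyC1 hornerD hornerX hornerC.
rewrite jacobi_hsum hornerZ /hsum horner_sum big_ord_recr /= big1 => [|j _]; last first.
  rewrite hornerZ hornerM horner_exp h0 expr0n.
  by rewrite subn_eq0 leqNgt ltn_ord mul0r mulr0.
rewrite add0r subnn expr0 mul1r gbinom0 mulr1 hornerZ horner_exp h2.
by rewrite mulrCA mulVf ?exp2_neq0 // mulr1.
Qed.

Lemma derivn_jacobi a b n k : (k <= n)%N ->
  (jacobi a b n)^`(k) = ((k`!)%:R * gbinom (n%:R + a + b + k%:R) k / 2 ^+ k) *: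
    jacobi (a + k%:R) (b + k%:R) (n - k).
Proof.
elim: k => [|k IH] kn; first by rewrite derivn0 fact0 gbinom0 expr0 !mul1r invr1 scale1r !addr0 subn0.
rewrite derivnS IH 1?ltnW // derivZ.
have e : (n - k = (n - k.+1).+1)%N by rewrite subnSK.
have en : (n - k.+1).+1%:R = n%:R - k%:R :> R by rewrite -e natrB // ltnW.
have ek : k.+1%:R = k%:R + 1 :> R by rewrite natr1.
rewrite e deriv_jacobi scalerA en ek !addrA; congr (_ *: _).
rewrite exprS factS natrM ek.
have /= h := gbinom_absorb (n%:R + a + b + k%:R + 1) k; rewrite addrK in h.
have /= g := gbinomS (n%:R + a + b + k%:R + 1) k.
rewrite ek -h in g.
set G' := gbinom _ k.+1 in g *; set H := gbinom _ k in g h *.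
transitivity ((k`!)%:R / (2 * 2 ^+ k) * ((n%:R + a + b + k%:R + 1) * H)).
  by field; rewrite exp2_neq0.
by rewrite -g; field; rewrite exp2_neq0.
Qed.

Lemma jacobi0 a b : jacobi a b 0 = 1.
Proof.
rewrite jacobi_hsum /hsum big_ord1 subn0 !gbinom0 mulr1 !expr0 mulr1.
by rewrite invr1 !scale1r.
Qed.

End GeneralizedBinomial.

(** * The Mehler-Heine asymptotics, coefficientwise *)

Section DominatedConvergence.
Variable R : realType.
Implicit Types (p q : nat -> {poly R}) (c d : nat -> R).

(** The bounds are the coefficients of C exp(r t). They survive sums, products and derivation, and
    they give uniform convergence on bounded sets ([dcvg_unif]). *)
Definition dcvg p c :=
  (forall k, (fun n => (p n)`_k) @ \oo --> c k) /\
  exists C r : R, [/\ 0 <= C, 0 <= r &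
    \forall n \near \oo, forall k, `|(p n)`_k| <= C * (r ^+ k / (k`!)%:R)].

Lemma dcvg_bound p c : dcvg p c -> exists C r : R, [/\ 0 <= C, 0 <= r &
  forall k, `|c k| <= C * (r ^+ k / (k`!)%:R)].
Proof.
move=> [pc [C [r [C0 r0 h]]]]; exists C, r; split=> // k.
rewrite -(cvg_lim _ (cvg_norm (pc k))) //.
apply: limr_le; first by apply: is_cvg_norm; apply/cvg_ex; exists (c k); exact: pc.
by near=> n; have : forall k, `|(p n)`_k| <= C * (r ^+ k / (k`!)%:R) by near: n.
Unshelve. all: by end_near. Qed.

Lemma dcvgD p q c d : dcvg p c -> dcvg q d -> dcvg (fun n => p n + q n) (fun k => c k + d k).
Proof.
move=> [pc [C [r [C0 r0 h]]]] [qd [C' [r' [C'0 r'0 h']]]]; split.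
  move=> k; have -> : (fun n => (p n + q n)`_k) = (fun n => (p n)`_k + (q n)`_k).
    by apply/funext => n; rewrite coefD.
  exact: cvgD.
exists (C + C'), (r + r'); split; rewrite ?addr_ge0 //.
near=> n => k; rewrite coefD mulrDl (le_trans (ler_normD _ _)) // lerD //.
  have /(_ k) H : forall k, `|(p n)`_k| <= C * (r ^+ k / (k`!)%:R) by near: n.
  apply: (le_trans H); rewrite ler_wpM2l // ler_wpM2r //.
  by rewrite lerXn2r ?nnegrE ?addr_ge0 // lerDl.
have /(_ k) H : forall k, `|(q n)`_k| <= C' * (r' ^+ k / (k`!)%:R) by near: n.
apply: (le_trans H); rewrite ler_wpM2l // ler_wpM2r //.
by rewrite lerXn2r ?nnegrE ?addr_ge0 // lerDr.
Unshelve. all: by end_near. Qed.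

Lemma dcvgM p q c d : dcvg p c -> dcvg q d ->
  dcvg (fun n => p n * q n) (fun k => \sum_(j < k.+1) c j * d (k - j)%N).
Proof.
move=> [pc [C [r [C0 r0 h]]]] [qd [C' [r' [C'0 r'0 h']]]]; split.
  move=> k; have -> : (fun n => (p n * q n)`_k) =
      (fun n => \sum_(j < k.+1) (p n)`_j * (q n)`_(k - j)).
    by apply/funext => n; rewrite coefM.
  apply: cvg_big => [|j _]; first exact: add_continuous.
  by apply: cvgM; [exact: pc | exact: qd].
exists (C * C'), (r + r'); split; rewrite ?mulr_ge0 ?addr_ge0 //.
near=> n => k; rewrite coefM (le_trans (ler_norm_sum _ _ _)) //.
have H : forall k, `|(p n)`_k| <= C * (r ^+ k / (k`!)%:R) by near: n.
have H' : forall k, `|(q n)`_k| <= C' * (r' ^+ k / (k`!)%:R) by near: n.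
(* By the binomial theorem, the Cauchy product of the two exponential bounds is the exponential
   bound of rate r + r'. *)
have E : C * C' * ((r + r') ^+ k / (k`!)%:R) =
    \sum_(j < k.+1) (C * (r ^+ j / (j`!)%:R)) * (C' * (r' ^+ (k - j) / ((k - j)`!)%:R)).
  rewrite addrC exprDn mulr_suml mulr_sumr; apply: eq_bigr => j _.
  have jk : (j <= k)%N by rewrite -ltnS.
  rewrite -[in LHS]mulr_natr.
  have := bin_fact jk => /(congr1 (fun n => n%:R : R)); rewrite !natrM => <-.
  have := fact_gt0 j; have := fact_gt0 (k - j); rewrite -!(ltr0n R) => f1 f2.
  have b0 : 0 < 'C(k, j)%:R :> R by rewrite ltr0n bin_gt0.
  by field; rewrite !gt_eqF.
by rewrite E; apply: ler_sum => j _; rewrite normrM ler_pM.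
Unshelve. all: by end_near. Qed.

Lemma dcvg_deriv p c : dcvg p c -> dcvg (fun n => (p n)^`()) (fun k => k.+1%:R * c k.+1).
Proof.
move=> [pc [C [r [C0 r0 h]]]]; split.
  move=> k; have -> : (fun n => (p n)^`()`_k) = (fun n => k.+1%:R * (p n)`_k.+1).
    by apply/funext => n; rewrite coef_deriv mulr_natl.
  by apply: cvgMr; exact: pc.
exists (C * r), r; split; rewrite ?mulr_ge0 //; near=> n => k.
have /(_ k.+1) H : forall k, `|(p n)`_k| <= C * (r ^+ k / (k`!)%:R) by near: n.
rewrite coef_deriv normrMn -[_ *+ k.+1]mulr_natl.
apply: (@le_trans _ _ (k.+1%:R * (C * (r ^+ k.+1 / (k.+1`!)%:R)))).
  by rewrite ler_wpM2l.
rewrite le_eqVlt; apply/orP; left; apply/eqP; rewrite exprS factS natrM.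
have := fact_gt0 k; rewrite -(ltr0n R) => f1; have f2 : 0 < k.+1%:R :> R by [].
by field; rewrite !gt_eqF // addrC natr1.
Unshelve. all: by end_near. Qed.

Lemma dcvg_derivn p c i : dcvg p c ->
  dcvg (fun n => (p n)^`(i)) (fun k => ((k + i)`!)%:R / (k`!)%:R * c (k + i)%N).
Proof.
elim: i => [|i IH] pc.
  suff <- : c = (fun k => ((k + 0)`!)%:R / (k`!)%:R * c (k + 0)%N) by [].
  by apply/funext => k; rewrite addn0 divff ?mul1r // pnatr_eq0 -lt0n fact_gt0.
have -> : (fun n => (p n)^`(i.+1)) = (fun n => (p n)^`(i)^`()).
  by apply/funext => n; rewrite derivnS.
have := dcvg_deriv (IH pc); congr dcvg; apply/funext => k; rewrite addSnnS factS natrM.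
have := fact_gt0 k; rewrite -(ltr0n R) => f1; have f2 : 0 < k.+1%:R :> R by [].
by field; rewrite !gt_eqF // addrC natr1.
Qed.

Lemma dcvg_drop p c l : dcvg p c -> dcvg (fun n => drop_poly l (p n)) (fun k => c (k + l)%N).
Proof.
move=> [pc [C [r [C0 r0 h]]]]; split.
  move=> k; have -> : (fun n => (drop_poly l (p n))`_k) = (fun n => (p n)`_(k + l)).
    by apply/funext => n; rewrite coef_drop_poly.
  exact: pc.
exists (C * r ^+ l), r; split; rewrite ?mulr_ge0 ?exprn_ge0 //; near=> n => k.
have /(_ (k + l)%N) H : forall k, `|(p n)`_k| <= C * (r ^+ k / (k`!)%:R) by near: n.
rewrite coef_drop_poly (le_trans H) // -!mulrA ler_wpM2l // mulrA -exprD addnC.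
rewrite ler_wpM2l ?exprn_ge0 // lef_pV2 ?posrE ?ltr0n ?fact_gt0 // ler_nat.
by apply: leq_fact; rewrite leq_addl.
Unshelve. all: by end_near. Qed.

(** Finitely many convergent coefficients are eventually bounded; the factor m! in the constant
    absorbs the 1/k! with k < m. *)
Lemma dcvg_poly (m : nat) p c : (forall k, (fun n => (p n)`_k) @ \oo --> c k) ->
  (forall n, (size (p n) <= m)%N) -> dcvg p c.
Proof.
move=> pc sp; split => //.
have [C C0 hC] : exists2 C : R, 0 <= C &
    \forall n \near \oo, forall k, (k < m)%N -> `|(p n)`_k| <= C.
  elim: m {sp} => [|m [C C0 IH]]; first by exists 0 => //; exact: nearW.
  exists (Num.max C (`|c m| + 1)); first by rewrite le_max C0.
  near=> n => k; rewrite ltnS leq_eqVlt => /orP[/eqP ->|km].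
    rewrite le_max; apply/orP; right.
    have : `|c m - (p n)`_m| < 1 by near: n; move: (pc m) => /cvgrPdist_lt; exact.
    move=> h1; rewrite -[(p n)`_m](subrKC (c m)) (le_trans (ler_normD _ _)) // lerD2l.
    by rewrite distrC ltW.
  rewrite le_max; have : forall k, (k < m)%N -> `|(p n)`_k| <= C by near: n.
  by move=> -> .
exists (C * (m`!)%:R), 1; split; rewrite ?mulr_ge0 //; near=> n => k.
have [km|mk] := ltnP k m; last first.
  by rewrite nth_default ?(leq_trans (sp n)) // normr0 !mulr_ge0 // expr1n divr_ge0.
have H : forall k, (k < m)%N -> `|(p n)`_k| <= C by near: n.
rewrite expr1n (le_trans (H k km)) // -mulrA ler_peMr //.
by rewrite mul1r ler_pdivlMr ?ltr0n ?fact_gt0 // mul1r ler_nat; apply/leq_fact/ltnW.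
Unshelve. all: by end_near. Qed.

(** The coefficients below K form a polynomial of bounded degree, covered by [dcvg_poly]. The bound
    for Jacobi polynomials is only available when a + k >= 0, hence this form. *)
Lemma dcvg_weaken p c K : (forall k, (fun n => (p n)`_k) @ \oo --> c k) ->
  (exists C r : R, [/\ 0 <= C, 0 <= r & \forall n \near \oo, forall k, (K <= k)%N ->
    `|(p n)`_k| <= C * (r ^+ k / (k`!)%:R)]) -> dcvg p c.
Proof.
move=> pc [C [r [C0 r0 h]]].
have [||_ [C' [r' [C'0 r'0 h']]]] := @dcvg_poly K (fun n => take_poly K (p n))
  (fun k => if (k < K)%N then c k else 0).
- move=> k; have -> : (fun n => (take_poly K (p n))`_k) =
    (fun n => if (k < K)%N then (p n)`_k else 0).
    by apply/funext => n; rewrite coef_take_poly.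
  by case: ifP => _; [exact: pc | exact: cvg_cst].
- by move=> n; exact: size_take_poly.
split=> //; exists (C + C'), (r + r'); split; rewrite ?addr_ge0 //; near=> n => k.
have H : forall k, (K <= k)%N -> `|(p n)`_k| <= C * (r ^+ k / (k`!)%:R) by near: n.
have H' : forall k, `|(take_poly K (p n))`_k| <= C' * (r' ^+ k / (k`!)%:R) by near: n.
have X : r ^+ k <= (r + r') ^+ k by rewrite lerXn2r ?nnegrE ?addr_ge0 // lerDl.
have X' : r' ^+ k <= (r + r') ^+ k by rewrite lerXn2r ?nnegrE ?addr_ge0 // lerDr.
rewrite mulrDl; have [Kk|kK] := leqP K k.
  rewrite (le_trans (H k Kk)) // ler_wpDr ?mulr_ge0 ?exprn_ge0 ?addr_ge0 //.
  by rewrite ler_wpM2l // ler_wpM2r.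
have := H' k; rewrite coef_take_poly kK => {}H'.
rewrite (le_trans H') // ler_wpDl ?mulr_ge0 ?exprn_ge0 ?addr_ge0 //.
by rewrite ler_wpM2l // ler_wpM2r.
Unshelve. all: by end_near. Qed.

(** As w tends to 0, B(1 - w t) tends to the constant B(1): the coefficients B_i of the Wronskian
    enter the limit only through their values at 1. *)
Lemma dcvg_comp_lin (B : {poly R}) (w : nat -> R) : w @ \oo --> 0 ->
  dcvg (fun n => B \Po (1 - w n *: 'X)) (fun k => if k == 0%N then B.[1] else 0).
Proof.
move=> w0; have pol (f : nat -> R) (l : R) : f @ \oo --> l ->
    dcvg (fun n => (f n)%:P) (fun k => if k == 0%N then l else 0).
  move=> fl; apply: (@dcvg_poly 1) => [k|n]; last exact: size_polyC_leq1.
  rewrite (_ : (fun n => _) = fun n => if k == 0%N then f n else 0); last first.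
    by apply/funext => n; rewrite coefC.
  by case: eqP => _ //; exact: cvg_cst.
have lin : dcvg (fun n => 1 - w n *: 'X) (fun k => if k == 0%N then 1 else 0).
  apply: (@dcvg_poly 2) => [k|n]; last first.
    rewrite -polyC1 (leq_trans (size_polyD _ _)) // geq_max size_polyN.
    rewrite (leq_trans (size_polyC_leq1 _)) //=.
    by rewrite (leq_trans (size_scale_leq _ _)) // size_polyX.
  rewrite (_ : (fun n => _) = fun n => (k == 0%N)%:R - w n * (k == 1%N)%:R); last first.
    by apply/funext => n; rewrite coefB coef1 coefZ coefX.
  have -> : (if k == 0%N then 1 else 0) = (k == 0%N)%:R - 0 * (k == 1%N)%:R :> R.
    by case: eqP; rewrite mul0r subr0.
  by apply: cvgB; [exact: cvg_cst | apply: cvgMl].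
have cst (c : R) : dcvg (fun=> c%:P) (fun k => if k == 0%N then c else 0).
  by apply: pol; exact: cvg_cst.
elim/poly_ind: B => [|p c IH].
  have := cst 0; rewrite horner0; congr dcvg.
  by apply/funext => n; rewrite comp_poly0.
have := dcvgD (dcvgM IH lin) (cst c); congr dcvg.
  by apply/funext => n; rewrite comp_polyD comp_polyM comp_polyX comp_polyC.
apply/funext => k; rewrite hornerD hornerM hornerX hornerC mulr1.
rewrite big_ord_recl /= big1 => [|i _]; last by rewrite mul0r.
by rewrite subn0 addr0; case: eqP; rewrite ?mulr1 ?mulr0 ?addr0.
Qed.
End DominatedConvergence.

(** * Rescaled Jacobi polynomials at 1 *)

Section MehlerHeine.
Variable R : realType.
Implicit Types (a b z : R).

Lemma coef_comp_lin (p : {poly R}) (w : R) k :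
  (p \Po (1 - w *: 'X))`_k = (p^`N(k)).[1] * (- w) ^+ k.
Proof.
rewrite /comp_poly -scaleNr nderiv_taylor; last exact: mulrC.
have E i : (p^:P)^`N(i).[1] * (- w *: 'X) ^+ i = ((p^`N(i)).[1] * (- w) ^+ i) *: 'X^i :> {poly R}.
  by rewrite nderivn_map -[X in _.[X]]polyC1 horner_map /= exprZn mul_polyC scalerA.
rewrite (eq_bigr _ (fun (i : 'I_(size p^:P)) _ => E i)) coef_sum.
rewrite size_map_inj_poly //; [|exact: polyC_inj].
have [kp|pk] := ltnP k (size p).
  rewrite (bigD1 (Ordinal kp)) //= coefZ coefXn eqxx mulr1 big1 ?addr0 // => i ik.
  by rewrite coefZ coefXn eq_sym (negPf (_ : i != k :> nat)) ?mulr0 //.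
rewrite big1 => [|i _].
  have -> : p^`N(k) = 0; last by rewrite horner0 mul0r.
  by apply/eqP; rewrite -size_poly_eq0 -leqn0 (leq_trans (size_poly _ _)) // leqn0 subn_eq0.
by rewrite coefZ coefXn gtn_eqF ?mulr0 // (leq_trans (ltn_ord i)).
Qed.

Lemma gbinom_prodE (m : nat) z :
  gbinom (m%:R + z) m = (\prod_(i < m) (z + 1 + i%:R)) / (m`!)%:R.
Proof.
rewrite /gbinom; congr (_ / _).
rewrite (reindex_inj rev_ord_inj) /=; apply: eq_bigr => i _.
by rewrite natrB // -[i.+1%:R]natr1; ring.
Qed.

(** Induction on m: the new factor 1 + z/(m+2) is at most exp(z/(m+2)), hence at most
    ((m+2)/(m+1))^z, because 1/(m+2) <= ln(1 + 1/(m+1)). *)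
Lemma gbinom_le_powR (m : nat) z : (0 < m)%N -> 0 <= z ->
  0 <= gbinom (m%:R + z) m <= expR z * m%:R `^ z.
Proof.
move=> m0 z0; rewrite gbinom_prodE; apply/andP; split.
  rewrite divr_ge0 // prodr_ge0 // => i _; rewrite !addr_ge0 //.
case: m m0 => // m _; elim: m => [|m IH].
  by rewrite big_ord1 -[1`!]/1%N addr0 divr1 powR1 mulr1 addrC expR_ge1Dx.
rewrite big_ord_recr /= factS natrM.
have f0 : (m.+1)`!%:R != 0 :> R by exact: fact_neq0.
have p0 : 0 < m.+2%:R :> R by [].
have p1 : 0 < m.+1%:R :> R by [].
set A := \prod_(i < _) _ in IH *.
have -> : A * (z + 1 + m.+1%:R) / (m.+2%:R * (m.+1)`!%:R) = A / (m.+1)`!%:R * (1 + z / m.+2%:R).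
  have -> : z + 1 + m.+1%:R = z + m.+2%:R by rewrite -[m.+2%:R]natr1; ring.
  by field; rewrite f0 gt_eqF.
apply: (@le_trans _ _ (expR z * m.+1%:R `^ z * (1 + z / m.+2%:R))).
  by rewrite ler_wpM2r // addr_ge0 // divr_ge0.
rewrite -mulrA ler_pM2l ?expR_gt0 //.
have -> : m.+2%:R `^ z = m.+1%:R `^ z * expR (z * ln (1 + m.+1%:R^-1)).
  have -> : m.+2%:R = m.+1%:R * (1 + m.+1%:R^-1) :> R.
    by rewrite -[m.+2%:R]natr1 mulrDr mulr1 divff ?gt_eqF.
  rewrite powRM ?ltW // ?addr_gt0 ?invr_gt0 //.
  by rewrite [(1 + _) `^ _]/powR gt_eqF // addr_gt0 ?invr_gt0.
rewrite ler_pM2l ?powR_gt0 //; apply: (le_trans (expR_ge1Dx _)).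
by rewrite ler_expR ler_wpM2l // ln1DV_ge.
Qed.

Definition scaled_jacobi a b (s : nat) : {poly R} :=
  (s%:R `^ (- a)) *: (jacobi a b s \Po (1 - (2 / s%:R ^+ 2) *: 'X)).

(** The powers of s are distributed so that the two bracketed factors tend to 1/Gamma(a+k+1) and to
    1/k!. *)
Lemma coef_scaled_jacobi a b s k : (0 < s)%N -> (k <= s)%N ->
  (scaled_jacobi a b s)`_k = (-1) ^+ k *
    (gbinom ((s - k)%:R + (a + k%:R)) (s - k) * s%:R `^ (- (a + k%:R))) *
    (gbinom (s%:R + a + b + k%:R) k / s%:R ^+ k).
Proof.
move=> s0 ks; rewrite coefZ coef_comp_lin.
have p0 : 0 < s%:R :> R by rewrite ltr0n.
have f0 : (k`!)%:R != 0 :> R by exact: fact_neq0.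
have -> : (jacobi a b s)^`N(k).[1] =
   gbinom (s%:R + a + b + k%:R) k / 2 ^+ k * gbinom ((s - k)%:R + (a + k%:R)) (s - k).
  apply: (mulfI f0); rewrite mulr_natl -hornerMn -nderivn_def derivn_jacobi //.
  by rewrite hornerZ jacobi_at1 !mulrA.
have -> : s%:R `^ (- a) = s%:R `^ (- (a + k%:R)) * s%:R ^+ k.
  rewrite -powR_mulrn ?ltW // -powRD; last by rewrite (gt_eqF p0) implybT.
  by congr (_ `^ _); ring.
rewrite -mulNr exprMn exprVn -exprM mulnC exprM -[- 2]mulN1r exprMn.
set g := gbinom _ _; set h := gbinom _ _; set w := _ `^ _.
have n2 : (2 : R) ^+ k != 0 by rewrite expf_neq0.
have n3 : s%:R ^+ k != 0 :> R by rewrite expf_neq0 // gt_eqF.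
by rewrite expr2; field; rewrite n2 n3.
Qed.

Lemma coef_scaled_jacobi_gt a b s k : (s < k)%N -> (scaled_jacobi a b s)`_k = 0.
Proof.
move=> sk; rewrite coefZ coef_comp_lin.
have -> : (jacobi a b s)^`N(k) = 0; last by rewrite horner0 mul0r mulr0.
apply/eqP; rewrite -size_poly_eq0 -leqn0 (leq_trans (size_poly _ _)) // leqn0 subn_eq0.
apply: leq_trans sk; rewrite (leq_trans (size_scale_leq _ _)) //.
apply: (leq_trans (size_sum _ _ _)); apply/bigmax_leqP => i _.
rewrite (leq_trans (size_scale_leq _ _)) // (leq_trans (size_polyMleq _ _)) //.
rewrite -polyC1 size_exp_XsubC.
have -> : 'X + 1%:P = 'X - (-1)%:P :> {poly R} by rewrite polyCN opprK.
by rewrite size_exp_XsubC addSn /= addnS subnK // -ltnS.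
Qed.

(** Written with 1/Gamma it makes sense for every real a; when a = -l with l a positive integer, the
    coefficients with k < l are 0. *)
Definition bessel_coef a (k : nat) : R := (-1) ^+ k * inv_Gamma (a + k%:R + 1) / (k`!)%:R.

Lemma cvg_gbinom_fact a k :
  (fun s : nat => gbinom (s%:R + a) k / s%:R ^+ k) @ \oo --> ((k`!)%:R^-1 : R).
Proof.
have h : (fun s : nat => (\prod_(i < k) ((s%:R + (a - i%:R)) / (s%:R + 0))) / (k`!)%:R)
    @ \oo --> ((k`!)%:R^-1 : R).
  rewrite -[X in _ --> X]mul1r; apply: cvgMl.
  have e1 : \prod_(i < k) 1 = 1 :> R by rewrite big1.
  rewrite -[X in _ --> X]e1.
  apply: cvg_big => [|i _]; [exact: mul_continuous | exact: cvg_ratio].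
apply: cvg_trans h; apply: near_eq_cvg; near=> s.
rewrite /gbinom prodf_div prodr_const card_ord addr0 mulrAC; congr (_ / _ / _).
by apply: eq_bigr => i _; rewrite addrA.
Unshelve. all: by end_near. Qed.

Lemma cvg_coef_scaled_jacobi a b k :
  (fun s => (scaled_jacobi a b s)`_k) @ \oo --> bessel_coef a k.
Proof.
have h : (fun s : nat => (-1) ^+ k *
    ((\prod_(i < s - k) (a + k%:R + 1 + i%:R)) / ((s - k)`!)%:R * (s - k)%:R `^ (1 - (a + k%:R + 1))
      * ((s - k)%:R / s%:R) `^ (a + k%:R)) *
    (gbinom (s%:R + (a + b + k%:R)) k / s%:R ^+ k)) @ \oo --> bessel_coef a k.
  apply: cvgM; last exact: cvg_gbinom_fact.
  apply: cvgMr; rewrite -[X in _ --> X]mulr1; apply: cvgM; last exact: cvg_powR_ratio.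
  rewrite -(cvg_shiftn k) /=.
  have := @cvg_prod_inv_Gamma R (a + k%:R + 1).
  by apply: cvg_trans; apply: near_eq_cvg; near=> s; rewrite addnK.
apply: cvg_trans h; apply: near_eq_cvg; near=> s.
have ks : (k < s)%N by near: s; exact: nbhs_infty_gt.
have s0 : (0 < s)%N by exact: leq_ltn_trans ks.
have p0 : 0 < s%:R :> R by rewrite ltr0n.
have p1 : 0 < (s - k)%:R :> R by rewrite ltr0n subn_gt0.
rewrite coef_scaled_jacobi //; last exact: ltnW.
rewrite -gbinom_prodE -[in RHS]addrA; congr (_ * _ * (gbinom _ _ / _)); last by rewrite !addrA.
rewrite -[in LHS]mulrA; congr (_ * _).
have -> : 1 - (a + k%:R + 1) = - (a + k%:R) by ring.
move: (a + k%:R) => c.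
have -> : ((s - k)%:R / s%:R) `^ c = (s - k)%:R `^ c * s%:R `^ (- c).
  rewrite powRM ?invr_ge0 // powRN; congr (_ * _).
  by rewrite -powR_inv1 // -powRrM mulN1r powRN.
by rewrite powRN mulrA mulVf ?mul1r // gt_eqF // powR_gt0.
Unshelve. all: by end_near. Qed.

Lemma dcvg_scaled_jacobi a b : dcvg (scaled_jacobi a b) (bessel_coef a).
Proof.
apply: (@dcvg_weaken _ _ _ (Num.bound `|a|)); first exact: cvg_coef_scaled_jacobi.
(* Each factor s + a + b + k - i of the second binomial is at most A s in absolute value, as k <= s.
   The first binomial contributes exp(a + k), whence the rate A exp(1). *)
pose A := 2 + `|a + b|.
have A0 : 0 <= A by rewrite addr_ge0.
exists (expR a), (expR 1 * A); split; rewrite ?expR_ge0 ?mulr_ge0 ?expR_ge0 //.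
near=> s => k ak.
have s0 : (0 < s)%N by near: s; exact: nbhs_infty_gt.
have p0 : 0 < s%:R :> R by rewrite ltr0n.
have [ks|sk] := leqP k s; last first.
  by rewrite coef_scaled_jacobi_gt // normr0 !mulr_ge0 ?expR_ge0 // ?exprn_ge0 ?mulr_ge0 ?expR_ge0.
have z0 : 0 <= a + k%:R.
  rewrite -lerBlDl sub0r (le_trans (ler_norm _)) // normrN.
  by rewrite (le_trans (ltW (archi_boundP (normr_ge0 a)))) // ler_nat.
have X1 : `|gbinom ((s - k)%:R + (a + k%:R)) (s - k) * s%:R `^ (- (a + k%:R))| <= expR (a + k%:R).
  rewrite normrM [`|_ `^ _|]ger0_norm ?powR_ge0 // powRN ler_pdivrMr ?powR_gt0 //.
  have [sk0|sk0] := posnP (s - k).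
    rewrite sk0 gbinom0 normr1 -[leLHS]mulr1 ler_pM //.
      by rewrite -[leLHS](@expR0 R) ler_expR.
    by rewrite -[leLHS](powRr0 s%:R); apply: ler_powR => //; rewrite ler1n.
  have /andP[g0 g1] := gbinom_le_powR sk0 z0.
  rewrite ger0_norm // (le_trans g1) // ler_pM2l ?expR_gt0 //.
  by rewrite ge0_ler_powR // ?nnegrE // ler_nat leq_subr.
have X2 : `|gbinom (s%:R + a + b + k%:R) k / s%:R ^+ k| <= A ^+ k / (k`!)%:R.
  rewrite /gbinom !normrM normr_prod !normfV normrX !normr_nat mulrAC ler_wpM2r ?invr_ge0 //.
  rewrite ler_pdivrMr ?exprn_gt0 // -exprMn.
  have -> : (A * s%:R) ^+ k = \prod_(i < k) (A * s%:R) by rewrite prodr_const card_ord.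
  apply: ler_prod => i _; rewrite normr_ge0 /=.
  have -> : s%:R + a + b + k%:R - i%:R = s%:R + (a + b) + (k - i)%:R.
    by rewrite natrB 1?ltnW //; ring.
  rewrite (le_trans (ler_normD _ _)) // (le_trans (lerD (ler_normD _ _) (lexx _))) //.
  have h1 : `|a + b| <= `|a + b| * s%:R by rewrite ler_peMr // ler1n.
  have h2 : (k - i)%:R <= s%:R :> R by rewrite ler_nat (leq_trans (leq_subr _ _)).
  rewrite !normr_nat /A mulrDl; move: ((k - i)%:R : R) (s%:R : R) h1 h2 => u v.
  by move: (`|_| * v) => w; lra.
have -> : `|(scaled_jacobi a b s)`_k| =
    `|gbinom ((s - k)%:R + (a + k%:R)) (s - k) * s%:R `^ (- (a + k%:R))| *
    `|gbinom (s%:R + a + b + k%:R) k / s%:R ^+ k|.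
  rewrite coef_scaled_jacobi // normrM; congr (_ * _).
  by rewrite normrM normrX normrN1 expr1n mul1r.
apply: (le_trans (ler_pM _ _ X1 X2)) => //.
rewrite expRD -[k%:R]mul1r expRM_natr exprMn !mulrA.
by rewrite le_eqVlt eqxx.
Unshelve. all: by end_near. Qed.

End MehlerHeine.

(** * Power series dominated by an exponential *)

Section EntireSeries.
Variable R : realType.
Implicit Types (c : nat -> R) (t T : R).

Definition ebounded c := exists C r : R, [/\ 0 <= C, 0 <= r &
  forall k, `|c k| <= C * (r ^+ k / (k`!)%:R)].

Definition psum c t : R := limn (pseries c t).

Lemma ebounded_diffs c : ebounded c -> ebounded (pseries_diffs c).
Proof.
move=> [C [r [C0 r0 h]]]; exists (C * r), r; split; rewrite ?mulr_ge0 // => k.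
rewrite /pseries_diffs normrM normr_nat.
apply: (@le_trans _ _ (k.+1%:R * (C * (r ^+ k.+1 / (k.+1`!)%:R)))).
  by rewrite ler_wpM2l.
rewrite le_eqVlt; apply/orP; left; apply/eqP; rewrite exprS factS natrM.
have := fact_gt0 k; rewrite -(ltr0n R) => f1; have f2 : 0 < k.+1%:R :> R by [].
by field; rewrite !gt_eqF // addrC natr1.
Qed.

Lemma exp_coeff_term (r t : R) k : r ^+ k / (k`!)%:R * t ^+ k = exp_coeff (r * t) k.
Proof. by rewrite /exp_coeff /= exprMn mulrAC. Qed.

Lemma is_cvg_psum c t : ebounded c -> cvgn (pseries c t).
Proof.
move=> [C [r [C0 r0 h]]]; apply: normed_cvg.
apply: (@series_le_cvg _ _ (fun k => C * exp_coeff (r * `|t|) k)) => [k|k|k|].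
- exact: normr_ge0.
- by rewrite mulr_ge0 // exp_coeff_ge0 // mulr_ge0.
- by rewrite /= normrM normrX -exp_coeff_term mulrA ler_wpM2r // exprn_ge0.
apply: is_cvg_seriesZ; exact: is_cvg_series_exp_coeff.
Qed.

Lemma cvg_psum c t : ebounded c -> pseries c t @ \oo --> psum c t.
Proof. by move=> h; exact: is_cvg_psum. Qed.

Lemma is_derive_psum c t : ebounded c -> is_derive t 1 (psum c) (psum (pseries_diffs c) t).
Proof.
move=> h; apply: (@pseries_snd_diffs _ _ (`|t| + 1)).
- exact: is_cvg_psum.
- by apply: is_cvg_psum; exact: ebounded_diffs.
- by apply: is_cvg_psum; do 2!apply: ebounded_diffs.
by rewrite [ltRHS]ger0_norm ?addr_ge0 // ltrDl.
Qed.

Lemma psum0 c : ebounded c -> psum c 0 = c 0%N.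
Proof.
move=> h; apply: cvg_lim => //; rewrite -cvg_shiftS /=.
rewrite (_ : (fun n => _) = fun=> c 0%N); first exact: cvg_cst.
apply/funext => n; rewrite /pseries /series /= big_nat_recl //= expr0 mulr1.
by rewrite big1 ?addr0 // => i _; rewrite expr0n /= mulr0.
Qed.

Lemma dcvg_ebounded p c : dcvg p c -> ebounded c.
Proof. exact: dcvg_bound. Qed.

Lemma exp_tail (x e : R) : 0 <= x -> 0 < e -> exists K, forall M, (K <= M)%N ->
  \sum_(K <= k < M) exp_coeff x k <= e.
Proof.
move=> x0 e0; have hc := is_cvg_series_exp_coeff x.
have hn : nondecreasing_seq (series (exp_coeff x)).
  by apply/nondecreasing_seqP => n; rewrite seriesSr lerDl exp_coeff_ge0.
have := hc => /cvgrPdist_lt /(_ _ e0) [K _ hK]; exists K => M KM.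
have -> : \sum_(K <= k < M) exp_coeff x k = series (exp_coeff x) M - series (exp_coeff x) K.
  by rewrite sub_series_geq.
have h1 := nondecreasing_cvgn_le hn hc M.
have := hK K (leqnn K); rewrite /= => /(le_lt_trans (ler_norm _)) h2.
by lra.
Qed.

(** The differences of coefficients are at most D q^k/k!, so the terms from K on contribute at most
    e/2, uniformly in n and in |t| <= T; the first K terms form a finite sum tending to 0. *)
Lemma dcvg_unif p c T (e : R) : dcvg p c -> 0 <= T -> 0 < e ->
  \forall n \near \oo, forall t, `|t| <= T -> `|(p n).[t] - psum c t| <= e.
Proof.
move=> pc T0 e0; have hb := dcvg_ebounded pc.
have [C' [r' [C'0 r'0 hc]]] := hb; have [pk [C [r [C0 r0 h]]]] := pc.
pose D := C + C' + 1; have D0 : 0 < D by rewrite ltr_wpDl // addr_ge0.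
pose q := r + r'; have q0 : 0 <= q by rewrite addr_ge0.
have e1 : 0 < e / 2 / D by rewrite !divr_gt0.
have [K hK] := exp_tail (mulr_ge0 q0 T0) e1.
have hfin : \forall n \near \oo, \sum_(k < K) `|(p n)`_k - c k| * T ^+ k <= e / 2.
  have : (fun n => \sum_(k < K) `|(p n)`_k - c k| * T ^+ k) @ \oo --> (\sum_(k < K) 0 : R).
    apply: cvg_big => [|k _]; first exact: add_continuous.
    have : (fun n => `|(p n)`_k - c k| * T ^+ k) @ \oo --> `|c k - c k| * T ^+ k.
      by apply: cvgMl; apply: cvg_norm; apply: cvgB; [exact: pk | exact: cvg_cst].
    by rewrite subrr normr0 mul0r.
  rewrite big1 // => /cvgrPdist_lt /(_ (e / 2)) hh.
  near=> n; have : `|0 - \sum_(k < K) `|(p n)`_k - c k| * T ^+ k| < e / 2.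
    by near: n; apply: hh; rewrite divr_gt0.
  by rewrite sub0r normrN => /(le_lt_trans (ler_norm _)) /ltW.
near=> n => t tT.
have Hn : forall k, `|(p n)`_k| <= C * (r ^+ k / (k`!)%:R) by near: n.
have Fn : \sum_(k < K) `|(p n)`_k - c k| * T ^+ k <= e / 2 by near: n.
have Bn k : `|(p n)`_k - c k| <= D * (q ^+ k / (k`!)%:R).
  have f0 : 0 <= (k`!)%:R^-1 :> R by rewrite invr_ge0.
  rewrite (le_trans (ler_normB _ _)) // (le_trans (lerD (Hn k) (hc k))) //.
  have x1 : r ^+ k / (k`!)%:R <= q ^+ k / (k`!)%:R.
    by rewrite ler_wpM2r // lerXn2r ?nnegrE // lerDl.
  have x2 : r' ^+ k / (k`!)%:R <= q ^+ k / (k`!)%:R.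
    by rewrite ler_wpM2r // lerXn2r ?nnegrE // lerDr.
  have x3 : 0 <= q ^+ k / (k`!)%:R by rewrite mulr_ge0 // exprn_ge0.
  rewrite /D !mulrDl mul1r; apply: ler_wpDr => //.
  by apply: lerD; rewrite ler_wpM2l.
(* Beyond the degree of [p n], the partial sums of the difference are [(p n).[t]] minus the partial
   sums of the series. *)
pose M0 := maxn K (size (p n)).
have E : (fun M => `|\sum_(k < M + M0) ((p n)`_k - c k) * t ^+ k|) @ \oo --> `|(p n).[t] - psum c t|.
  apply: cvg_norm.
  rewrite (_ : (fun M => _) = fun M => (p n).[t] - pseries c t (M + M0)); last first.
    apply/funext => M; rewrite (@horner_coef_wide _ (M + M0)%N); last first.
      by rewrite (leq_trans (leq_maxr K _)) // leq_addl.
    rewrite /pseries /series /= big_mkord -sumrB; apply: eq_bigr => k _.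
    by rewrite mulrBl.
  apply: cvgB; first exact: cvg_cst.
  by rewrite (cvg_shiftn M0 (pseries c t)); exact: cvg_psum.
rewrite -(cvg_lim _ E) //; apply: limr_le; first by apply/cvg_ex; eexists; exact: E.
apply: nearW => M.
rewrite (le_trans (ler_norm_sum _ _ _)) //.
have KM : (K <= M + M0)%N by rewrite (leq_trans (leq_maxl _ (size (p n)))) // leq_addl.
rewrite -(big_mkord xpredT (fun k => `|((p n)`_k - c k) * t ^+ k|)).
rewrite (@big_cat_nat _ _ _ K) //= [e](splitr e) lerD //.
  rewrite big_mkord (le_trans _ Fn) //; apply: ler_sum => k _.
  by rewrite normrM normrX ler_wpM2l // lerXn2r ?nnegrE // (le_trans _ tT).
have -> : e / 2 = D * (e / 2 / D) by field; rewrite gt_eqF.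
rewrite (le_trans _ (ler_wpM2l (ltW D0) (hK _ KM))) // mulr_sumr; apply: ler_sum => k _.
rewrite normrM normrX -exp_coeff_term mulrA ler_pM ?exprn_ge0 //.
by rewrite lerXn2r ?nnegrE // (le_trans _ tT).
Unshelve. all: by end_near. Qed.

End EntireSeries.

(** * Zeros of the Bessel series *)

Section RealDerivatives.
Variable R : realType.
Implicit Types (f g : R -> R) (x a b : R).

(** The rules [derD], [derM], ... compute the derivative of an explicit function in whatever form it
    comes; [der_eq] leaves the comparison with the wanted form to [ring] or [field]. *)
Lemma der_eq f x a b : is_derive x 1 f a -> a = b -> is_derive x 1 f b.
Proof. by move=> fa <-. Qed.

Lemma derD f g x a b : is_derive x 1 f a -> is_derive x 1 g b ->
  is_derive x 1 (fun y => f y + g y) (a + b).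
Proof. by move=> fa gb; exact: (is_deriveD fa gb). Qed.

Lemma derN f x a : is_derive x 1 f a -> is_derive x 1 (fun y => - f y) (- a).
Proof. by move=> fa; exact: (is_deriveN fa). Qed.

Lemma derM f g x a b : is_derive x 1 f a -> is_derive x 1 g b ->
  is_derive x 1 (fun y => f y * g y) (a * g x + f x * b).
Proof.
move=> fa gb; apply: (der_eq (is_deriveM fa gb)).
by rewrite addrC /GRing.scale /= mulrC.
Qed.

Lemma derX f n x a : is_derive x 1 f a ->
  is_derive x 1 (fun y => f y ^+ n) (n%:R * f x ^+ n.-1 * a).
Proof.
move=> fa; have := is_deriveX n fa.
by rewrite exprfctE => h; apply: (der_eq h).
Qed.

Lemma derV f x a : is_derive x 1 f a -> f x != 0 ->
  is_derive x 1 (fun y => (f y)^-1) (- a / f x ^+ 2).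
Proof.
move=> fa f0; apply: (der_eq (is_deriveV f0 fa)).
by rewrite /GRing.scale /= mulNr mulrC mulNr.
Qed.

Lemma derC (c x : R) : is_derive x 1 (fun=> c) 0.
Proof. exact: is_derive_cst. Qed.

Lemma derId x : is_derive x 1 (fun y => y) 1.
Proof. exact: is_derive_id. Qed.

Lemma der_cont f x a : is_derive x 1 f a -> {for x, continuous f}.
Proof. by move=> [fd _]; apply: differentiable_continuous; exact/derivable1_diffP. Qed.

Lemma der_within f (df : R -> R) u v :
  (forall x, u <= x <= v -> is_derive x 1 f (df x)) -> {within `[u, v], continuous f}.
Proof.
move=> h; apply: continuous_in_subspaceT => x; rewrite inE /= in_itv /= => xuv.
exact: der_cont (h x xuv).
Qed.

Lemma der_mvt f (df : R -> R) u v : u < v ->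
  (forall x, u <= x <= v -> is_derive x 1 f (df x)) ->
  exists2 c, u < c < v & f v - f u = df c * (v - u).
Proof.
move=> uv h; have [x||c] := @MVT _ f df u v uv.
- by rewrite in_itv /= => /andP[ux xv]; apply: h; rewrite !ltW.
- exact: der_within h.
by rewrite in_itv /= => cuv e; exists c.
Qed.

Lemma der_nondecreasing f (df : R -> R) u v : u <= v ->
  (forall x, u <= x <= v -> is_derive x 1 f (df x)) ->
  (forall x, u <= x <= v -> 0 <= df x) -> f u <= f v.
Proof.
rewrite le_eqVlt => /predU1P[-> //|uv] h h0.
have [c /andP[uc cv] e] := der_mvt uv h.
by rewrite -subr_ge0 e mulr_ge0 ?h0 ?subr_ge0 ?ltW ?(ltW cv) ?(ltW uc).
Qed.

Lemma cont_neq0 f x : {for x, continuous f} -> f x != 0 ->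
  exists2 d, 0 < d & forall t, `|t - x| < d -> f t != 0.
Proof.
move=> cf fx; have : \forall t \near x, f t != 0 by exact: (cvgr_neq0 _ cf fx).
move=> /nbhs_ballP[d /= d0 hd]; exists d => // t td.
by apply: hd; rewrite /ball /= distrC.
Qed.
End RealDerivatives.

(** * The differential equation of the Bessel series and its zeros *)

Section BesselSeries.
Variables (R : realType) (c : nat -> R) (nu : R).
Hypothesis cb : ebounded c.
Hypothesis crec : forall k, k.+1%:R * (k.+1%:R + nu) * c k.+1 = - c k.
Hypothesis c0 : c 0%N != 0.

Let G := psum c.
Let G1 := psum (pseries_diffs c).
Let G2 := psum (pseries_diffs (pseries_diffs c)).

Let dG (t : R) : is_derive t 1 G (G1 t). Proof. exact: is_derive_psum. Qed.
Let dG1 (t : R) : is_derive t 1 G1 (G2 t).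
Proof. by apply: is_derive_psum; exact: ebounded_diffs. Qed.
Let G0 : G 0 != 0. Proof. by rewrite /G psum0. Qed.
Let cG (t : R) : {for t, continuous G}. Proof. exact: der_cont (dG t). Qed.
Let cG1 (t : R) : {for t, continuous G1}. Proof. exact: der_cont (dG1 t). Qed.

(** [crec] is this equation read on coefficients. The partial sums of G and G' are taken one term
    longer than those of G'', so that the combination is exactly 0. *)
Lemma bessel_ode (t : R) : t * G2 t + (nu + 1) * G1 t + G t = 0.
Proof.
pose s n := t * pseries (pseries_diffs (pseries_diffs c)) t n +
  (nu + 1) * pseries (pseries_diffs c) t n.+1 + pseries c t n.+1.
have h1 : s @ \oo --> t * G2 t + (nu + 1) * G1 t + G t.
  apply: cvgD; last first.
    by rewrite (cvg_shiftS (pseries c t)); exact: cvg_psum.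
  apply: cvgD.
    by apply: cvgMr; apply: cvg_psum; do 2!apply: ebounded_diffs.
  apply: cvgMr; rewrite (cvg_shiftS (pseries (pseries_diffs c) t)).
  by apply: cvg_psum; apply: ebounded_diffs.
suff E n : s n = 0.
  by rewrite -(cvg_lim _ h1) // (_ : s = fun=> 0) ?lim_cst //; apply/funext.
have recl (d : nat -> R) : pseries d t n.+1 = d 0%N + \sum_(0 <= i < n) d i.+1 * t ^+ i.+1.
  by rewrite /pseries /series /= big_nat_recl // expr0 mulr1.
rewrite /s !recl /pseries /series /= mulrDr !mulr_sumr.
transitivity ((nu + 1) * pseries_diffs c 0 + c 0%N + \sum_(0 <= i < n)
  (t * (pseries_diffs (pseries_diffs c) i * t ^+ i) +
   (nu + 1) * (pseries_diffs c i.+1 * t ^+ i.+1) + c i.+1 * t ^+ i.+1)).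
  by rewrite !big_split /=; ring.
rewrite big1 => [|i _]; rewrite /pseries_diffs.
  by have := crec 0; rewrite !mul1r addr0 [nu + 1]addrC => ->; rewrite addNr.
have := crec i.+1; rewrite exprS -[i.+2%:R]natr1 => h.
transitivity (t * t ^+ i * ((i.+1%:R + 1) * (i.+1%:R + 1 + nu) * c i.+2 + c i.+1)); last by rewrite h addNr mulr0.
ring.
Qed.

(* For K large, t^(K+1) (t G'^2 + G^2) is nondecreasing; it would vanish on
   [0, t] if t were a double zero. *)
Lemma bessel_simple (t : R) : 0 < t -> G t = 0 -> G1 t != 0.
Proof.
move=> t0 Gt; apply/eqP => G1t.
pose K := Num.bound `|2 * nu + 1|.
have K0 : 2 * nu + 1 <= K.+1%:R.
  rewrite (le_trans (ler_norm _)) // (le_trans (ltW (archi_boundP (normr_ge0 _)))) //.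
  by rewrite ler_nat.
pose f x := x ^+ K.+1 * (x * (G1 x * G1 x) + G x * G x).
pose df x := x ^+ K * (K.+1%:R * (G x * G x) + (K.+1%:R - (2 * nu + 1)) * (x * (G1 x * G1 x))).
have fdf (x : R) : is_derive x 1 f (df x).
  apply: (der_eq (derM (derX K.+1 (derId x)) (derD (derM (derId x)
    (derM (dG1 x) (dG1 x))) (derM (dG x) (dG x))))).
  have := bessel_ode x => h; rewrite /df /= exprS.
  have -> : x * (G2 x * G1 x + G1 x * G2 x) = - 2 * G1 x * ((nu + 1) * G1 x + G x).
    transitivity (2 * G1 x * (x * G2 x)); first by ring.
    have -> : x * G2 x = - ((nu + 1) * G1 x + G x) by rewrite -[RHS]add0r -h; ring.
    by ring.
  ring.
have f0 x : 0 <= x -> 0 <= f x.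
  move=> x0; have s1 := sqr_ge0 (G1 x); have s2 := sqr_ge0 (G x).
  by rewrite /f -!expr2; apply: mulr_ge0; [exact: exprn_ge0 | exact: addr_ge0 (mulr_ge0 x0 s1) s2].
have Gz x : 0 < x <= t -> G x = 0.
  move=> /andP[x0 xt].
  have : f x <= f t.
    apply: (der_nondecreasing xt (fun y _ => fdf y)) => y /andP[xy yt].
    have y0 : 0 <= y by rewrite (le_trans (ltW x0)).
    have s1 := sqr_ge0 (G1 y); have s2 := sqr_ge0 (G y).
    have K1 : 0 <= K.+1%:R - (2 * nu + 1) by rewrite subr_ge0.
    rewrite /df -!expr2; apply: mulr_ge0; first exact: exprn_ge0.
    by apply: addr_ge0; apply: mulr_ge0 => //; apply: mulr_ge0.
  rewrite {2}/f Gt G1t !mulr0 addr0 mulr0 => fx.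
  have : f x == 0 by rewrite eq_le fx f0 // ltW.
  have s1 := sqr_ge0 (G1 x); have s2 := sqr_ge0 (G x).
  rewrite /f -!expr2 mulf_eq0 expf_eq0 /= gt_eqF //= paddr_eq0 //; last first.
    exact: mulr_ge0 (ltW x0) s1.
  by move=> /andP[_]; rewrite sqrf_eq0 => /eqP.
have [e e0 he] := cont_neq0 (@cG 0) G0.
pose m : R := Num.min (e / 2) t.
have m0 : 0 < m by rewrite lt_min t0 divr_gt0.
have := he m; rewrite Gz ?eqxx; last by rewrite m0 ge_min lexx orbT.
rewrite subr0 (gtr0_norm m0) => H.
by have /H : m < e by rewrite gt_min ltr_pdivrMr // ltr_pMr // ltr1n.
Qed.

(** A zero u is positive since [c0] excludes 0, hence simple; G' has no zero near u, and the mean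
    value theorem forbids a second zero of G there. *)
Lemma bessel_isolated (u : R) : 0 <= u ->
  exists2 d, 0 < d & forall t, u < t < u + d -> G t != 0.
Proof.
move=> u0.
have [Gu|Gu] := eqVneq (G u) 0; last first.
  have [d d0 hd] := cont_neq0 (@cG u) Gu.
  exists d => // t /andP[ut td]; apply: hd; rewrite gtr0_norm ?subr_gt0 //.
  by rewrite ltrBlDl.
have u1 : 0 < u.
  by rewrite lt_neqAle u0 andbT; apply/eqP => u00; move: Gu G0; rewrite -u00 => ->; rewrite eqxx.
have [d d0 hd] := cont_neq0 (@cG1 u) (bessel_simple u1 Gu).
exists d => // t /andP[ut td]; apply/eqP => Gt.
have [x /andP[ux xt]] := der_mvt ut (fun y _ => dG y).
rewrite Gu Gt subrr => /esym/eqP; rewrite mulf_eq0 subr_eq0 (gt_eqF ut) orbF; apply/negP.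
apply: hd; rewrite gtr0_norm ?subr_gt0 //.
by rewrite ltrBlDl (lt_trans xt).
Qed.

(* Without zeros, r = - t G'/G solves the Riccati equation
   r' = 1 + (r^2 - nu r) / t, whose solutions blow up. *)
Lemma bessel_zeros_unbounded (T : R) : exists2 t, T < t & G t = 0.
Proof.
apply: contrapT => noz.
have nz t : T < t -> G t != 0 by move=> Tt; apply/eqP => Gt; apply: noz; exists t.
pose r t := - (t * G1 t) / G t.
have dr (t : R) : 0 < t -> T < t -> is_derive t 1 r (1 + (r t ^+ 2 - nu * r t) / t).
  move=> t0 Tt; have Gt := nz t Tt.
  apply: (der_eq (derM (derN (derM (derId t) (dG1 t))) (derV (dG t) Gt))).
  have h : t * G2 t = - ((nu + 1) * G1 t + G t).
    by rewrite -[RHS]add0r -(bessel_ode t); ring.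
  by rewrite h /r; field; rewrite Gt gt_eqF.
(* The term nu^2 ensures r^2 - nu r >= -nu^2/4 >= -t/4, so that r' >= 1/2 beyond T1 and r grows at
   least linearly. *)
pose T1 := `|T| + nu ^+ 2 + 1.
have T1T t : T1 <= t -> [/\ 0 < t, T < t, 1 <= t & nu ^+ 2 <= t].
  rewrite /T1 => h; have := sqr_ge0 nu; have := normr_ge0 T; have := ler_norm T.
  move: h; move: (nu ^+ 2) (`|T|) => x y; by split; lra.
have dr1 t : T1 <= t -> 1 / 2 <= 1 + (r t ^+ 2 - nu * r t) / t.
  move=> /T1T[t0 Tt t1 tn].
  suff : - (1 / 2) <= (r t ^+ 2 - nu * r t) / t by lra.
  rewrite ler_pdivlMr //; have := sqr_ge0 (r t - nu / 2); nra.
have r1 t : T1 <= t -> r T1 + (t - T1) / 2 <= r t.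
  move=> T1t.
  have : r T1 - T1 / 2 <= r t - t / 2.
    apply: (@der_nondecreasing _ (fun x => r x - x / 2)
      (fun x => 1 + (r x ^+ 2 - nu * r x) / x - 1 / 2) _ _ T1t) => x /andP[x1 x2].
      have [y1 y2 _ _] := T1T x x1.
      apply: (derD (dr x y1 y2)); apply: derN.
      apply: (der_eq (derM (derId x) (derC _ x))); ring.
    by rewrite subr_ge0 dr1.
  lra.
pose T2 := T1 + 2 * (2 * `|nu| + 1 + `|r T1|).
have T12 : T1 <= T2 by rewrite /T2 lerDl !mulr_ge0 // !addr_ge0 // mulr_ge0.
have r2 t : T2 <= t -> 2 * `|nu| + 1 <= r t.
  move=> t2; have := r1 t (le_trans T12 t2).
  have := ler_norm (- r T1); rewrite normrN; rewrite /T2 in t2; lra.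
(* Once r >= 2|nu| + 1, the equation gives r'/r^2 >= 1/(2t), so phi is nonincreasing. As 1/r > 0,
   this bounds ln t from above, which fails at t = T2 + exp(2 phi(T2)). *)
pose phi t := (r t)^-1 + ln t / 2.
have phi1 t : T2 <= t -> phi t <= phi T2.
  move=> t2; rewrite -lerN2.
  apply: (@der_nondecreasing _ (fun x => - phi x)
    (fun x => - (- (1 + (r x ^+ 2 - nu * r x) / x) / r x ^+ 2 + x^-1 / 2)) _ _ t2) => x /andP[x1 x2].
    have [y1 y2 _ _] := T1T x (le_trans T12 x1).
    have rx : r x != 0.
      by rewrite gt_eqF // (lt_le_trans _ (r2 x x1)) // ltr_wpDl // mulr_ge0.
    apply: derN; apply: derD; first exact: derV (dr x y1 y2) rx.
    by apply: (der_eq (derM (is_derive1_ln y1) (derC _ x))); ring.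
  have [y1 y2 _ _] := T1T x (le_trans T12 x1).
  have h := r2 x x1; have n0 := normr_ge0 nu; have n1 := ler_norm nu.
  have r0 : 0 < r x by lra.
  move: (r x) h r0 => y h r0.
  have -> : - (- (1 + (y ^+ 2 - nu * y) / x) / y ^+ 2 + x^-1 / 2) =
    (y ^+ 2)^-1 * (1 + y * (y - 2 * nu) / (2 * x)).
    by field; rewrite !gt_eqF.
  rewrite mulr_ge0 ?invr_ge0 ?sqr_ge0 // addr_ge0 // divr_ge0 //; last by rewrite mulr_ge0 // ltW.
  by apply: mulr_ge0; lra.
pose t := T2 + expR (2 * phi T2).
have t2 : T2 <= t by rewrite lerDl expR_ge0.
have [T20 _ _ _] := T1T T2 T12.
have := phi1 t t2; apply/negP; rewrite -ltNge /phi.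
have rt : 0 < (r t)^-1.
  by rewrite invr_gt0 (lt_le_trans _ (r2 t t2)) // ltr_wpDl // mulr_ge0.
suff : 2 * phi T2 <= ln t by rewrite {1}/phi; lra.
by rewrite -[leLHS]expRK ler_ln ?posrE ?expR_gt0 ?lerDr ?ltW // (lt_le_trans T20).
Qed.

(** The infimum of the zeros beyond u: it differs from u because zeros do not accumulate on the
    right of u, and it is a zero by continuity. *)
Lemma bessel_next_zero (u : R) : 0 <= u -> exists w, [/\ u < w, G w = 0 &
  forall t, u < t < w -> G t != 0].
Proof.
move=> u0; pose S := [set t | u < t /\ G t = 0].
have S0 : S !=set0 by have [t ut Gt] := bessel_zeros_unbounded u; exists t.
have [d d0 hd] := bessel_isolated u0.
have lb : lbound S (u + d).
  move=> t [ut Gt]; rewrite leNgt; apply/negP => td.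
  by have := hd t; rewrite ut td Gt eqxx => /(_ isT).
have hl : has_lbound S by exists (u + d).
have wd : u + d <= inf S by exact: lb_le_inf.
exists (inf S); split.
- by rewrite (lt_le_trans _ wd) // ltrDl.
- apply/eqP; apply: contrapT => /negP Gw.
  have [e e0 he] := cont_neq0 (@cG _) Gw.
  have [t St te] := inf_adherent e0 (conj S0 hl).
  have : G t != 0.
    apply: he; rewrite ger0_norm ?subr_ge0; last exact: ge_inf hl t St.
    by rewrite ltrBlDl.
  by case: St => _ ->; rewrite eqxx.
move=> t /andP[ut tw]; apply/eqP => Gt.
have : inf S <= t by apply: ge_inf.
by rewrite leNgt tw.
Qed.

Lemma bessel_zero_list k : exists s : seq R, [/\ size s = k, sorted <%R s &
  forall t, (t \in s) = (0 < t <= last 0 s) && (G t == 0)].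
Proof.
elim: k => [|k [s [sk ss hs]]].
  by exists [::]; split => // t; rewrite in_nil /=; case: (ltP 0 t) => //= t0; rewrite leNgt t0.
have l0 : 0 <= last 0 s.
  have [->|ne] := eqVneq s [::]; first by [].
  have : last 0 s \in s by case: (s) ne => // a l _ /=; exact: mem_last.
  by rewrite hs => /andP[/andP[/ltW]].
have [w [lw Gw hw]] := bessel_next_zero l0.
exists (rcons s w); split; first by rewrite size_rcons sk.
  case: (s) ss lw => //= x l; rewrite rcons_path => -> /= ->; by [].
move=> t; rewrite mem_rcons inE hs last_rcons.
have [->|tw] /= := eqVneq t w; first by rewrite Gw eqxx lexx (le_lt_trans l0 lw).
have [Gt|] := eqVneq (G t) 0; rewrite ?andbF // !andbT.
have [t0|//] := ltP 0 t; rewrite /=.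
apply/idP/idP => [tl|]; first by rewrite (le_trans tl) // ltW.
move=> tw'; rewrite leNgt; apply/negP => tl.
by have := hw t; rewrite tl lt_neqAle tw tw' Gt eqxx => /(_ isT).
Qed.
End BesselSeries.

(** * Zeros near the endpoint 1 *)

Section RootConvergence.
Variable R : realType.
Implicit Types (p : nat -> {poly R}) (c : nat -> R) (u v x e : R) (s : seq R).

Lemma dcvg_horner p c x : dcvg p c -> (fun n => (p n).[x]) @ \oo --> psum c x.
Proof.
move=> pc; apply/cvgrPdist_le => e e0.
have := dcvg_unif pc (normr_ge0 x) e0; apply: filterS => n h.
by rewrite distrC h.
Qed.

(** On the compact interval the absolute value of the limit has a positive minimum, and the
    polynomials are eventually within half of it. *)
Lemma dcvg_noroot p c u v : dcvg p c -> u <= v ->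
  (forall t, u <= t <= v -> psum c t != 0) ->
  \forall n \near \oo, forall t, u <= t <= v -> (p n).[t] != 0.
Proof.
move=> pc uv G0; have cb := dcvg_ebounded pc.
have cG : {within `[u, v], continuous (fun t => `|psum c t|)}.
  apply: continuous_subspaceT => t; apply: continuous_comp; last exact: norm_continuous.
  exact: der_cont (is_derive_psum t cb).
have [w] := EVT_min uv cG; rewrite in_itv /= => wuv hw.
have w0 : 0 < `|psum c w| by rewrite normr_gt0 G0.
have T0 : 0 <= `|u| + `|v| by rewrite addr_ge0.
have e0 : 0 < `|psum c w| / 2 by rewrite divr_gt0.
have := dcvg_unif pc T0 e0; apply: filterS => n h t tuv.
have tT : `|t| <= `|u| + `|v|.
  move/andP: tuv => [ut tv]; rewrite ler_norml; apply/andP; split.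
    have := ler_norm (- u); rewrite normrN; have := normr_ge0 v; lra.
  have := ler_norm v; have := normr_ge0 u; lra.
apply/eqP => pt; have := h t tT; rewrite pt sub0r normrN leNgt => /negP; apply.
have := hw t; rewrite in_itv /= => /(_ tuv); lra.
Qed.

(** All roots of [q] in the interval are listed, not merely one near each point of [s], so that the
    k-th root can be identified. *)
Definition simple_roots_near (q : {poly R}) u v s e := exists rs : seq R,
  [/\ size rs = size s, sorted <%R rs,
    forall t, (t \in rs) = (u < t < v) && root q t,
    forall t, t \in rs -> q^`().[t] != 0 &
    forall i, (i < size s)%N -> `|nth 0 rs i - nth 0 s i| < e].

Lemma diffs_deriv c : (fun k => k.+1%:R * c k.+1 : R) = pseries_diffs c.
Proof. by []. Qed.

(** The product condition says that the derivative of the limit keeps a constant sign, so the limit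
    changes sign. The polynomials inherit the sign change and a derivative without zeros: existence
    by the intermediate value theorem, uniqueness by Rolle. *)
Lemma dcvg_one_root p c u x v : dcvg p c -> u < x < v -> psum c x = 0 ->
  (forall t, u <= t <= v -> 0 < psum (pseries_diffs c) t * psum (pseries_diffs c) x) ->
  \forall n \near \oo, exists y, [/\ u < y < v, root (p n) y,
    (p n)^`().[y] != 0 & forall t, u <= t <= v -> root (p n) t -> t = y].
Proof.
move=> pc /andP[ux xv] Gx G1; have cb := dcvg_ebounded pc.
have uv := lt_trans ux xv.
set g := psum (pseries_diffs c) x in G1.
have dG t := is_derive_psum t cb.
have su : psum c u * g < 0.
  have [z /andP[uz zx]] := der_mvt ux (fun y _ => dG y).
  rewrite Gx sub0r => h; rewrite -oppr_gt0 -mulNr h mulrAC mulr_gt0 ?subr_gt0 //.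
  by apply: G1; rewrite !ltW // (lt_trans zx).
have sv : 0 < psum c v * g.
  have [z /andP[xz zv]] := der_mvt xv (fun y _ => dG y).
  rewrite Gx subr0 => ->; rewrite mulrAC mulr_gt0 ?subr_gt0 //.
  by apply: G1; rewrite !ltW // (lt_trans ux).
have suv : psum c u * psum c v < 0.
  have g2 : 0 < g ^+ 2.
    rewrite exprn_even_gt0 //=; apply/eqP => g0.
    by move: sv; rewrite g0 mulr0 ltxx.
  rewrite -(pmulr_llt0 _ g2) (_ : _ * _ * _ = (psum c u * g) * (psum c v * g)); last by ring.
  by rewrite nmulr_rlt0.
have h1 : \forall n \near \oo, (p n).[u] * (p n).[v] < 0.
  have : (fun n => (p n).[u] * (p n).[v]) @ \oo --> psum c u * psum c v.
    by apply: cvgM; exact: dcvg_horner.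
  by move=> /cvgr_lt; apply.
have h2 : \forall n \near \oo, forall t, u <= t <= v -> (p n)^`().[t] != 0.
  have := @dcvg_noroot _ _ u v (dcvg_deriv pc) (ltW uv); apply => t tuv.
  by apply/eqP => h; have := G1 t tuv; rewrite diffs_deriv in h; rewrite h mul0r ltxx.
near=> n.
have k1 : (p n).[u] * (p n).[v] < 0 by near: n.
have k2 : forall t, u <= t <= v -> (p n)^`().[t] != 0 by near: n.
have [y] := polyrcf.poly_ivtoo (ltW uv) k1; rewrite in_itv /= => yuv ry.
move/andP: (yuv) => [uy yv].
exists y; split => //; first by apply: k2; rewrite !ltW.
have nodouble t1 t2 : u <= t1 -> t2 <= v -> t1 < t2 -> root (p n) t1 -> root (p n) t2 -> False.
  move=> ut1 t2v t12 /rootP r1 /rootP r2.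
  have := r1; rewrite -r2 => /(polyrcf.poly_rolle t12)[z]; rewrite in_itv /= => /andP[z1 z2] z0.
  have := k2 z; rewrite z0 eqxx => H; have : false; last by [].
  by apply: H; rewrite (le_trans ut1 (ltW z1)) (le_trans (ltW z2) t2v).
move=> t /andP[ut tv] rt; case: (ltgtP t y) => // ty; exfalso.
  exact: (nodouble t y ut (ltW yv) ty rt ry).
exact: (nodouble y t (ltW uy) tv ty ry rt).
Unshelve. all: by end_near. Qed.

(** Induction on the zeros from the left: no root up to x - h, one in [x - h, x + h], and the
    induction hypothesis from x + h on. *)
Lemma dcvg_roots p c e v s u : dcvg p c -> 0 < e -> u < v ->
  psum c u != 0 -> psum c v != 0 -> sorted <%R s ->
  (forall t, (t \in s) = (u < t < v) && (psum c t == 0)) ->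
  (forall t, t \in s -> psum (pseries_diffs c) t != 0) ->
  \forall n \near \oo, simple_roots_near (p n) u v s e.
Proof.
move=> pc e0; elim: s u => [|x s IH] u uv Gu Gv ss hs h1.
  have : forall t, u <= t <= v -> psum c t != 0.
    move=> t; rewrite le_eqVlt => /andP[/predU1P[<- //|ut]].
    rewrite le_eqVlt => /predU1P[-> //|tv].
    by have := hs t; rewrite in_nil ut tv /= => /esym/negbT.
  move=> /(dcvg_noroot pc (ltW uv)); apply: filterS => n hn.
  exists [::]; split => // t; rewrite in_nil; apply/esym/negP => /andP[/andP[ut tv]].
  by apply/negP; apply: hn; rewrite !ltW.
have cb := dcvg_ebounded pc.
set g := psum (pseries_diffs c) x.
have g0 : g != 0 by apply: h1; rewrite mem_head.
have /andP[/andP[ux xv] /eqP Gx] : (u < x < v) && (psum c x == 0) by rewrite -hs mem_head.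
have [d d0 hd] : exists2 d, 0 < d & forall t, `|t - x| < d -> 0 < psum (pseries_diffs c) t * g.
  have cG1 : {for x, continuous (psum (pseries_diffs c))}.
    exact: der_cont (is_derive_psum x (ebounded_diffs cb)).
  have : \forall t \near x, 0 < psum (pseries_diffs c) t * g.
    have : (fun t => psum (pseries_diffs c) t * g) @ x --> g * g by apply: cvgMl; exact: cG1.
    by move=> /cvgr_gt; apply; rewrite -expr2 exprn_even_gt0.
  move=> /nbhs_ballP[d /= d0 hd]; exists d => // t td; apply: hd.
  by rewrite /ball /= distrC.
(* Half of m is below the precision e, keeps the derivative of constant sign around x, and leaves u
   and v outside [x - h, x + h]. *)
pose m := Num.min (Num.min d e) (Num.min (x - u) (v - x)).
have m0 : 0 < m by rewrite /m !lt_min d0 e0 !subr_gt0 ux xv.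
pose h := m / 2; have h0 : 0 < h by rewrite divr_gt0.
have hm : h < m by rewrite /h ltr_pdivrMr // ltr_pMr // ltr1n.
have [hdd he hu hv] : [/\ h < d, h < e, h < x - u & h < v - x].
  by move: hm; rewrite /m !lt_min => /andP[/andP[-> ->] /andP[-> ->]].
have Gpos t : x - h <= t <= x + h -> 0 < psum (pseries_diffs c) t * g.
  move=> /andP[t1 t2]; apply: hd; rewrite (le_lt_trans _ hdd) // ler_norml.
  by apply/andP; split; lra.
have Gnz t : x < t <= x + h -> psum c t != 0.
  move=> /andP[xt th]; apply/eqP => Gt.
  have [z /andP[xz zt]] := der_mvt xt (fun y _ => is_derive_psum y cb).
  rewrite Gx Gt subrr => /esym/eqP; rewrite mulf_eq0 subr_eq0 (gt_eqF xt) orbF => /eqP Gz.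
  by have := Gpos z; rewrite Gz mul0r ltxx => H; have : false; [apply: H; apply/andP; split; lra|].
have sx : forall t, t \in s -> x < t by apply/allP; rewrite (order_path_min lt_trans).
have H1 : \forall n \near \oo, forall t, u <= t <= x - h -> (p n).[t] != 0.
  apply: (dcvg_noroot pc); first lra.
  move=> t /andP[]; rewrite le_eqVlt => /predU1P[<- //|ut tx]; apply/negP => Gt.
  have : t \in x :: s by rewrite hs ut Gt andbT /=; lra.
  rewrite inE => /orP[/eqP tx'|/sx]; lra.
have H2 : \forall n \near \oo, exists y, [/\ x - h < y < x + h, root (p n) y,
    (p n)^`().[y] != 0 & forall t, x - h <= t <= x + h -> root (p n) t -> t = y].
  apply: (dcvg_one_root pc _ Gx Gpos); lra.
have H3 : \forall n \near \oo, simple_roots_near (p n) (x + h) v s e.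
  apply: IH => //; first lra.
  - by apply: Gnz; rewrite lexx andbT; lra.
  - exact: path_sorted ss.
  - move=> t; apply/idP/idP => [ts|/andP[/andP[t1 t2] Gt]].
      have : t \in x :: s by rewrite inE ts orbT.
      rewrite hs => /andP[/andP[ut ->] Gt]; rewrite Gt !andbT ltNge; apply/negP => tx.
      by have := Gnz t; rewrite sx // tx Gt => /(_ isT).
    have : t \in x :: s by rewrite hs Gt t2 !andbT; lra.
    by rewrite inE => /orP[/eqP tx|//]; lra.
  - by move=> t ts; apply: h1; rewrite inE ts orbT.
near=> n.
have k1 : forall t, u <= t <= x - h -> (p n).[t] != 0 by near: n.
have [y [/andP[y1 y2] ry dy uniqy]] : exists y, [/\ x - h < y < x + h, root (p n) y,
    (p n)^`().[y] != 0 & forall t, x - h <= t <= x + h -> root (p n) t -> t = y] by near: n.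
have [rs [r1 r2 r3 r4 r5]] : simple_roots_near (p n) (x + h) v s e by near: n.
exists (y :: rs); split.
- by rewrite /= r1.
- rewrite /= path_min_sorted //; apply/allP => t; rewrite r3 => /andP[/andP[t1 _] _]; lra.
- move=> t; rewrite inE r3; have [tx|xt] := leP t (x - h).
    have -> : (t == y) = false by rewrite lt_eqF //; lra.
    have -> /= : (x + h < t) = false by apply/negP => ?; lra.
    apply/esym/negP => /andP[/andP[ut _] rt].
    by have := k1 t; rewrite (ltW ut) tx => /(_ isT); rewrite -/(root (p n) t) rt.
  have [tx|tx] := ltP (x + h) t.
    have -> /= : (t == y) = false by rewrite gt_eqF //; lra.
    by have -> : u < t by lra.
  rewrite /= orbF; apply/eqP/idP => [->|/andP[_ rt]]; first by rewrite ry andbT; lra.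
  by apply: uniqy => //; rewrite tx ltW.
- by move=> t; rewrite inE => /orP[/eqP -> //|]; exact: r4.
case=> [|i] /=; last by rewrite ltnS; exact: r5.
move=> _; rewrite ltr_norml; apply/andP; split; lra.
Unshelve. all: by end_near. Qed.

End RootConvergence.

(** * The functions J_nu and their positive zeros *)

Section BesselFunction.
Variable R : realType.
Implicit Types (nu x t : R).

Lemma ebounded_bessel_coef nu : ebounded (bessel_coef nu).
Proof. exact: dcvg_ebounded (dcvg_scaled_jacobi nu 0). Qed.

Lemma bessel_coef_rec nu k :
  k.+1%:R * (k.+1%:R + nu) * bessel_coef nu k.+1 = - bessel_coef nu k.
Proof.
rewrite /bessel_coef exprS factS natrM.
have := inv_GammaS (nu + k%:R + 1).
have -> : nu + k%:R + 1 + 1 = nu + k.+1%:R + 1 by rewrite -[k.+1%:R]natr1; ring.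
have -> : nu + k%:R + 1 = k.+1%:R + nu by rewrite -[k.+1%:R]natr1; ring.
move=> ->; have f0 : (k`!)%:R != 0 :> R by exact: fact_neq0.
have k0 : k.+1%:R != 0 :> R by rewrite pnatr_eq0.
by move: (k.+1%:R : R) (inv_Gamma _) k0 => m g m0; field; rewrite f0 m0.
Qed.

(* [l] is the order of vanishing at 0 of the entire part of the Bessel function;
   it is positive exactly when [nu] is the negative integer [- l]. *)
Lemma bessel_coef_reduce nu : exists l nu', [/\ forall k, (k < l)%N -> bessel_coef nu k = 0,
  (0 < l)%N -> nu = - l%:R, bessel_coef nu l != 0 &
  forall k, k.+1%:R * (k.+1%:R + nu') * bessel_coef nu (k.+1 + l) = - bessel_coef nu (k + l)].
Proof.
have [[i ni]|ni] := pselect (exists i : nat, nu = - i.+1%:R).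
  exists i.+1, i.+1%:R; split => // [k ki||k].
  - rewrite /bessel_coef ni (_ : _ + 1 = - (i - k)%:R).
      by rewrite inv_Gamma0 mulr0 mul0r.
    by rewrite natrB // -[i.+1%:R]natr1; ring.
  - rewrite /bessel_coef ni addNr add0r; apply: mulf_neq0; last first.
      by rewrite invr_eq0 pnatr_eq0 -lt0n fact_gt0.
    apply: mulf_neq0; first by rewrite signr_eq0.
    apply: inv_Gamma_neq0 => j; rewrite -subr_eq0 opprK.
    by rewrite addrC natr1 pnatr_eq0.
  - rewrite addSn -bessel_coef_rec ni; congr (_ * _).
    by rewrite -!natr1 natrD -natr1; ring.
exists 0%N, nu; split => // [|k]; last by rewrite !addn0 bessel_coef_rec.
rewrite /bessel_coef addr0 expr0 mul1r fact0 divr1.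
apply: inv_Gamma_neq0 => j; apply/eqP => h; apply: ni; exists j.
by rewrite -natr1 opprD -h; ring.
Qed.

Lemma psum_drop (c : nat -> R) l t : ebounded c -> (forall k, (k < l)%N -> c k = 0) ->
  psum c t = t ^+ l * psum (fun k => c (k + l)%N) t.
Proof.
move=> cb cl.
have E n : pseries c t (n + l) = t ^+ l * pseries (fun k => c (k + l)%N) t n.
  rewrite /pseries /series /= (@big_cat_nat _ _ _ l) ?leq_addl //= big_nat_cond big1; last first.
    by move=> i /andP[/andP[_ il] _]; rewrite cl // mul0r.
  rewrite add0r -{1}[l]add0n big_addn addnK mulr_sumr; apply: eq_bigr => i _.
  by rewrite exprD mulrA mulrC.
(* Division by t^l is impossible only at t = 0 with l > 0, where both sides vanish. *)
have [t0|t0] := eqVneq (t ^+ l) 0.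
  rewrite t0 mul0r; move: t0; move=> /eqP; rewrite expf_eq0 => /andP[l0 /eqP ->].
  by rewrite psum0 // cl.
have h : pseries (fun k => c (k + l)%N) t @ \oo --> psum c t / t ^+ l.
  rewrite (_ : pseries _ t = fun n => pseries c t (n + l)%N / t ^+ l); last first.
    by apply/funext => n; rewrite E mulrC mulKf.
  by apply: cvgMl; rewrite (cvg_shiftn l (pseries c t)); exact: cvg_psum.
by rewrite /psum (cvg_lim _ h) // mulrC divfK.
Qed.

Lemma ebounded_shift (c : nat -> R) l : ebounded c -> ebounded (fun k => c (k + l)%N).
Proof.
move=> [C [r [C0 r0 h]]]; exists (C * r ^+ l), r; split; rewrite ?mulr_ge0 ?exprn_ge0 // => k.
rewrite (le_trans (h _)) // -!mulrA ler_wpM2l // mulrA -exprD addnC.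
rewrite ler_wpM2l ?exprn_ge0 // lef_pV2 ?posrE ?ltr0n ?fact_gt0 // ler_nat.
by apply: leq_fact; rewrite leq_addl.
Qed.

Lemma bessel_JE nu x : 0 < x ->
  bessel_J nu x = (x / 2) `^ nu * psum (bessel_coef nu) (x ^+ 2 / 4).
Proof.
move=> x0; have x2 : 0 < x / 2 by rewrite divr_gt0.
have h := @cvg_psum _ _ (x ^+ 2 / 4) (ebounded_bessel_coef nu).
rewrite /bessel_J; apply: cvg_lim => //.
rewrite (_ : series _ = fun n => (x / 2) `^ nu * pseries (bessel_coef nu) (x ^+ 2 / 4) n).
  exact: cvgMr.
apply/funext => n; rewrite /pseries /series /= mulr_sumr; apply: eq_bigr => m _.
rewrite powRD; last by rewrite (gt_eqF x2) implybT.
rewrite -natrM powR_mulrn ?ltW // exprM /bessel_coef [nu + _]addrC.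
have -> : (x / 2) ^+ 2 = x ^+ 2 / 4 by field.
by ring.
Qed.

Lemma card_seq (s : seq R) : uniq s -> ([set` s] #= `I_(size s))%card.
Proof.
move=> us; have inj : {in `I_(size s) &, injective (nth 0 s)}.
  by move=> i j; rewrite !inE /= => i1 j1 /eqP; rewrite nth_uniq // => /eqP.
have := inj_card_eq inj; congr (is_true (_ #= _)%card).
apply/seteqP; split => [x [i /= il <-]|x /= xs]; first by rewrite /= mem_nth.
by exists (index x s); [rewrite /= index_mem | rewrite nth_index].
Qed.

(** The positive zeros of J_nu are the 2 sqrt t for the positive zeros t of f. As [bessel_zero] is a
    choice, uniqueness matters too: an x to the left of the proposed value has fewer than [size s]
    zeros in (0, x], and one to the right, being itself a zero, has more. *)
Lemma bessel_zeroE nu (f : R -> R) (s : seq R) : (0 < size s)%N ->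
  (forall x, 0 < x -> bessel_J nu x = 0 <-> f (x ^+ 2 / 4) = 0) ->
  sorted <%R s -> (forall t, (t \in s) = (0 < t <= last 0 s) && (f t == 0)) ->
  bessel_zero nu (size s) = 2 * Num.sqrt (last 0 s).
Proof.
move=> s0 Jf ss hs.
have ls : last 0 s \in s by case: (s) s0 => //= a l _; exact: mem_last.
set tau := last 0 s in hs ls *.
have /andP[/andP[t0 _] /eqP ft] : (0 < tau <= tau) && (f tau == 0) by rewrite -hs.
pose g t : R := 2 * Num.sqrt t.
have gK t : 0 <= t -> g t ^+ 2 / 4 = t.
  by move=> h; rewrite /g exprMn sqr_sqrtr //; field.
have Kg x : 0 <= x -> g (x ^+ 2 / 4) = x.
  move=> h; have -> : x ^+ 2 / 4 = (x / 2) ^+ 2 by field.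
  by rewrite /g sqrtr_sqr ger0_norm ?divr_ge0 //; field.
have g_gt0 t : 0 < t -> 0 < g t by move=> h; rewrite mulr_gt0 // sqrtr_gt0.
have A x : x \in map g s <-> (0 < x <= g tau /\ bessel_J nu x = 0).
  split.
    move=> /mapP[t]; rewrite hs => /andP[/andP[t1 t2] /eqP f0] ->.
    split; last by apply/Jf; rewrite ?g_gt0 // gK ?ltW.
    by rewrite g_gt0 //= ler_pM2l // ler_wsqrtr.
  move=> [/andP[x1 x2] /Jf]; move/(_ x1) => fx.
  apply/mapP; exists (x ^+ 2 / 4); last by rewrite Kg // ltW.
  rewrite hs fx eqxx andbT divr_gt0 ?exprn_gt0 //=.
  rewrite -[leRHS](gK _ (ltW t0)) ler_pM2r // lerXn2r ?nnegrE ?(ltW x1) //.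
  exact: ltW (g_gt0 _ t0).
have us : uniq (map g s).
  rewrite map_inj_in_uniq; first exact: sorted_uniq lt_trans ltxx _ ss.
  move=> t t'; rewrite !hs => /andP[/andP[h _] _] /andP[/andP[h' _] _] /(congr1 (fun x => x ^+ 2 / 4)).
  by rewrite (gK _ (ltW h)) (gK _ (ltW h')).
have cA : ([set y | 0 < y <= g tau /\ bessel_J nu y = 0] #= `I_(size s))%card.
  rewrite -[in X in `I_X](size_map g); have := card_seq us; congr (is_true (_ #= _)%card).
  by apply/seteqP; split => x /=; [move=> /A | move=> h; apply/A].
rewrite /bessel_zero; case: xgetP => [x _|/(_ (g tau))]; last first.
  case; split => //; first exact: g_gt0.
  by apply/Jf; [exact: g_gt0 | rewrite (gK _ (ltW t0))].
move=> [x0 Jx cx]; case: (ltgtP x (g tau)) => // xt; exfalso.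
  have sub : [set y | 0 < y <= x /\ bessel_J nu y = 0] `<=` [set` rem (g tau) (map g s)].
    move=> y /= [/andP[y0 yx] Jy]; rewrite mem_rem_uniq // !inE.
    apply/andP; split; first by rewrite lt_eqF // (le_lt_trans yx).
    by apply/A; split => //; rewrite y0 ltW // (le_lt_trans yx).
  have ur : uniq (rem (g tau) (map g s)) by rewrite rem_uniq.
  have := subset_card_le sub.
  rewrite (card_le_eql cx) (card_le_eqr (card_seq ur)) card_le_II size_rem ?map_f // size_map.
  by case: (size s) s0 => // n _; rewrite ltnn.
have sub : [set` x :: map g s] `<=` [set y | 0 < y <= x /\ bessel_J nu y = 0].
  move=> y /=; rewrite inE => /predU1P[->|]; first by rewrite x0 lexx.
  by move=> /A[/andP[y0 yt] Jy]; rewrite y0 (le_trans yt) // ltW.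
have ux : uniq (x :: map g s).
  by rewrite /= us andbT; apply/negP => /A[/andP[_]]; rewrite leNgt xt.
have := subset_card_le sub.
by rewrite (card_le_eqr cx) (card_le_eql (card_seq ux)) card_le_II /= size_map ltnn.
Qed.

End BesselFunction.

#[local] Opaque jacobi.

(** * Combinations of derivatives of Jacobi polynomials at 1 *)

Section NearOne.
Variable R : realType.
Implicit Types (a b e t x : R).

Lemma dcvg_scale (w : nat -> R) (x : R) (p : nat -> {poly R}) c : w @ \oo --> x ->
  dcvg p c -> dcvg (fun n => w n *: p n) (fun k => x * c k).
Proof.
move=> wx pc.
have hw : dcvg (fun n => (w n)%:P) (fun k => if k == 0%N then x else 0).
  apply: (@dcvg_poly _ 1) => [k|n]; last exact: size_polyC_leq1.
  rewrite (_ : (fun n => _) = fun n => if k == 0%N then w n else 0); last first.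
    by apply/funext => n; rewrite coefC.
  by case: eqP => _ //; exact: cvg_cst.
have := dcvgM hw pc; congr dcvg; first by apply/funext => n; rewrite mul_polyC.
apply/funext => k; rewrite big_ord_recl /= subn0 big1 ?addr0 // => i _.
by rewrite mul0r.
Qed.

Lemma dcvg_mul_comp_lin (B : {poly R}) (w : nat -> R) (p : nat -> {poly R}) c :
  w @ \oo --> 0 -> dcvg p c ->
  dcvg (fun n => (B \Po (1 - w n *: 'X)) * p n) (fun k => B.[1] * c k).
Proof.
move=> w0 pc; have := dcvgM (dcvg_comp_lin B w0) pc; congr dcvg.
apply/funext => k; rewrite big_ord_recl /= subn0 big1 ?addr0 // => i _.
by rewrite mul0r.
Qed.

Lemma dcvg_sum (m : nat) (p : nat -> nat -> {poly R}) (c : nat -> nat -> R) :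
  (forall i, (i < m)%N -> dcvg (p i) (c i)) ->
  dcvg (fun n => \sum_(i < m) p i n) (fun k => \sum_(i < m) c i k).
Proof.
elim: m => [|m IH] h.
  have : dcvg (fun=> 0 : {poly R}) (fun=> 0 : R).
    split=> [k|]; first by rewrite coef0; exact: cvg_cst.
    exists 0, 0; split => //; apply: nearW => n k.
    by rewrite coef0 normr0 mul0r.
  by congr dcvg; apply/funext => n; rewrite big_ord0.
have := dcvgD (IH (fun i im => h i (ltnW im))) (h m (ltnSn m)).
by congr dcvg; apply/funext => n; rewrite big_ord_recr.
Qed.

Lemma derivn_comp_lin (p : {poly R}) (w : R) i :
  (p \Po (1 - w *: 'X))^`(i) = (- w) ^+ i *: (p^`(i) \Po (1 - w *: 'X)).
Proof.
elim: i => [|i IH]; first by rewrite !derivn0 expr0 scale1r.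
rewrite derivnS IH derivZ deriv_comp derivB -polyC1 derivC derivZ derivX polyC1 sub0r.
have E (q : {poly R}) : q * (- (w *: 1)) = (- w) *: q.
  by rewrite -scaleNr -mul_polyC mulr1 mulrC mul_polyC.
by rewrite E scalerA -exprSr derivnS.
Qed.

Lemma cvg_natV_expn (m : nat) (x : R) : (0 < m)%N -> (fun s : nat => x / s%:R ^+ m) @ \oo --> (0 : R).
Proof.
move=> m0; rewrite -(mulr0 x); apply: cvgMr.
have h : (fun s : nat => (s%:R^-1 : R)) @ \oo --> (0 : R).
  by rewrite -cvg_shiftS; exact: cvg_harmonic.
case: m m0 => // m _; elim: m => [|m IH].
  by rewrite (_ : (fun s : nat => _) = fun s : nat => s%:R^-1) //; apply/funext => s; rewrite expr1.
rewrite (_ : (fun s : nat => _) = fun s : nat => s%:R^-1 * (s%:R ^+ m.+1)^-1); last first.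
  by apply/funext => s; rewrite [in LHS]exprS invfM.
by rewrite -(mulr0 (0 : R)); apply: cvgM.
Qed.

Variables (a b : R) (r : nat) (B : nat -> {poly R}).
Hypothesis Br1 : (B r).[1] != 0.

Definition jacobi_comb (s : nat) : {poly R} :=
  \sum_(i < r.+1) B i * (jacobi a b s)^`(i).

Let wt (s : nat) : R := 2 / s%:R ^+ 2.
(** Normalized for the term i = r: in [HE] the term i carries the factor s^(-2(r-i)). *)
Let H (s : nat) : {poly R} :=
  (s%:R `^ (- a) / s%:R ^+ (2 * r)) *: (jacobi_comb s \Po (1 - wt s *: 'X)).
Let kap : R := (B r).[1] / 2 ^+ r.

Let HE (s : nat) : (0 < s)%N -> H s = \sum_(i < r.+1)
  ((- 2^-1) ^+ i / s%:R ^+ (2 * (r - i))) *: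
    ((B i \Po (1 - wt s *: 'X)) * (scaled_jacobi a b s)^`(i)).
Proof.
move=> s0; rewrite /H raddf_sum /= scaler_sumr; apply: eq_bigr => i _.
rewrite comp_polyM /scaled_jacobi -/(wt s).
have -> : (s%:R `^ (- a) *: (jacobi a b s \Po (1 - wt s *: 'X)))^`(i) =
   s%:R `^ (- a) *: (jacobi a b s \Po (1 - wt s *: 'X))^`(i) by exact: derivnZ.
rewrite derivn_comp_lin.
rewrite -!scalerAr !scalerA; congr (_ *: _).
have p0 : s%:R != 0 :> R by rewrite pnatr_eq0 -lt0n.
have ir : (i <= r)%N by rewrite -ltnS.
have e1 : s%:R ^+ (2 * r) = s%:R ^+ (2 * (r - i)) * s%:R ^+ (2 * i) :> R.
  by rewrite -exprD -mulnDr subnK.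
have e2 : (- 2^-1) ^+ i * (- wt s) ^+ i = (s%:R ^+ (2 * i))^-1 :> R.
  by rewrite -exprMn mulrNN /wt mulrA mulVf // mul1r exprVn -exprM.
rewrite e1 invfM -e2; ring.
Qed.

(** The r-th derivative of the series of order a is (-1)^r times the series of order a + r, and this
    sign cancels the one of (-1/2)^r. *)
Let dH : dcvg H (fun k => kap * bessel_coef (a + r%:R) k).
Proof.
pose cc i k : R := (if i == r then (- 2^-1) ^+ r else 0) *
  ((B i).[1] * (((k + i)`!)%:R / (k`!)%:R * bessel_coef a (k + i)%N)).
have h : dcvg (fun s => \sum_(i < r.+1) ((- 2^-1) ^+ i / s%:R ^+ (2 * (r - i))) *:
    ((B i \Po (1 - wt s *: 'X)) * (scaled_jacobi a b s)^`(i)))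
    (fun k => \sum_(i < r.+1) cc i k).
  apply: (@dcvg_sum _ (fun i s => ((- 2^-1) ^+ i / s%:R ^+ (2 * (r - i))) *:
    ((B i \Po (1 - wt s *: 'X)) * (scaled_jacobi a b s)^`(i)))) => i ir.
  apply: dcvg_scale; last first.
    apply: dcvg_mul_comp_lin; first exact: cvg_natV_expn.
    by apply: dcvg_derivn; exact: dcvg_scaled_jacobi.
  case: eqP => [->|/eqP ni].
    rewrite subnn muln0 (_ : (fun s : nat => _) = fun=> (- 2^-1) ^+ r); first exact: cvg_cst.
    by apply/funext => s; rewrite expr0 divr1.
  by apply: cvg_natV_expn; rewrite muln_gt0 /= subn_gt0 ltn_neqAle ni -ltnS.
have [hk hC] := h.
have cE : (fun k => \sum_(i < r.+1) cc i k) = (fun k => kap * bessel_coef (a + r%:R) k).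
  apply/funext => k; rewrite big_ord_recr /= big1 => [|i _]; last first.
    by rewrite /cc ltn_eqF // mul0r.
  rewrite add0r /cc eqxx /kap /bessel_coef natrD exprD -[- 2^-1]mulN1r exprMn exprVn.
  have f0 : (k`!)%:R != 0 :> R by exact: fact_neq0.
  have f1 : ((k + r)`!)%:R != 0 :> R by exact: fact_neq0.
  have n2 : (2 : R) ^+ r != 0 by rewrite expf_neq0.
  rewrite (_ : a + (k%:R + r%:R) + 1 = a + r%:R + k%:R + 1); last by ring.
  have s2 : (-1) ^+ r * (-1) ^+ r = 1 :> R by rewrite -expr2 sqrr_sign.
  rewrite -[RHS]mul1r -[X in _ = X * _]s2.
  move: ((-1 : R) ^+ r) ((-1 : R) ^+ k) => u v.
  by field; rewrite n2 f0 f1.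
rewrite -cE; split=> [k|].
  have := hk k; apply: cvg_trans; apply: near_eq_cvg; near=> s.
  by rewrite HE //; near: s; exact: nbhs_infty_gt.
have [C [rho [C0 rho0 hb]]] := hC; exists C, rho; split => //.
near=> s; rewrite HE; first by near: s.
by near: s; exact: nbhs_infty_gt.
Unshelve. all: by end_near. Qed.

(** When a = -(l + r), the coefficients of the rescaled P_s below l + r contain the factor a + r + l
    = 0, and at most r derivations leave order l at 0. The limit alone would not give this exact
    vanishing, which the division by t^l requires. *)
Let H_low (l : nat) : a + r%:R = - l%:R -> \forall s \near \oo, forall k, (k < l)%N -> (H s)`_k = 0.
Proof.
move=> al; near=> s => k kl.
have s0 : (0 < s)%N by near: s; exact: nbhs_infty_gt.
have sl : (l + r < s)%N by near: s; exact: nbhs_infty_gt.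
have F0 j : (j < l + r)%N -> (scaled_jacobi a b s)`_j = 0.
  move=> jl; have js : (j <= s)%N by rewrite ltnW // (ltn_trans jl).
  rewrite coef_scaled_jacobi // gbinom_prodE.
  have ij : (l + r - j.+1 < s - j)%N.
    by lia.
  rewrite (bigD1 (Ordinal ij)) //= natrB // natrD -[j.+1%:R]natr1.
  have -> : a + j%:R + 1 + (l%:R + r%:R - (j%:R + 1)) = (a + r%:R) + l%:R by ring.
  by rewrite al addNr !(mul0r, mulr0).
rewrite HE // coef_sum big1 // => i _; rewrite coefZ coefM big1 ?mulr0 // => j _.
rewrite coef_derivn F0 ?mul0rn ?mulr0 //.
by have := ltn_ord i; have := ltn_ord j; lia.
Unshelve. all: by end_near. Qed.

Lemma psumZ (x : R) (c : nat -> R) t : ebounded c -> psum (fun k => x * c k) t = x * psum c t.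
Proof.
move=> cb; apply: cvg_lim => //.
rewrite (_ : pseries _ t = fun n => x * pseries c t n); first by apply: cvgMr; exact: cvg_psum.
by apply/funext => n; rewrite /pseries /series /= mulr_sumr; apply: eq_bigr => i _; rewrite mulrA.
Qed.

Lemma jacobi_comb_roots (k : nat) : (0 < k)%N -> exists ts : seq R, exists v,
  [/\ size ts = k, 0 < last 0 ts, bessel_zero (a + r%:R) k = 2 * Num.sqrt (last 0 ts), 0 < v &
  forall e, 0 < e -> \forall s \near \oo, exists rs : seq R,
   [/\ size rs = k, sorted <%R rs,
    forall t, (t \in rs) = (0 < t < v) && root (jacobi_comb s) (1 - 2 / s%:R ^+ 2 * t),
    forall t, t \in rs -> (jacobi_comb s)^`().[1 - 2 / s%:R ^+ 2 * t] != 0 &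
    forall i, (i < k)%N -> `|nth 0 rs i - nth 0 ts i| < e]].
Proof.
move=> k0; have [l [nu' [cl lnu cl0 crec]]] := bessel_coef_reduce (a + r%:R).
have kap0 : kap != 0 by rewrite mulf_neq0 // invr_eq0 expf_neq0.
pose c j := kap * bessel_coef (a + r%:R) (j + l).
have dc : dcvg (fun s => drop_poly l (H s)) c by exact: dcvg_drop dH.
have cb := dcvg_ebounded dc.
have {}crec j : j.+1%:R * (j.+1%:R + nu') * c j.+1 = - c j.
  by rewrite /c mulrCA crec mulrN.
have c0 : c 0%N != 0 by rewrite mulf_neq0.
have [ts [sts ss hs]] := bessel_zero_list cb crec c0 k.
have lts : last 0 ts \in ts.
  by move: k0; rewrite -sts; case: (ts) => //= x l' _; exact: mem_last.
have /andP[/andP[l0 _] /eqP Gl] : (0 < last 0 ts <= last 0 ts) && (psum c (last 0 ts) == 0).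
  by rewrite -hs.
have [d d0 hd] := bessel_isolated cb crec c0 (ltW l0).
(* v lies past the k-th zero of the limit and before the next one, so that exactly k roots are
   followed in (0, v). *)
pose v := last 0 ts + d / 2.
have ltv : last 0 ts < v by rewrite ltrDl divr_gt0.
have vd : v < last 0 ts + d by rewrite ltrD2l ltr_pdivrMr // ltr_pMr // ltr1n.
exists ts, v; split => //; last 2 first.
- exact: (lt_trans l0 ltv).
- move=> e e0.
  have hroots := @dcvg_roots _ _ _ e v ts 0 dc e0 (lt_trans l0 ltv).
  have : \forall s \near \oo, simple_roots_near (drop_poly l (H s)) 0 v ts e.
    apply: hroots => //.
    - by rewrite psum0.
    - by apply: hd; rewrite ltv.
    - move=> t; rewrite hs; have [Gt|] := eqVneq (psum c t) 0; rewrite ?andbF // !andbT.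
      case: (0 < t) => //=; apply/idP/idP => [tl|tv]; first exact: le_lt_trans ltv.
      rewrite leNgt; apply/negP => tl.
      by have := hd t; rewrite tl (lt_trans tv vd) Gt eqxx => /(_ isT).
    - move=> t; rewrite hs => /andP[/andP[t0 _] /eqP Gt].
      exact: (bessel_simple cb crec c0 t0 Gt).
  have HX : \forall s \near \oo, H s = drop_poly l (H s) * 'X^l.
    have : \forall s \near \oo, forall j, (j < l)%N -> (H s)`_j = 0.
      have [->|l1] := posnP l; first exact: nearW.
      exact: H_low (lnu l1).
    apply: filterS => s hj; rewrite -[LHS](poly_take_drop l) (_ : take_poly l _ = 0) ?add0r //.
    by apply/polyP => j; rewrite coef_take_poly coef0; case: ifP => // /hj.
  move=> hr; near=> s.
  have [rs [r1 r2 r3 r4 r5]] : simple_roots_near (drop_poly l (H s)) 0 v ts e by near: s.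
  have hx : H s = drop_poly l (H s) * 'X^l by near: s.
  have s0 : (0 < s)%N by near: s; exact: nbhs_infty_gt.
  have p0 : 0 < s%:R :> R by rewrite ltr0n.
  have w0 : wt s != 0 by rewrite mulf_neq0 // invr_eq0 expf_neq0 // gt_eqF.
  have kk : s%:R `^ (- a) / s%:R ^+ (2 * r) != 0 :> R.
    by rewrite mulf_neq0 // ?invr_eq0 ?expf_neq0 // gt_eqF // powR_gt0.
  have Lt t : (1 - wt s *: 'X : {poly R}).[t] = 1 - wt s * t.
    by rewrite -polyC1 hornerD hornerN hornerZ hornerX hornerC.
  exists rs; split => //; first by rewrite r1 sts.
  - move=> t; rewrite r3; have [t0|] := ltP 0 t => //=; congr (_ && _).
    have : (H s).[t] = (drop_poly l (H s)).[t] * t ^+ l by rewrite {1}hx hornerM hornerXn.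
    rewrite {1}/H hornerZ horner_comp Lt /root => E.
    apply/eqP/eqP => h.
      move: E; rewrite h mul0r => /eqP; rewrite mulf_eq0 (negPf kk) => /eqP.
      by [].
    move: E; rewrite h mulr0 => /esym/eqP; rewrite mulf_eq0 expf_eq0 (gt_eqF t0) andbF orbF.
    by move=> /eqP.
  - move=> t trs; have := r4 t trs; move: trs; rewrite r3 => /andP[/andP[t0 _] /rootP rt] h4.
    have : (H s)^`().[t] = (drop_poly l (H s))^`().[t] * t ^+ l.
      by rewrite {1}hx derivM hornerD !hornerM rt mul0r addr0 hornerXn.
    rewrite {1}/H derivZ deriv_comp hornerZ hornerM horner_comp Lt => E.
    apply/eqP => h; move: E; rewrite h mul0r mulr0 => /esym/eqP.
    by rewrite mulf_eq0 (negPf h4) expf_eq0 (gt_eqF t0) andbF.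
  - by move=> i ik; apply: r5; rewrite sts.
rewrite -sts; apply: (@bessel_zeroE _ _ (psum c)) => //; first by rewrite sts.
move=> x x0; rewrite bessel_JE // (@psum_drop _ _ l) //; last exact: ebounded_bessel_coef.
rewrite /c psumZ; last exact/ebounded_shift/ebounded_bessel_coef.
have x2 : 0 < x ^+ 2 / 4 by rewrite divr_gt0 ?exprn_gt0.
have y0 : (x / 2) `^ (a + r%:R) != 0 by rewrite gt_eqF // powR_gt0 // divr_gt0.
have y1 : (x ^+ 2 / 4) ^+ l != 0 by rewrite gt_eqF // exprn_gt0.
split=> /eqP.
  by rewrite !mulf_eq0 (negPf y0) (negPf y1) => /eqP ->; rewrite mulr0.
by rewrite mulf_eq0 (negPf kap0) => /eqP ->; rewrite !mulr0.
Unshelve. all: by end_near. Qed.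

End NearOne.

(** * From zeros to angles *)

Section ZeroNearOne.
Variable R : realType.
Implicit Types (p : {poly R}) (x c : R).

Lemma mup_simple p x : root p x -> p^`().[x] != 0 -> mup x p = 1%N.
Proof.
move=> rx dx; have p0 : p != 0.
  by apply: contra_neq dx => ->; rewrite deriv0 horner0.
have h1 : (0 < mup x p)%N by rewrite mup_geq // expr1 dvdp_XsubCl.
have h2 : ~~ (1 < mup x p)%N.
  rewrite mup_geq //; apply/negP => /dvdpP[q pq]; move/negP: dx; apply.
  rewrite pq derivM hornerD !hornerM deriv_exp derivXsubC mul1r expr1.
  by rewrite hornerMn hornerXsubC subrr mul0rn !mulr0 addr0.
by apply/eqP; rewrite eqn_leq h1 andbT leqNgt.
Qed.

Lemma sorted_split (s : seq R) c : sorted <%R s ->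
  s = [seq x <- s | x <= c] ++ [seq x <- s | c < x].
Proof.
elim: s => //= x s IH ss; have [xc|cx] := leP x c.
  by rewrite /= -IH // (path_sorted ss).
have h : all (fun y => c < y) s.
  by apply/allP => y ys; rewrite (lt_trans cx) //; apply: (allP (order_path_min lt_trans ss)).
rewrite (_ : [seq y <- s | y <= c] = [::]) /=; first by congr (_ :: _); apply/esym/all_filterP.
by apply/eqP; rewrite -(negbK (_ == _)) -has_filter -all_predC; apply/allP => y /(allP h) /=; rewrite ltNge.
Qed.

(** Only the roots above c matter: being simple, they form the end of the list of roots with
    multiplicity, each occurring once. *)
Lemma zero_near_1E p c (s : seq R) k : p != 0 -> -1 <= c ->
  sorted (fun x y => y < x) s -> (forall x, (x \in s) = (c < x < 1) && root p x) ->
  (forall x, x \in s -> p^`().[x] != 0) -> (0 < k <= size s)%N ->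
  zero_near_1 p k = nth 0 s k.-1.
Proof.
move=> p0 c1 ss hs ds /andP[k0 ks].
pose Z := zeros p.
have sZ : sorted <%R Z by exact: polyrcf.sorted_roots.
have E : [seq x <- Z | c < x] = rev s.
  apply: lt_sorted_eq; first by rewrite sorted_filter //; exact: lt_trans.
    by rewrite rev_sorted.
  move=> x; rewrite mem_filter mem_rev hs /Z /zeros polyrcf.in_roots p0 andbT in_itv /=.
  have [cx|//] := ltP c x; rewrite /= andbC; congr (_ && _).
  by rewrite (le_lt_trans c1 cx).
rewrite /zero_near_1 /zeros_mult -/Z (sorted_split c sZ) map_cat flatten_cat rev_cat nth_cat.
have -> : flatten [seq nseq (mup x p) x | x <- [seq x <- Z | c < x]] = rev s.
  rewrite E; have : {in rev s, forall x, mup x p = 1%N}.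
    move=> x; rewrite mem_rev => xs; apply: mup_simple; last exact: ds.
    by move: xs; rewrite hs => /andP[].
  by elim: (rev s) => //= x l IH h; rewrite h ?mem_head //= IH // => y yl; apply: h; rewrite inE yl orbT.
by rewrite revK prednK // ks.
Qed.

Lemma sin_cos_bounds (x : R) : 0 <= x -> sin x <= x.
Proof.
move=> x0; rewrite -subr_ge0.
have : 0 - sin 0 <= x - sin x.
  apply: (@der_nondecreasing _ (fun y => y - sin y) (fun y => 1 - cos y) _ _ x0).
  by move=> y _; rewrite subr_ge0 cos_le1.
by rewrite sin0 subrr.
Qed.

Lemma mul_cos_le_sin (x : R) : 0 <= x <= pi -> x * cos x <= sin x.
Proof.
move=> /andP[x0 xp]; rewrite -subr_ge0.
have : sin 0 - 0 * cos 0 <= sin x - x * cos x.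
  apply: (@der_nondecreasing _ (fun y => sin y - y * cos y) (fun y => y * sin y) _ _ x0).
    move=> y _; apply: (der_eq (derD (is_derive_sin y) (derN (derM (derId y) (is_derive_cos y))))).
    ring.
  move=> y /andP[y0 yx]; rewrite mulr_ge0 // sin_ge0_pi // y0 (le_trans yx) //.
by rewrite sin0 mul0r subrr.
Qed.

(* With [cos th = 1 - 2 u], [sin (th / 2) ^+ 2 = u]. *)
Lemma acos_bounds (u : R) : 0 <= u < 1 ->
  2 * Num.sqrt u <= acos (1 - 2 * u) <= 2 * Num.sqrt u / Num.sqrt (1 - u).
Proof.
move=> /andP[u0 u1]; have hu : -1 <= 1 - 2 * u <= 1 by apply/andP; split; lra.
set th := acos _; have cth : cos th = 1 - 2 * u by rewrite acosK.
have th0 : 0 <= th by exact: acos_ge0.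
have thp : th <= pi by exact: acos_lepi.
pose ph := th / 2.
have ph0 : 0 <= ph by rewrite divr_ge0.
have php : ph <= pi by rewrite /ph; have := pi_ge0 R; lra.
have E : th = ph + ph by rewrite /ph; field.
have cs := cos2Dsin2 ph.
have s2 : sin ph ^+ 2 = u.
  have : cos th = cos ph * cos ph - sin ph * sin ph by rewrite E cosD.
  rewrite cth -!expr2; lra.
have sp : sin ph = Num.sqrt u.
  by rewrite -s2 sqrtr_sqr ger0_norm // sin_ge0_pi // ph0 php.
have cp : cos ph = Num.sqrt (1 - u).
  have -> : 1 - u = cos ph ^+ 2 by lra.
  rewrite sqrtr_sqr ger0_norm // cos_ge0_pihalf //; apply/andP; split.
    by have := pi_ge0 R; rewrite /ph; lra.
  by rewrite /ph ler_pM2r.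
have c0 : 0 < Num.sqrt (1 - u) by rewrite sqrtr_gt0 subr_gt0.
rewrite -sp -cp E; apply/andP; split.
  by have := sin_cos_bounds ph0; lra.
rewrite ler_pdivlMr ?cp // -cp.
have := @mul_cos_le_sin ph; rewrite ph0 php => /(_ isT); lra.
Qed.

(** Squeezing by [acos_bounds] with u = t s / s^2, where 1 - u tends to 1. *)
Lemma cvg_acos (t : nat -> R) (l : R) : (forall s, 0 <= t s) -> t @ \oo --> l ->
  (fun s : nat => s%:R * acos (1 - 2 / s%:R ^+ 2 * t s)) @ \oo --> 2 * Num.sqrt l.
Proof.
move=> t0 tl.
have csqrt : Num.sqrt \o t @ \oo --> Num.sqrt l by apply: continuous_cvg => //; exact: sqrt_continuous.
have h1 : (fun s => 2 * Num.sqrt (t s)) @ \oo --> 2 * Num.sqrt l by apply: cvgMr.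
have hu : (fun s : nat => 1 - t s / s%:R ^+ 2) @ \oo --> (1 : R).
  rewrite -[X in _ --> X]subr0; apply: cvgB; first exact: cvg_cst.
  rewrite -(mulr0 l) (_ : (fun s => _) = fun s : nat => t s * (1 / s%:R ^+ 2)); last first.
    by apply/funext => s; rewrite mul1r.
  by apply: cvgM => //; exact: cvg_natV_expn.
have h2 : (fun s => 2 * Num.sqrt (t s) / Num.sqrt (1 - t s / s%:R ^+ 2)) @ \oo --> 2 * Num.sqrt l.
  rewrite -[X in _ --> X]divr1; apply: cvgM => //.
  apply: cvgV; first by [].
  rewrite -[X in _ --> X]sqrtr1; apply: continuous_cvg => //; exact: sqrt_continuous.
apply: (squeeze_cvgr _ h1 h2); near=> s.
have s0 : 0 < s%:R :> R by rewrite ltr0n; near: s; exact: nbhs_infty_gt.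
have u1 : 0 < 1 - t s / s%:R ^+ 2.
  by near: s; have := hu => /cvgr_gt; apply.
set u := t s / s%:R ^+ 2 in u1 *.
have u0 : 0 <= u by rewrite divr_ge0 // exprn_ge0 // ltW.
have -> : 2 / s%:R ^+ 2 * t s = 2 * u by rewrite /u; ring.
have ts : Num.sqrt (t s) = s%:R * Num.sqrt u.
  by rewrite /u sqrtrM // sqrtrV ?exprn_ge0 ?ltW // sqrtr_sqr gtr0_norm //; field; rewrite gt_eqF.
have /andP[b1 b2] : 2 * Num.sqrt u <= acos (1 - 2 * u) <= 2 * Num.sqrt u / Num.sqrt (1 - u).
  by apply: acos_bounds; rewrite u0 -subr_gt0.
rewrite ts; apply/andP; split.
  by rewrite mulrCA ler_pM2l.
rewrite (_ : 2 * (s%:R * Num.sqrt u) / _ = s%:R * (2 * Num.sqrt u / Num.sqrt (1 - u))); last by ring.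
by rewrite ler_pM2l.
Unshelve. all: by end_near. Qed.

End ZeroNearOne.

Section CoreLimit.
Variable R : realType.
Implicit Types (x : R).

Lemma nbhs_itv (u v x : R) : u < x < v -> \forall y \near x, u < y < v.
Proof.
move=> xuv; have : \forall y \near x, y \in `]u, v[ by apply: near_in_itvoo; rewrite in_itv.
by apply: filterS => y; rewrite in_itv.
Qed.

(** At a zero of q the derivative of w q is w q', whatever the derivative of w. *)
Lemma weighted_simple_root (p q : {poly R}) (w : R -> R) :
  (forall x, -1 < x < 1 -> [/\ derivable w x 1, w x != 0 & p.[x] = w x * q.[x]]) ->
  forall x, -1 < x < 1 -> (root p x = root q x) *
   (root q x -> q^`().[x] != 0 -> p^`().[x] != 0).
Proof.
move=> hw x xI; have [dw wx px] := hw x xI.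
split; first by rewrite /root px mulf_eq0 (negPf wx).
move=> /rootP qx dq.
have dwx : is_derive x 1 w ('D_1 w x) by apply: derivableP.
have d1 := derM dwx (is_derive_poly q x).
have d2 : is_derive x 1 (horner p) ('D_1 w x * q.[x] + w x * q^`().[x]).
  apply: near_eq_is_derive d1.
  by have := nbhs_itv xI; apply: filterS => y /hw[].
have := is_derive_poly p x => -[_ <-]; case: d2 => _ ->.
by rewrite qx mulr0 add0r mulf_neq0.
Qed.

Lemma core_limit (a b : R) (r : nat) (B : nat -> {poly R}) (k : nat) (p : nat -> {poly R}) :
  (B r).[1] != 0 -> (0 < k)%N ->
  (\forall s \near \oo, exists w : R -> R, forall x, -1 < x < 1 ->
    [/\ derivable w x 1, w x != 0 & (p s).[x] = w x * (jacobi_comb a b r B s).[x]]) ->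
  (fun s : nat => s%:R * acos (zero_near_1 (p s) k)) @ \oo --> bessel_zero (a + r%:R) k.
Proof.
move=> Br1 k0 hw; have [ts [v [sts l0 bz v0 hr]]] := jacobi_comb_roots a b Br1 k0.
have key e : 0 < e -> \forall s \near \oo, exists t : R, [/\ 0 < t, `|t - last 0 ts| < e &
    zero_near_1 (p s) k = 1 - 2 / s%:R ^+ 2 * t].
  move=> e0; have hr' := hr e e0.
  have : (fun s : nat => v / s%:R ^+ 2) @ \oo --> (0 : R) by exact: cvg_natV_expn.
  move=> /cvgr_lt /(_ 1 ltr01) h; near=> s.
  have [rs [r1 r2 r3 r4 r5]] : exists rs : seq R,
   [/\ size rs = k, sorted <%R rs,
    forall t, (t \in rs) = (0 < t < v) && root (jacobi_comb a b r B s) (1 - 2 / s%:R ^+ 2 * t),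
    forall t, t \in rs -> (jacobi_comb a b r B s)^`().[1 - 2 / s%:R ^+ 2 * t] != 0 &
    forall i, (i < k)%N -> `|nth 0 rs i - nth 0 ts i| < e] by near: s.
  have s0 : 0 < s%:R :> R by rewrite ltr0n; near: s; exact: nbhs_infty_gt.
  have [w /weighted_simple_root W] : exists w : R -> R, forall x, -1 < x < 1 ->
    [/\ derivable w x 1, w x != 0 & (p s).[x] = w x * (jacobi_comb a b r B s).[x]] by near: s.
  have vs : 2 / s%:R ^+ 2 * v < 2.
    have : v / s%:R ^+ 2 < 1 by near: s.
    by rewrite mulrAC -mulrA; lra.
  set m := 2 / s%:R ^+ 2 in r3 r4 vs *.
  have m0 : 0 < m by rewrite divr_gt0 // exprn_gt0.
  have lr : nth 0 rs k.-1 \in rs by rewrite mem_nth // r1 prednK.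
  have xI x : 1 - m * v < x < 1 -> -1 < x < 1 by move=> /andP[h1 h2]; apply/andP; split; lra.
  pose f t := 1 - m * t.
  have fI t : 0 < t < v -> 1 - m * v < f t < 1.
    move=> /andP[t0 tv]; rewrite /f ltrD2l ltrN2 ltr_pM2l // tv /=.
    by rewrite ltrBlDr ltrDl mulr_gt0.
  have hs x : (x \in map f rs) = (1 - m * v < x < 1) && root (p s) x.
    apply/mapP/andP => [[t]|[xc rx]].
      rewrite r3 => /andP[tv rt] ->; rewrite fI // (W _ (xI _ (fI _ tv))).1.
      by split.
    have E : 1 - m * ((1 - x) / m) = x by field; rewrite gt_eqF.
    exists ((1 - x) / m); last by rewrite /f E.
    rewrite r3 E -(W _ (xI _ xc)).1 rx andbT; move/andP: xc => [x1 x2].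
    rewrite divr_gt0 ?subr_gt0 //= ltr_pdivrMr //; rewrite [v * m]mulrC; lra.
  have nz x : x \in map f rs -> (p s)^`().[x] != 0.
    move=> /mapP[t trs ->]; have := trs; rewrite r3 => /andP[tv rt].
    exact: (W _ (xI _ (fI _ tv))).2 rt (r4 t trs).
  have ps0 : p s != 0.
    have := nz (f (nth 0 rs k.-1)) (map_f _ lr).
    by apply: contra_neq => ->; rewrite deriv0 horner0.
  exists (nth 0 rs k.-1); split.
  - by move: lr; rewrite r3 => /andP[/andP[]].
  - by rewrite -nth_last sts; apply: r5; rewrite prednK.
  rewrite (@zero_near_1E _ _ (1 - m * v) (map f rs)) //.
  - by rewrite (nth_map 0) // r1 prednK.
  - by lra.
  - rewrite sorted_map; apply: sub_sorted r2 => t t' /= tt'.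
    by rewrite /f ltrD2l ltrN2 ltr_pM2l.
  - by rewrite size_map r1 k0 leqnn.
(* The rescaled distance from 1 to the k-th zero; the maximum with 0 keeps it nonnegative for the
   small s that [key] does not cover, as [cvg_acos] asks. *)
pose T (s : nat) := Num.max 0 ((1 - zero_near_1 (p s) k) * s%:R ^+ 2 / 2).
have TE (s : nat) t : (0 < s)%N -> 0 < t -> zero_near_1 (p s) k = 1 - 2 / s%:R ^+ 2 * t -> T s = t.
  move=> s0 t0 E; rewrite /T E.
  have s1 : s%:R != 0 :> R by rewrite pnatr_eq0 -lt0n.
  have -> : (1 - (1 - 2 / s%:R ^+ 2 * t)) * s%:R ^+ 2 / 2 = t by field.
  by rewrite max_r // ltW.
have Tl : T @ \oo --> last 0 ts.
  apply/cvgrPdist_lt => e e0; have ke := key e e0; near=> s.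
  have s0 : (0 < s)%N by near: s; exact: nbhs_infty_gt.
  have [t [t0 te E]] : exists t : R, [/\ 0 < t, `|t - last 0 ts| < e &
    zero_near_1 (p s) k = 1 - 2 / s%:R ^+ 2 * t] by near: s.
  by rewrite (TE s t) // distrC.
rewrite bz; have T0 s : 0 <= T s by rewrite le_max lexx.
have := cvg_acos T0 Tl; apply: cvg_trans; apply: near_eq_cvg.
have k1 := key 1 ltr01; near=> s.
have s0 : (0 < s)%N by near: s; exact: nbhs_infty_gt.
have [t [t0 te E]] : exists t : R, [/\ 0 < t, `|t - last 0 ts| < 1 &
    zero_near_1 (p s) k = 1 - 2 / s%:R ^+ 2 * t] by near: s.
by rewrite (TE s t) // E.
Unshelve. all: by end_near. Qed.

End CoreLimit.

(** * Wronskians *)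

Section Wronskians.
Variable R : realType.
Implicit Types (f g : R -> R) (fs : seq (R -> R)) (x : R) (U : set R).

Definition smooth_on U f := forall i x, U x -> derivable (derive1n i f) x 1.

Lemma derive1n_eq_on U f g : open U -> (forall x, U x -> f x = g x) ->
  forall i x, U x -> derive1n i f x = derive1n i g x.
Proof.
move=> oU fg; elim=> [|i IH] x Ux; first exact: fg.
rewrite !derive1nS !derive1E; apply: near_eq_derive.
by have := open_nbhs_nbhs (conj oU Ux); apply: filterS => y /IH.
Qed.

Lemma smooth_is_derive U f i x : smooth_on U f -> U x ->
  is_derive x 1 (derive1n i f) (derive1n i.+1 f x).
Proof.
move=> sf Ux; rewrite derive1nS derive1E; apply: derivableP; exact: sf.
Qed.

(** Any explicit sequence in which each term has the next one as derivative yields at once the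
    iterated derivatives of its first term and their derivability. *)
Lemma derive1n_tower U (F : nat -> R -> R) : open U ->
  (forall i x, U x -> is_derive x 1 (F i) (F i.+1 x)) ->
  (forall i x, U x -> derive1n i (F 0%N) x = F i x) /\ smooth_on U (F 0%N).
Proof.
move=> oU hF.
have E i x : U x -> derive1n i (F 0%N) x = F i x.
  elim: i x => [//|i IH] x Ux; rewrite derive1nS derive1E.
  rewrite (near_eq_derive (g := F i)); last first.
    by have := open_nbhs_nbhs (conj oU Ux); apply: filterS => y; exact: IH.
  by have [_ ->] := hF i x Ux.
split=> // i x Ux; have [h _] := hF i x Ux; move: h; apply: near_eq_derivable.
by have := open_nbhs_nbhs (conj oU Ux); apply: filterS => y Uy; rewrite E.
Qed.

Lemma der_sum n (F : nat -> R -> R) (d : nat -> R) x :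
  (forall i, (i < n)%N -> is_derive x 1 (F i) (d i)) ->
  is_derive x 1 (fun y => \sum_(i < n) F i y) (\sum_(i < n) d i).
Proof.
elim: n => [|n IH] h.
  rewrite (_ : (fun y => _) = fun=> 0); last by apply/funext => y; rewrite big_ord0.
  by rewrite big_ord0; exact: derC.
rewrite (_ : (fun y => _) = fun y => \sum_(i < n) F i y + F n y); last first.
  by apply/funext => y; rewrite big_ord_recr.
by rewrite big_ord_recr; apply: derD; [apply: IH => i ni; apply/h/ltnW | exact: h].
Qed.

Definition leibniz f g (n : nat) x : R :=
  \sum_(i < n.+1) 'C(n, i)%:R * (derive1n (n - i) g x * derive1n i f x).

Lemma leibniz_derive U f g n x : open U -> smooth_on U f -> smooth_on U g -> U x ->
  is_derive x 1 (leibniz f g n) (leibniz f g n.+1 x).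
Proof.
move=> oU sf sg Ux.
pose d i := 'C(n, i)%:R * (derive1n (n - i).+1 g x * derive1n i f x +
  derive1n (n - i) g x * derive1n i.+1 f x).
have := @der_sum n.+1 (fun i y => 'C(n, i)%:R * (derive1n (n - i) g y * derive1n i f y)) d x.
move=> h; apply: (der_eq (h _)) => [i _|].
  apply: (der_eq (derM (derC _ x) (derM (smooth_is_derive (n - i) sg Ux) (smooth_is_derive i sf Ux)))).
  by rewrite /d mul0r add0r.
pose G i := derive1n i g x; pose P i := derive1n i f x.
pose S2 := \sum_(i < n.+1) 'C(n, i)%:R * (G (n - i)%N * P i.+1).
have -> : leibniz f g n.+1 x = G n.+1 * P 0%N +
    (\sum_(i < n.+1) 'C(n, i.+1)%:R * (G (n - i)%N * P i.+1) + S2).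
  rewrite /leibniz big_ord_recl bin0 mul1r; congr (_ + _).
  rewrite -big_split; apply: eq_bigr => i _.
  by rewrite lift0 binS natrD mulrDl subSS.
have -> : \sum_(i < n.+1) d i = \sum_(i < n.+1) 'C(n, i)%:R * (G (n - i).+1 * P i) + S2.
  by rewrite -big_split; apply: eq_bigr => i _; rewrite /d mulrDr.
rewrite addrA; congr (_ + _).
have -> : \sum_(i < n.+1) 'C(n, i.+1)%:R * (G (n - i)%N * P i.+1) =
    \sum_(i < n) 'C(n, i.+1)%:R * (G (n - i)%N * P i.+1).
  by rewrite big_ord_recr /= (bin_small (ltnSn n)) mul0r addr0.
rewrite big_ord_recl bin0 mul1r subn0; congr (_ + _).
by apply: eq_bigr => i _; rewrite lift0 subnSK.
Qed.

Lemma leibnizE U f g : open U -> smooth_on U f -> smooth_on U g ->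
  (forall n x, U x -> derive1n n (fun y => g y * f y) x = leibniz f g n x) /\
  smooth_on U (fun y => g y * f y).
Proof.
move=> oU sf sg.
have E : (fun y => g y * f y) = leibniz f g 0.
  by apply/funext => y; rewrite /leibniz big_ord1 bin0 mul1r.
rewrite E; apply: derive1n_tower => // n x Ux; exact: leibniz_derive Ux.
Qed.

Lemma smoothM U f g : open U -> smooth_on U f -> smooth_on U g ->
  smooth_on U (fun y => f y * g y).
Proof. by move=> oU sf sg; have [] := leibnizE oU sg sf. Qed.

Lemma derive1nZ U f c : open U -> smooth_on U f ->
  (forall n x, U x -> derive1n n (fun y => c * f y) x = c * derive1n n f x) /\
  smooth_on U (fun y => c * f y).
Proof.
move=> oU sf; apply: (@derive1n_tower U (fun n y => c * derive1n n f y)) => // n x Ux.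
by apply: (der_eq (derM (derC c x) (smooth_is_derive n sf Ux))); rewrite mul0r add0r.
Qed.

Lemma wronskianE fs n x : size fs = n ->
  wronskian fs x = \det (\matrix_(i < n, j < n) derive1n i (nth (fun=> 0) fs j) x).
Proof. by move=> <-. Qed.

Lemma wronskian_eq_on U (I : eqType) (F G : I -> R -> R) (s : seq I) x : open U -> U x ->
  (forall i y, i \in s -> U y -> F i y = G i y) ->
  wronskian (map F s) x = wronskian (map G s) x.
Proof.
move=> oU Ux FG; rewrite (wronskianE x (size_map _ _)) (wronskianE x (size_map G s)).
congr (\det _); apply/matrixP => i j; rewrite !mxE.
case: s FG j i => [_ []//|a s FG j i].
rewrite !(nth_map a) //; apply: (derive1n_eq_on oU) => // y Uy.
by apply: FG => //; exact: mem_nth.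
Qed.

(** By Leibniz the matrix is the product of the lower triangular L, whose diagonal entries are all g
    x, and of the matrix of the F_i. *)
Lemma wronskianM U (I : eqType) (F : I -> R -> R) g (s : seq I) x : open U -> U x ->
  smooth_on U g -> (forall i, i \in s -> smooth_on U (F i)) ->
  wronskian (map (fun i y => g y * F i y) s) x = g x ^+ size s * wronskian (map F s) x.
Proof.
move=> oU Ux sg sF; rewrite [in RHS](wronskianE _ (size_map F s)) [LHS](wronskianE (n := size s)) ?size_map //.
pose L := \matrix_(i < size s, l < size s) ('C(i, l)%:R * derive1n (i - l) g x).
have -> : g x ^+ size s = \det L.
  rewrite det_trig; last first.
    by apply/is_trig_mxP => i j ij; rewrite mxE bin_small // mul0r.
  rewrite (eq_bigr (fun=> g x)) => [|i _]; first by rewrite prodr_const card_ord.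
  by rewrite mxE binn subnn mul1r.
rewrite -det_mulmx; congr (\det _); apply/matrixP => i j; rewrite !mxE.
have [E _] : (forall n y, U y -> derive1n n (nth (fun=> 0) (map (fun i y => g y * F i y) s) j) y =
    leibniz (nth (fun=> 0) (map F s) j) g n y) /\ smooth_on U (nth (fun=> 0) (map (fun i y => g y * F i y) s) j).
  case: s sF {L} i j => [_ []//|a s sF i j]; rewrite !(nth_map a) //.
  by apply: leibnizE => //; apply: sF; exact: mem_nth.
rewrite E // /leibniz.
rewrite (big_ord_widen (size s) (fun l => 'C(i, l)%:R * (derive1n (i - l) g x * derive1n l (nth (fun=> 0) (map F s) j) x))) //.
rewrite [RHS](bigID (fun l : 'I_(size s) => (l < i.+1)%N)) /= [X in _ = _ + X]big1 ?addr0 => [|l].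
  by apply: eq_bigr => l _; rewrite !mxE mulrA.
by rewrite -leqNgt => il; rewrite !mxE bin_small // !mul0r.
Qed.

Lemma wronskian_cons1 fs x : wronskian ((fun=> 1) :: fs) x = wronskian (map (@derive1 _ _) fs) x.
Proof.
rewrite [RHS](wronskianE x (size_map _ _)) [LHS](wronskianE (n := (size fs).+1)) //.
have d1 i : (0 < i)%N -> derive1n i (fun=> 1 : R) x = 0.
  case: i => // i _; rewrite /derive1n iterSr.
  have -> : derive1 (fun=> 1 : R) = fun=> 0 by apply/funext => y; rewrite derive1_cst.
  elim: i => [//|i IH]; rewrite iterSr.
  by have -> : derive1 (fun=> 0 : R) = fun=> 0 by apply/funext => y; rewrite derive1_cst.
rewrite (expand_det_col _ 0) big_ord_recl big1 ?addr0 => [|i _]; last first.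
  by rewrite mxE (_ : derive1n _ _ _ = 0) ?mul0r //; exact: (d1 (lift ord0 i)).
rewrite mxE /= mul1r /cofactor /= expr0 mul1r; congr (\det _).
by apply/matrixP => i j; rewrite !mxE !lift0 (nth_map (fun=> 0)) // /derive1n iterSr.
Qed.

Lemma wronskianZ U (I : eqType) (F : I -> R -> R) (k : I -> R) (s : seq I) x : open U -> U x ->
  (forall i, i \in s -> smooth_on U (F i)) ->
  wronskian (map (fun i y => k i * F i y) s) x = (\prod_(i <- s) k i) * wronskian (map F s) x.
Proof.
move=> oU Ux sF; rewrite [in RHS](wronskianE _ (size_map F s)) [LHS](wronskianE (n := size s)) ?size_map //.
case: s sF => [|a s sF]; first by rewrite big_nil mul1r !det_mx00.
set n := size (a :: s).
pose D := diag_mx (\row_(j < n) k (nth a (a :: s) j)).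
have -> : \prod_(i <- a :: s) k i = \det D.
  rewrite det_diag (big_nth a) big_mkord; apply: eq_bigr => j _; by rewrite mxE.
rewrite mulrC -det_mulmx; congr (\det _); apply/matrixP => i j.
rewrite mul_mx_diag !mxE !(nth_map a) //.
have [E _] := derive1nZ (k (nth a (a :: s) j)) oU (sF _ (mem_nth a (ltn_ord j))).
by rewrite E // mulrC.
Qed.

Lemma wronskian_perm (I : eqType) (F : I -> R -> R) (s t : seq I) : perm_eq s t ->
  exists2 e : R, e != 0 & forall x, wronskian (map F s) x = e * wronskian (map F t) x.
Proof.
case: s => [|a s] st.
  have := perm_size st; case: t {st} => // _; exists 1 => [|x]; first exact: oner_neq0.
  by rewrite mul1r.
have sz : size t = size (a :: s) by rewrite (perm_size st).
have [p hp] : exists p : {perm 'I_(size t)}, a :: s = [tuple tnth (in_tuple t) (p i) | i < size t].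
  exact/tuple_permP.
exists ((-1) ^+ p) => [|x]; first by rewrite signr_eq0.
rewrite (wronskianE (n := size t)) ?size_map // (wronskianE (n := size t)) ?size_map //.
set Ms := \matrix_(i, j) _; set Mt := \matrix_(i, j) _.
suff -> : Ms = col_perm p Mt by rewrite col_permE det_mulmx det_perm odd_permV mulrC.
apply/matrixP => i j; rewrite !mxE (nth_map a); last by rewrite -sz.
rewrite (nth_map a) //.
by rewrite hp -tnth_nth tnth_mktuple (tnth_nth a).
Qed.

Lemma wronskian_flip U (I : eqType) (F : I -> R -> R) (s : seq I) : open U ->
  (forall x, U x -> U (- x)) -> (forall i, i \in s -> smooth_on U (F i)) ->
  exists2 e : R, e != 0 & forall x, U x ->
    wronskian (map (fun i y => F i (- y)) s) x = e * wronskian (map F s) (- x).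
Proof.
move=> oU sU sF; exists (\prod_(i < size s) (-1) ^+ i) => [|x Ux].
  by apply/prodf_neq0 => i _; rewrite signr_eq0.
rewrite [in RHS](wronskianE _ (size_map F s)) [LHS](wronskianE (n := size s)) ?size_map //.
pose D : 'rV[R]_(size s) := \row_(i < size s) (-1) ^+ i.
have -> : \prod_(i < size s) (-1) ^+ i = \det (diag_mx D).
  by rewrite det_diag; apply: eq_bigr => j _; rewrite mxE.
rewrite -det_mulmx; congr (\det _); apply/matrixP => i j.
rewrite mul_diag_mx !mxE; case: s sF {D} i j => [_ []//|a s sF i j].
rewrite !(nth_map a) //.
have sf := sF _ (mem_nth a (ltn_ord j)); move: (F _) sf => f sf.
have [|E _] := @derive1n_tower U (fun n y => (-1) ^+ n * derive1n n f (- y)) oU.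
  move=> n y Uy.
  have dc : is_derive y 1 (fun z => derive1n n f (- z)) (derive1n n.+1 f (- y) * (- 1)).
    apply: (@is_derive1_comp _ (derive1n n f) (fun z => - z)).
    by apply: smooth_is_derive sf _; exact: sU.
  by apply: (der_eq (derM (derC _ y) dc)); rewrite mul0r add0r exprS; ring.
have e0 : (fun y => (-1) ^+ 0 * derive1n 0 f (- y)) = (fun y => f (- y)).
  by apply/funext => y; rewrite expr0 mul1r.
by rewrite -e0 E.
Qed.
End Wronskians.

(** * The duality between mu and its conjugate *)

Section QuasiPolynomials.
Variable R : realType.
Implicit Types (c d x : R) (p q : {poly R}) (U : set R).

Definition I11 : set R := [set x | -1 < x < 1].

Lemma open_I11 : open I11.
Proof.
rewrite (_ : I11 = [set` `]-1, 1[]); first exact: interval_open.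
by apply/seteqP; split=> x; rewrite /I11 /= in_itv.
Qed.

(** Derivation lowers both exponents by 1 and sends p to [dqf c d p], so the class is stable and all
    its members are smooth on (-1, 1). *)
Definition qf c d p x : R := (1 + x) `^ c * (1 - x) `^ d * p.[x].

Definition dqf c d p : {poly R} :=
  (c%:P * (1 - 'X) - d%:P * (1 + 'X)) * p + (1 - 'X ^+ 2) * p^`().

Lemma I11_gt0 x : I11 x -> 0 < 1 + x /\ 0 < 1 - x.
Proof. by rewrite /I11 /= => /andP[h1 h2]; split; lra. Qed.

Lemma powRD_gt0 (y c d : R) : 0 < y -> y `^ (c + d) = y `^ c * y `^ d.
Proof. by move=> y0; rewrite powRD // (gt_eqF y0) implybT. Qed.

Lemma powRS (y c : R) : 0 < y -> y `^ (c + 1) = y `^ c * y.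
Proof. by move=> y0; rewrite powRD_gt0 // powRr1 // ltW. Qed.

Lemma powRP (y c : R) : 0 < y -> y `^ c = y `^ (c - 1) * y.
Proof. by move=> y0; rewrite -powRS // subrK. Qed.

Lemma is_derive_qf c d p x : I11 x -> is_derive x 1 (qf c d p) (qf (c - 1) (d - 1) (dqf c d p) x).
Proof.
move=> /I11_gt0[x1 x2].
have d1 : is_derive x 1 (fun y : R => (1 + y) `^ c) (c * (1 + x) `^ (c - 1) * 1).
  apply: (@is_derive1_comp _ (fun z => z `^ c) (fun y => 1 + y)).
    exact: is_derive1_powR.
  by apply: (der_eq (derD (derC _ x) (derId x))); rewrite add0r.
have d2 : is_derive x 1 (fun y : R => (1 - y) `^ d) (d * (1 - x) `^ (d - 1) * (- 1)).
  apply: (@is_derive1_comp _ (fun z => z `^ d) (fun y => 1 - y)).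
    exact: is_derive1_powR.
  by apply: (der_eq (derD (derC _ x) (derN (derId x)))); rewrite add0r.
apply: (der_eq (derM (derM d1 d2) (is_derive_poly p x))).
rewrite (powRP c x1) (powRP d x2) /qf /dqf.
have h1 : (1 - 'X : {poly R}).[x] = 1 - x by rewrite -polyC1 hornerD hornerN hornerX hornerC.
have h2 : (1 + 'X : {poly R}).[x] = 1 + x by rewrite -polyC1 hornerD hornerX hornerC.
have h3 : (1 - 'X^2 : {poly R}).[x] = 1 - x ^+ 2 by rewrite -polyC1 hornerD hornerN hornerXn hornerC.
rewrite hornerD !hornerM h3 hornerD hornerN !hornerM h1 h2 !hornerC.
by ring.
Qed.

Lemma smooth_qf c d p : smooth_on I11 (qf c d p).
Proof.
pose F := fix F n := match n with
  | 0%N => (c, d, p)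
  | m.+1 => let: (c', d', p') := F m in (c' - 1, d' - 1, dqf c' d' p')
  end.
have [|_] := @derive1n_tower R I11 (fun n x => let: (c', d', p') := F n in qf c' d' p' x) open_I11; last by [].
move=> n x Ix /=; case: (F n) => -[c' d'] p'; exact: is_derive_qf.
Qed.

Lemma qfM c d p c' d' p' x : I11 x -> qf c d p x * qf c' d' p' x = qf (c + c') (d + d') (p * p') x.
Proof.
move=> /I11_gt0[x1 x2]; rewrite /qf hornerM !powRD_gt0 //; ring.
Qed.

Lemma derive1_qfM c d p c' d' p' x : I11 x ->
  derive1 (fun y => qf c d p y * qf c' d' p' y) x =
  qf (c + c' - 1) (d + d' - 1) (dqf (c + c') (d + d') (p * p')) x.
Proof.
move=> Ix; rewrite derive1E.
have [_ <-] := is_derive_qf (c + c') (d + d') (p * p') Ix.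
apply: near_eq_derive; have := open_nbhs_nbhs (conj open_I11 Ix).
by apply: filterS => y; exact: qfM.
Qed.

Lemma qf_mulB c d p x : I11 x -> qf c (d - 1) ((1 - 'X) * p) x = qf c d p x.
Proof.
move=> /I11_gt0[x1 x2]; rewrite /qf hornerM (powRP d x2).
by rewrite -polyC1 hornerD hornerN hornerX hornerC; ring.
Qed.

Lemma qf_mulD c d p x : I11 x -> qf (c - 1) d ((1 + 'X) * p) x = qf c d p x.
Proof.
move=> /I11_gt0[x1 x2]; rewrite /qf hornerM (powRP c x1).
by rewrite -polyC1 hornerD hornerX hornerC; ring.
Qed.

Lemma qfZ c d k p x : qf c d (k *: p) x = k * qf c d p x.
Proof. by rewrite /qf hornerZ; ring. Qed.

Lemma qf_neq0 c d x : I11 x -> qf c d 1 x != 0.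
Proof.
move=> /I11_gt0[x1 x2]; rewrite /qf -polyC1 hornerC mulr1.
by rewrite mulf_neq0 // gt_eqF // powR_gt0.
Qed.

(** Multiplying the columns by v = 1/f0 turns the first one into 1 and leaves the Wronskian of the
    derivatives of the v F_i, which are multiples of w G_i. It serves the duality, with powers of 1
    + x or 1 - x, and also the divisions in Rolle's argument. *)
Lemma wronskian_step U (I : eqType) (F G : I -> R -> R) (f0 v w : R -> R) (k : I -> R) (s : seq I) :
  open U -> smooth_on U f0 -> smooth_on U v -> smooth_on U w ->
  (forall i, i \in s -> smooth_on U (F i)) -> (forall i, i \in s -> smooth_on U (G i)) ->
  (forall x, U x -> v x * f0 x = 1) ->
  (forall i x, i \in s -> U x -> derive1 (fun y => v y * F i y) x = k i * (w x * G i x)) ->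
  forall x, U x -> v x ^+ (size s).+1 * wronskian (f0 :: map F s) x =
    (\prod_(i <- s) k i) * (w x ^+ size s * wronskian (map G s) x).
Proof.
move=> oU s0 sv sw sF sG vf0 dF x Ux.
pose F' (o : option I) := if o is Some i then F i else f0.
pose H (o : option I) := if o is Some i then (fun y => v y * F i y) else (fun=> 1).
pose s' := None :: map Some s.
have e1 : f0 :: map F s = map F' s' by rewrite /= -map_comp.
have hF' i : i \in s' -> smooth_on U (F' i).
  case: i => [i|] si; last exact: s0.
  apply: sF; move: si; rewrite inE /=; rewrite mem_map; last by move=> ? ? [].
  exact.
have h1 := @wronskianM R U _ F' v s' x oU Ux sv hF'.
have h2 : wronskian (map (fun i y => v y * F' i y) s') x = wronskian (map H s') x.
  by apply: (@wronskian_eq_on R U _ (fun i y => v y * F' i y) H s' x oU Ux) => -[i|] y // _; exact: vf0.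
have h3 : wronskian (map H s') x = wronskian (map (fun i => derive1 (fun y => v y * F i y)) s) x.
  by rewrite /s' [map H _]/= wronskian_cons1 -!map_comp.
have h4 := @wronskian_eq_on R U _ (fun i => derive1 (fun y => v y * F i y))
  (fun i y => k i * (w y * G i y)) s x oU Ux dF.
have hG i : i \in s -> smooth_on U (fun y => w y * G i y).
  by move=> si; exact: (smoothM oU sw (sG i si)).
have h5 := @wronskianZ R U _ (fun i y => w y * G i y) k s x oU Ux hG.
have h6 := @wronskianM R U _ G w s x oU Ux sw sG.
have sz : size s' = (size s).+1 by rewrite /s' /= size_map.
by rewrite e1 -sz -h1 h2 h3 h4 h5 h6.
Qed.

(** The factor is smooth and without zeros on (-1, 1), so f and g share their zeros there, with the
    same simplicity. *)
Definition wsim (f g : R -> R) := exists C e e' : R, C != 0 /\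
  forall x, I11 x -> f x = C * qf e e' 1 x * g x.

Lemma wsim_scale (C : R) f g : C != 0 -> (forall x, I11 x -> f x = C * g x) -> wsim f g.
Proof.
move=> C0 fg; exists C, 0, 0; split=> // x Ix.
by rewrite fg // /qf !powRr0 -polyC1 hornerC !mulr1.
Qed.

Lemma wsim_eq_on f g : (forall x, I11 x -> f x = g x) -> wsim f g.
Proof.
by move=> fg; apply: (wsim_scale (oner_neq0 R)) => x Ix; rewrite mul1r fg.
Qed.

Lemma wsim_refl f : wsim f f.
Proof. exact: wsim_eq_on. Qed.

Lemma qfK e e' x : I11 x -> qf e e' 1 x * qf (- e) (- e') 1 x = 1.
Proof. by move=> Ix; rewrite qfM // !subrr mulr1 /qf !powRr0 -polyC1 hornerC !mul1r. Qed.

Lemma wsim_sym f g : wsim f g -> wsim g f.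
Proof.
move=> [C [e [e' [C0 h]]]]; exists C^-1, (- e), (- e'); split; first by rewrite invr_eq0.
move=> x Ix; rewrite h //; have := qfK e e' Ix.
move: (qf _ _ _ _) (qf _ _ _ _) => u v uv.
by rewrite (_ : _ * (_ * g x) = v * u * (C^-1 * C) * g x); [rewrite uv mulVf // !mul1r | ring].
Qed.

Lemma wsim_trans f g h : wsim f g -> wsim g h -> wsim f h.
Proof.
move=> [C [e [e' [C0 fg]]]] [D [k [k' [D0 gh]]]].
exists (C * D), (e + k), (e' + k'); split; first by rewrite mulf_neq0.
by move=> x Ix; rewrite fg // gh // -[1 in RHS]mulr1 -qfM //; ring.
Qed.

End QuasiPolynomials.

(** * The steps (a, b) -> (a + 1, b - 1) *)

Section Duality.
Variable R : realType.
Implicit Types (a b x : R) (s : seq (nat * nat)).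

(* The tags 0, 1, 2 stand for P_n^(a,b), (1+x)^(-b) P_n^(a,-b), (1-x)^(-a) P_n^(-a,b). *)
Definition jacobi_fam a b (i : nat * nat) : R -> R :=
  match i.1 with
  | 0%N => qf 0 0 (jacobi a b i.2)
  | 1%N => qf (- b) 0 (jacobi a (- b) i.2)
  | _ => qf 0 (- a) (jacobi (- a) b i.2)
  end.

Definition tag_shift (i : nat * nat) : nat * nat :=
  match i.1 with
  | 0%N => i
  | 1%N => (1, i.2.-1)%N
  | t => (t, i.2.+1)
  end.

Lemma smooth_jacobi_fam a b i : smooth_on (@I11 R) (jacobi_fam a b i).
Proof. by rewrite /jacobi_fam; case: i.1 => [|[|t]]; exact: smooth_qf. Qed.

Lemma qf_eq (c d c' d' : R) p p' x : c = c' -> d = d' -> p = p' -> qf c d p x = qf c' d' p' x.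
Proof. by move=> -> -> ->. Qed.

Definition down_const a b (i : nat * nat) : R :=
  match i.1 with
  | 0%N => i.2%:R + b
  | 1%N => (i.2%:R + a - b + 1) / 2
  | _ => - 2 * i.2.+1%:R
  end.

(** The cases are [jacobi_mulXD1], [deriv_jacobi] and [jacobi_lift]: the factor (1+x)^b cancels the
    power in tag 1, leaving a polynomial, and completes the weight (1-x)^(-a) (1+x)^b in tag 2. *)
Lemma down_derive a b i x : (i.1 = 1 -> 0 < i.2)%N -> I11 x ->
  derive1 (fun y => qf b 0 1 y * jacobi_fam a b i y) x =
  down_const a b i * (qf (b - 1) 0 1 x * jacobi_fam (a + 1) (b - 1) (tag_shift i) x).
Proof.
case: i => -[|[|t]] n /= n0 Ix; rewrite /jacobi_fam /down_const /tag_shift /=.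
- rewrite derive1_qfM // qfM // -qfZ -[in RHS]qf_mulB //; apply: qf_eq; [by ring | by ring |].
  rewrite !addr0 !mul1r.
  rewrite -jacobi_mulXD1 /dqf -!mul_polyC polyC0; ring.
- case: n n0 => [/(_ erefl)//|n _]; rewrite derive1_qfM // qfM //.
  rewrite -qfZ -[in RHS]qf_mulB // -[in RHS]qf_mulD //.
  apply: qf_eq; [by ring | by ring |].
  rewrite !mul1r subrr addr0 opprB [1 - b]addrC /dqf /= -deriv_jacobi polyC0; ring.
- rewrite derive1_qfM // qfM // -qfZ; apply: qf_eq; [by ring | by ring |].
  by rewrite !mul1r addr0 add0r /dqf (opprD a 1) -jacobi_lift.
Qed.

Definition up_const a b (i : nat * nat) : R :=
  match i.1 with
  | 0%N => - (i.2%:R + (a + 1))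
  | 1%N => - 2 * i.2%:R
  | _ => (i.2%:R - a + b) / 2
  end.

(** The step read backwards, from (a + 1, b - 1) to (a, b): the factor (1-x)^(a+1) exchanges the
    parts of tags 1 and 2, and [jacobi_mulXB1] handles tag 0. *)
Lemma up_derive a b i x : (i.1 = 1 -> 0 < i.2)%N -> I11 x ->
  derive1 (fun y => qf 0 (a + 1) 1 y * jacobi_fam (a + 1) (b - 1) (tag_shift i) y) x =
  up_const a b i * (qf 0 a 1 x * jacobi_fam a b i x).
Proof.
case: i => -[|[|t]] n /= n0 Ix; rewrite /jacobi_fam /up_const /tag_shift /=.
- rewrite derive1_qfM // qfM // -qfZ -[in RHS]qf_mulD //; apply: qf_eq; [by ring | by ring |].
  have := jacobi_mulXB1 (a + 1) (b - 1) n; rewrite addrK subrK !mul1r => <-.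
  rewrite /dqf -!mul_polyC !addr0 polyC0 polyCN; ring.
- case: n n0 => [/(_ erefl)//|n _]; rewrite derive1_qfM // qfM // -qfZ.
  apply: qf_eq; [by ring | by ring |].
  have := jacobi_lift (a + 1) (- (b - 1)) n; rewrite addrK /= (_ : - (b - 1) - 1 = - b); last by ring.
  by rewrite !mul1r => <-; rewrite /dqf add0r addr0.
- rewrite derive1_qfM // qfM // -qfZ -[in RHS]qf_mulB // -[in RHS]qf_mulD //.
  apply: qf_eq; [by ring | by ring |].
  have := deriv_jacobi (- (a + 1)) (b - 1) n; rewrite subrK (_ : - (a + 1) + 1 = - a); last by ring.
  rewrite (_ : n.+1%:R + - (a + 1) + (b - 1) + 1 = n%:R - a + b); last first.
    by rewrite -[n.+1%:R]natr1; ring.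
  by rewrite !mul1r => <-; rewrite /dqf subrr add0r !polyC0; ring.
Qed.

Lemma wsim_of_step (n m : nat) (f g : R -> R) (c d c' d' k : R) : k != 0 ->
  (forall x, I11 x -> qf c d 1 x ^+ n * f x = k * (qf c' d' 1 x ^+ m * g x)) -> wsim f g.
Proof.
move=> k0 h.
have qfX (e e' : R) j x : I11 x -> qf e e' 1 x ^+ j = qf (j%:R * e) (j%:R * e') 1 x.
  move=> Ix; elim: j => [|j IH]; first by rewrite !mul0r /qf !powRr0 -polyC1 hornerC !mul1r.
  by rewrite exprS IH qfM // mulr1 -natr1; apply: qf_eq => //; ring.
exists k, (m%:R * c' - n%:R * c), (m%:R * d' - n%:R * d); split => // x Ix.
have := h x Ix; rewrite !qfX // => E.
have := qf_neq0 (n%:R * c) (n%:R * d) Ix => /mulfI; apply.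
rewrite E; have -> : qf (m%:R * c') (m%:R * d') 1 x =
   qf (n%:R * c) (n%:R * d) 1 x * qf (m%:R * c' - n%:R * c) (m%:R * d' - n%:R * d) 1 x.
  by rewrite qfM // mulr1; apply: qf_eq => //; ring.
ring.
Qed.

(* The function of tag 1 and degree 0 becomes constant and disappears. *)
Lemma wsim_down a b s : (forall i, i \in s -> i.1 = 1 -> 0 < i.2)%N ->
  (forall i, i \in s -> down_const a b i != 0) ->
  wsim (wronskian (map (jacobi_fam a b) ((1, 0)%N :: s)))
       (wronskian (map (jacobi_fam (a + 1) (b - 1)) (map tag_shift s))).
Proof.
move=> s0 sk.
have kn : \prod_(i <- s) down_const a b i != 0.
  by rewrite prodf_seq_neq0; apply/allP => i /sk.
apply: (@wsim_of_step (size s).+1 (size s) _ _ b 0 (b - 1) 0 _ kn) => x Ix.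
rewrite -map_comp.
apply: (@wronskian_step _ (@I11 R) _ (jacobi_fam a b)
  (fun i => jacobi_fam (a + 1) (b - 1) (tag_shift i))) => //.
- exact: open_I11.
- exact: smooth_jacobi_fam.
- exact: smooth_qf.
- exact: smooth_qf.
- by move=> i _; exact: smooth_jacobi_fam.
- by move=> i _; exact: smooth_jacobi_fam.
- by move=> y Iy; rewrite /jacobi_fam /= jacobi0; have := qfK b 0 Iy; rewrite oppr0.
- by move=> i y si Iy; apply: down_derive => //; exact: s0.
Qed.

(* A constant function is inserted and becomes the one of tag 2 and degree 0. *)
Lemma wsim_up a b s : (forall i, i \in s -> i.1 = 1 -> 0 < i.2)%N ->
  (forall i, i \in s -> up_const a b i != 0) ->
  wsim (wronskian (map (jacobi_fam a b) s))
       (wronskian (map (jacobi_fam (a + 1) (b - 1)) ((2, 0)%N :: map tag_shift s))).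
Proof.
move=> s0 sk; apply: wsim_sym.
have kn : \prod_(i <- s) up_const a b i != 0.
  by rewrite prodf_seq_neq0; apply/allP => i /sk.
apply: (@wsim_of_step (size s).+1 (size s) _ _ 0 (a + 1) 0 a _ kn) => x Ix.
rewrite map_cons -map_comp.
apply: (@wronskian_step _ (@I11 R) _ (fun i => jacobi_fam (a + 1) (b - 1) (tag_shift i))
  (jacobi_fam a b)) => //.
- exact: open_I11.
- exact: smooth_jacobi_fam.
- exact: smooth_qf.
- exact: smooth_qf.
- by move=> i _; exact: smooth_jacobi_fam.
- by move=> i _; exact: smooth_jacobi_fam.
- by move=> y Iy; rewrite /jacobi_fam /= jacobi0; have := qfK 0 (a + 1) Iy; rewrite oppr0.
- by move=> i y si Iy; apply: up_derive => //; exact: s0.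
Qed.

Lemma wsim_perm (F : nat * nat -> R -> R) s t : perm_eq s t ->
  wsim (wronskian (map F s)) (wronskian (map F t)).
Proof. by move=> /(wronskian_perm F)[e e0 h]; apply: (wsim_scale e0) => x _. Qed.

Definition tagged3 (L M K : seq nat) : seq (nat * nat) :=
  map (pair 0%N) L ++ map (pair 1%N) M ++ map (pair 2) K.

Lemma map_tag_shift L M K :
  map tag_shift (tagged3 L M K) = tagged3 L (map predn M) (map succn K).
Proof. by rewrite /tagged3 !map_cat -!map_comp. Qed.

Lemma mem_tagged3 L M K i : i \in tagged3 L M K ->
  [\/ exists2 n, n \in L & i = (0%N, n), exists2 m, m \in M & i = (1%N, m) |
      exists2 k, k \in K & i = (2, k)].
Proof.
rewrite !mem_cat => /or3P[] /mapP[n nl ->]; [apply: Or31|apply: Or32|apply: Or33];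
  by exists n.
Qed.

(* The degrees k produced by T steps of the duality from the degrees M. *)
Definition dual_set (T : nat) (M : seq nat) : seq nat :=
  [seq (T.-1 - t)%N | t <- iota 0 T & t \notin M].

(** Step t, at the parameters (a + t, b - t), goes by [wsim_down] if t is in M and by [wsim_up]
    otherwise. The nonvanishing hypotheses say that no constant is 0 at any step: [HL1] and [HL2]
    for tag 0, [HM] for tag 1, [HK] for the initial functions of tag 2, and [HT] for one created at
    step t when it undergoes step t'. *)
Lemma jacobi_duality (T : nat) a b (L M K : seq nat) : uniq M ->
  (forall m, m \in M -> (m < T)%N) ->
  (forall n t, n \in L -> t \in M -> n%:R + b - t%:R != 0) ->
  (forall n t, n \in L -> (t < T)%N -> t \notin M -> n%:R + a + t%:R + 1 != 0) ->
  (forall m t, m \in M -> t \in M -> (t < m)%N -> m%:R + a - b + 1 + t%:R != 0) ->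
  (forall k t, k \in K -> (t < T)%N -> t \notin M -> k%:R - a + b - t%:R != 0) ->
  (forall t t', (t < t')%N -> (t' < T)%N -> t \notin M -> t' \notin M ->
    b - a - t%:R - t'%:R - 1 != 0) ->
  wsim (wronskian (map (jacobi_fam a b) (tagged3 L M K)))
    (wronskian (map (jacobi_fam (a + T%:R) (b - T%:R))
      (tagged3 L [::] (dual_set T M ++ map (addn T) K)))).
Proof.
elim: T a b M K => [|T IH] a b M K uM MT HL1 HL2 HM HK HT.
  case: M uM MT {HL1 HL2 HM HK HT} => [|m M] _ MT; last by have := MT m (mem_head _ _).
  rewrite addr0 subr0 /dual_set /= (_ : map (addn 0) K = K); first exact: wsim_refl.
  by rewrite -[RHS]map_id; apply: eq_map => k; rewrite add0n.
pose M' := map predn (rem 0%N M).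
have memM' t : (t \in M') = (t.+1 \in M).
  apply/mapP/idP => [[m]|tM]; last first.
    by exists t.+1; rewrite // mem_rem_uniq // inE.
  by rewrite mem_rem_uniq // inE => /andP[m0 mM] ->; rewrite prednK // lt0n.
have uM' : uniq M'.
  rewrite map_inj_in_uniq ?rem_uniq // => m m'; rewrite !mem_rem_uniq // !inE.
  by case: m m' => [|m] [|m'] //= _ _ ->.
have aT : a + T.+1%:R = a + 1 + T%:R by rewrite -[T.+1%:R]natr1; ring.
have bT : b - T.+1%:R = b - 1 - T%:R by rewrite -[T.+1%:R]natr1; ring.
rewrite aT bT.
have IH' K' := IH (a + 1) (b - 1) M' K' uM'.
have {}IH' K' : (forall k t, k \in K' -> (t < T)%N -> t \notin M' -> k%:R - (a + 1) + (b - 1) - t%:R != 0) ->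
  wsim (wronskian (map (jacobi_fam (a + 1) (b - 1)) (tagged3 L M' K')))
    (wronskian (map (jacobi_fam (a + 1 + T%:R) (b - 1 - T%:R))
      (tagged3 L [::] (dual_set T M' ++ map (addn T) K')))).
  move=> hK; apply: IH' => //.
  - by move=> m; rewrite memM' => /MT.
  - move=> n t nL; rewrite memM' => tM; have := HL1 n _ nL tM.
    by rewrite -[t.+1%:R]natr1; apply: contra_neq; lra.
  - move=> n t nL tT; rewrite memM' => tM; have := HL2 n t.+1 nL tT tM.
    by rewrite -[t.+1%:R]natr1; apply: contra_neq; lra.
  - move=> m t; rewrite !memM' => mM tM tm; have := HM _ _ mM tM tm.
    rewrite -[t.+1%:R]natr1 -[m.+1%:R]natr1; apply: contra_neq; lra.
  - move=> t t' tt' t'T; rewrite !memM' => tM t'M; have := HT t.+1 t'.+1 tt' t'T tM t'M.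
    rewrite -[t.+1%:R]natr1 -[t'.+1%:R]natr1; apply: contra_neq; lra.
have dsE : dual_set T.+1 M = (if 0%N \in M then [::] else [:: T]) ++ dual_set T M'.
  rewrite /dual_set (_ : iota 0 T.+1 = 0%N :: map succn (iota 0 T)); last first.
    by rewrite /= -[1%N]/(1 + 0)%N iotaDl.
  have E : [seq (T.+1.-1 - t)%N | t <- [seq t <- map succn (iota 0 T) | t \notin M]] =
      [seq (T.-1 - t)%N | t <- iota 0 T & t \notin M'].
    rewrite filter_map -map_comp (@eq_filter _ _ (fun t => t \notin M')); last first.
      by move=> t /=; rewrite memM'.
    by apply: eq_map => t /=; lia.
  move: E => /= E; have [M0|M0] := boolP (0%N \in M); first by rewrite /= E.
  by rewrite /= E subn0.
have [M0|M0] := boolP (0%N \in M).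
  have p1 : perm_eq (tagged3 L M K) ((1, 0)%N :: tagged3 L (rem 0%N M) K).
    rewrite /tagged3 -[X in perm_eq _ X]cat1s perm_sym perm_catCA perm_cat2l perm_sym.
    by rewrite catA perm_cat2r; exact: perm_map (perm_to_rem M0).
  apply: (wsim_trans (wsim_perm _ p1)).
  have p2 : wsim (wronskian (map (jacobi_fam a b) ((1, 0)%N :: tagged3 L (rem 0%N M) K)))
     (wronskian (map (jacobi_fam (a + 1) (b - 1)) (tagged3 L M' (map succn K)))).
    rewrite -map_tag_shift; apply: wsim_down => i /mem_tagged3[] [n nl ->] //=.
    - by move: nl; rewrite mem_rem_uniq // inE lt0n => /andP[].
    - by have := HL1 n _ nl M0; rewrite subr0.
    - move: nl; rewrite mem_rem_uniq // inE => /andP[n0 nM]; rewrite /down_const /=.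
      have := HM n 0%N nM M0; rewrite addr0 lt0n => /(_ n0) h.
      by rewrite mulf_neq0 // invr_eq0.
    - by rewrite /down_const /= mulf_neq0 // oppr_eq0.
  apply: (wsim_trans p2).
  rewrite dsE M0 cat0s.
  have -> : map (addn T.+1) K = map (addn T) (map succn K).
    by rewrite -map_comp; apply: eq_map => k /=; rewrite addSnnS.
  apply: IH' => k t /mapP[k' kK ->] tT; rewrite memM' => tM.
  have := HK k' t.+1 kK tT tM; rewrite -[t.+1%:R]natr1 -[k'.+1%:R]natr1.
  by apply: contra_neq; lra.
have rM : rem 0%N M = M by rewrite rem_id.
have p2 : wsim (wronskian (map (jacobi_fam a b) (tagged3 L M K)))
     (wronskian (map (jacobi_fam (a + 1) (b - 1)) ((2, 0)%N :: tagged3 L M' (map succn K)))).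
  rewrite /M' rM -map_tag_shift; apply: wsim_up => i /mem_tagged3[] [n nl ->] //=.
  - by rewrite lt0n => _; apply: contraNneq M0 => <-.
  - rewrite /up_const /= oppr_eq0; have := HL2 n 0%N nl isT M0.
    by rewrite addr0 -addrA.
  - rewrite /up_const /= mulf_neq0 // ?oppr_eq0 // pnatr_eq0.
    by apply: contraNneq M0 => <-.
  - rewrite /up_const /= mulf_neq0 // ?invr_eq0 //.
    by have := HK n 0%N nl isT M0; rewrite subr0.
apply: (wsim_trans p2).
have p1 : perm_eq ((2, 0)%N :: tagged3 L M' (map succn K)) (tagged3 L M' (0%N :: map succn K)).
  by rewrite /tagged3 -[X in perm_eq X _]cat1s perm_catCA perm_cat2l perm_catCA.
apply: (wsim_trans (wsim_perm _ p1)).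
have h := IH' (0%N :: map succn K).
apply: (wsim_trans (h _)).
  move=> k t; rewrite inE => /predU1P[->|/mapP[k' kK ->]] tT; rewrite memM' => tM.
    have := HT 0%N t.+1 isT tT M0 tM; rewrite -[t.+1%:R]natr1.
    by apply: contra_neq; lra.
  have := HK k' t.+1 kK tT tM; rewrite -[t.+1%:R]natr1 -[k'.+1%:R]natr1.
  by apply: contra_neq; lra.
apply: wsim_perm; rewrite /tagged3 perm_cat2l /=.
rewrite perm_map // dsE (negPf M0) /= addn0 -map_comp -[X in perm_eq _ X]cat1s.
rewrite -[X in perm_eq (_ ++ X) _]cat1s perm_catCA !perm_cat2l.
by rewrite (eq_map (g := addn T.+1)) // => t /=; rewrite addSnnS.
Qed.

End Duality.

(** * Polynomiality and the limit at 1 *)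

Section EulerMatrix.
Variable R : realType.
Implicit Types (b c x : R) (p q : {poly R}).

(* The [i]-th derivative of (1+x)^(-b) p is (1+x)^(-b-i) times [Eop b p i];
   the scaling makes [Eop b p i] as divisible by 1+X as [p]. *)
Fixpoint Eop b p (i : nat) : {poly R} :=
  if i is j.+1 then (1 + 'X) * (Eop b p j)^`() - (b + j%:R) *: Eop b p j else p.

Lemma derive1n_Eop b p i x : I11 x ->
  derive1n i (qf (- b) 0 p) x = (1 + x) `^ (- b - i%:R) * (Eop b p i).[x].
Proof.
move=> Ix; have [|E _] := @derive1n_tower R (@I11 R) (fun n => qf (- b - n%:R) 0 (Eop b p n)) (@open_I11 R).
  move=> n y Iy; apply: (der_eq (is_derive_qf _ _ _ Iy)).
  rewrite -[RHS]qf_mulB //; apply: qf_eq => //; first by rewrite -[n.+1%:R]natr1; ring.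
  rewrite /dqf /= polyC0 -mul_polyC !(polyCB, polyCD, polyCN); ring.
have := E i x Ix; rewrite subr0 => ->.
by rewrite /qf powRr0 mulr1.
Qed.

Lemma EopD b p q i : Eop b (p + q) i = Eop b p i + Eop b q i.
Proof.
elim: i => //= i ->; rewrite derivD mulrDr scalerDr opprD !addrA; congr (_ + _).
by rewrite -!addrA; congr (_ + _); rewrite addrC.
Qed.

Lemma EopZ b c p i : Eop b (c *: p) i = c *: Eop b p i.
Proof.
elim: i => //= i ->; rewrite derivZ -scalerAr scalerBr !scalerA; congr (_ - _ *: _).
by rewrite mulrC.
Qed.

Lemma Eop_sum b (n : nat) (f : 'I_n -> {poly R}) i :
  Eop b (\sum_j f j) i = \sum_j Eop b (f j) i.
Proof.
apply: (big_morph (fun p => Eop b p i)); first by move=> p q; exact: EopD.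
by have := EopZ b 0 0 i; rewrite !scale0r.
Qed.

Lemma deriv1DX_exp m : ((1 + 'X : {poly R}) ^+ m)^`() = (1 + 'X) ^+ m.-1 *+ m.
Proof. by rewrite deriv_exp -polyC1 derivD derivC derivX add0r mul1r. Qed.

Lemma dvdp_Eop b m p i : (1 + 'X) ^+ m %| p -> (1 + 'X) ^+ m %| Eop b p i.
Proof.
move=> mp; elim: i => //= i IH; apply: dvdp_sub; last by rewrite -mul_polyC dvdp_mull.
have /dvdpP[q ->] := IH; case: m mp {IH} q => [|m] _ q; first by rewrite expr0 dvd1p.
rewrite derivM deriv1DX_exp mulrDr dvdp_add //; first by rewrite mulrA dvdp_mull.
have -> : (1 + 'X) * (q * ((1 + 'X) ^+ m.+1.-1 *+ m.+1)) = (q *+ m.+1) * (1 + 'X) ^+ m.+1.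
  rewrite /= exprS !mulrnAr mulrnAl; congr (_ *+ _).
  by move: ((1 + 'X) ^+ m) => Z; move: (1 + 'X) => Y; ring.
exact: dvdp_mull.
Qed.

(** For exponent 0 the ordinary derivatives reappear; this turns the last column of the Wronskian
    into the derivatives of P_s. *)
Lemma Eop0 p i : Eop 0 p i = (1 + 'X) ^+ i * p^`(i).
Proof.
elim: i => [|i /= ->]; first by rewrite mul1r.
rewrite derivM deriv1DX_exp add0r -mul_polyC polyC_natr -[(1 + 'X) ^+ _ *+ _]mulr_natr.
case: i => [|i] /=; first by rewrite !expr0; ring.
rewrite !exprS; move: ((1 + 'X) ^+ i) => Z; move: (1 + 'X) => Y; ring.
Qed.

Definition qfam (i : R * {poly R}) : R -> R := qf (- i.1) 0 i.2.

Definition Emx (n : nat) (cs : seq (R * {poly R})) : 'M[{poly R}]_n :=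
  \matrix_(i, j) Eop (nth (0, 0) cs j).1 (nth (0, 0) cs j).2 i.

(** The column of a function with exponent -b_j contributes -b_j, and the row i contributes -i. *)
Definition wexp (cs : seq (R * {poly R})) : R :=
  - \sum_(i <- cs) i.1 - \sum_(i < size cs) i%:R.

Lemma wronskian_Emx cs x : I11 x ->
  wronskian (map qfam cs) x = (1 + x) `^ wexp cs * (\det (Emx (size cs) cs)).[x].
Proof.
move=> Ix; have [x1 _] := I11_gt0 Ix; set n := size cs.
rewrite (wronskianE (n := n)) ?size_map //.
have -> : (\det (Emx n cs)).[x] = \det (map_mx (horner_eval x) (Emx n cs)) by rewrite det_map_mx.
pose D1 : 'rV[R]_n := \row_i (1 + x) `^ (- i%:R).
pose D2 : 'rV[R]_n := \row_j (1 + x) `^ (- (nth (0, 0) cs j).1).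
have powR_sum (I : Type) (s : seq I) (f : I -> R) : \prod_(i <- s) (1 + x) `^ (f i) = (1 + x) `^ (\sum_(i <- s) f i).
  elim: s => [|a s IH]; first by rewrite !big_nil powRr0.
  by rewrite !big_cons IH powRD_gt0.
have -> : (1 + x) `^ wexp cs = \det (diag_mx D1) * \det (diag_mx D2).
  rewrite !det_diag (eq_bigr (fun i : 'I_n => (1 + x) `^ (- i%:R))) => [|i _]; last by rewrite mxE.
  rewrite [X in _ = _ * X](eq_bigr (fun i : 'I_n => (1 + x) `^ (- (nth (0, 0) cs i).1))) => [|i _]; last by rewrite mxE.
  rewrite !powR_sum -powRD_gt0 //.
  congr (_ `^ _); rewrite /wexp addrC !sumrN; congr (- _ - _).
  by rewrite (big_nth (0, 0)) big_mkord.
rewrite [in RHS]mulrAC -!det_mulmx; congr (\det _); apply/matrixP => i j.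
rewrite mul_mx_diag mul_diag_mx !mxE (nth_map (0, 0)) //.
rewrite derive1n_Eop // powRD_gt0 //.
by rewrite /horner_eval; ring.
Qed.

(** The entry (0, 0) only fills the column that the cofactor removes, so the result does not depend
    on the last function; these are the B_i. *)
Definition Bfun cs (i : nat) : {poly R} :=
  (1 + 'X) ^+ i * cofactor (Emx (size cs).+1 (rcons cs (0, 0))) (inord i) ord_max.

Lemma det_Emx_rcons cs q : \det (Emx (size cs).+1 (rcons cs (0, q))) =
  \sum_(i < (size cs).+1) Bfun cs i * q^`(i).
Proof.
rewrite (expand_det_col _ ord_max); apply: eq_bigr => i _.
rewrite mxE nth_rcons ltnn eqxx Eop0 /Bfun mulrAC; congr (_ * _); congr (_ * _).
rewrite inord_val /cofactor; congr (_ * \det _); apply/matrixP => k l.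
have ll : (lift ord_max l < size cs)%N by rewrite lift_max.
by rewrite !mxE !nth_rcons ll.
Qed.

Lemma Bfun_last cs : Bfun cs (size cs) = (1 + 'X) ^+ size cs * \det (Emx (size cs) cs).
Proof.
rewrite /Bfun; congr (_ * _).
have -> : inord (size cs) = ord_max :> 'I_(size cs).+1.
  by apply/val_inj; rewrite /= inordK.
rewrite /cofactor addnn -signr_odd odd_double expr0 mul1r; congr (\det _).
by apply/matrixP => k l; rewrite !mxE !lift_max nth_rcons ltn_ord.
Qed.

(** The LUP decomposition of the transpose makes C A lower triangular even when C is singular. *)
Lemma column_echelon (F : fieldType) n (C : 'M[F]_n) : exists2 A : 'M[F]_n, A \in unitmx &
  forall p l : 'I_n, (p < l)%N -> (C *m A) p l = 0.
Proof.
case: n C => [|n] C; first by exists 1%:M => [|[]//]; exact: unitmx1.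
have := cormen_lup_correct C^T; have := cormen_lup_perm C^T.
have := cormen_lup_detL C^T; have := cormen_lup_upper C^T.
case: (cormen_lup C^T) => -[P L] U /= hU dL hP E.
have uL : L \in unitmx by rewrite unitmxE dL unitr1.
have uP : P \in unitmx by have /is_perm_mxP[s ->] := hP; exact: unitmx_perm.
have E' : C *m P^T = U^T *m L^T.
  by rewrite -[C]trmxK -!trmx_mul; congr (_^T).
exists (P^T *m invmx L^T).
  by rewrite unitmx_mul unitmx_tr uP unitmx_inv unitmx_tr.
move=> p l pl; rewrite mulmxA E' -mulmxA mulmxV ?unitmx_tr // mulmx1 mxE.
exact: hU.
Qed.

(* Column operations on the Taylor coefficients at -1. *)
Lemma dvdp_echelon n (ps : 'I_n -> {poly R}) : exists2 A : 'M[R]_n, A \in unitmx &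
  forall l : 'I_n, (1 + 'X) ^+ l %| \sum_j A j l *: ps j.
Proof.
pose C := \matrix_(p < n, j < n) (ps j \Po ('X - 1))`_p.
have [A uA hA] := column_echelon C; exists A => // l.
have E : (\sum_j A j l *: ps j) \Po ('X - 1) = drop_poly l ((\sum_j A j l *: ps j) \Po ('X - 1)) * 'X^l.
  rewrite -[LHS](poly_take_drop l) (_ : take_poly l _ = 0) ?add0r //.
  apply/polyP => p; rewrite coef_take_poly coef0; case: ifP => // pl.
  have pn : (p < n)%N by rewrite (ltn_trans pl).
  transitivity ((C *m A) (Ordinal pn) l); last exact: hA.
  rewrite raddf_sum coef_sum mxE; apply: eq_bigr => j _.
  by rewrite !mxE /= comp_polyZ coefZ mulrC.
have := congr1 (comp_poly ('X + 1)) E.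
rewrite -comp_polyA comp_polyM comp_Xn_poly comp_polyB comp_polyX rmorph1 addrK comp_polyXr.
by rewrite [1 + 'X]addrC => ->; rewrite dvdp_mull.
Qed.

(** Recombining the columns of each family with constant coefficients makes the l-th one divisible
    by (1+X)^l, a property that [Eop] preserves; the change of columns has a nonzero constant
    determinant. *)
Lemma dvdp_det_Emx b k1 k2 (ps : 'I_k1 -> {poly R}) (qs : 'I_k2 -> {poly R}) :
  (1 + 'X) ^+ ('C(k1, 2) + 'C(k2, 2)) %| \det (row_mx
     (\matrix_(i < k1 + k2, j < k1) Eop 0 (ps j) i)
     (\matrix_(i < k1 + k2, j < k2) Eop b (qs j) i)).
Proof.
set M1 := \matrix_(i, j) _; set M2 := \matrix_(i, j) _.
have [A1 uA1 hA1] := dvdp_echelon ps; have [A2 uA2 hA2] := dvdp_echelon qs.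
pose A : 'M[{poly R}]_(k1 + k2) := block_mx (map_mx polyC A1) 0 0 (map_mx polyC A2).
have dA : \det A = (\det A1 * \det A2)%:P by rewrite det_ublock !det_map_mx polyCM.
have dA0 : \det A1 * \det A2 != 0 by rewrite mulf_neq0 // -unitfE -unitmxE.
have E (n : nat) (c : R) (f : 'I_n -> {poly R}) (B : 'M[R]_n) :
   (\matrix_(i < k1 + k2, j < n) Eop c (f j) i) *m map_mx polyC B =
   \matrix_(i < k1 + k2, l < n) Eop c (\sum_j B j l *: f j) i.
  apply/matrixP => i l; rewrite !mxE Eop_sum; apply: eq_bigr => j _.
  by rewrite !mxE EopZ -mul_polyC mulrC.
have mulE : row_mx M1 M2 *m A = row_mx (\matrix_(i < k1 + k2, l < k1) Eop 0 (\sum_j A1 j l *: ps j) i)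
   (\matrix_(i < k1 + k2, l < k2) Eop b (\sum_j A2 j l *: qs j) i).
  by rewrite mul_row_block !mulmx0 addr0 add0r !E.
pose d : 'rV[{poly R}]_(k1 + k2) := row_mx (\row_(l < k1) (1 + 'X) ^+ l) (\row_(l < k2) (1 + 'X) ^+ l).
have [N hN] : exists N, row_mx M1 M2 *m A = N *m diag_mx d.
  rewrite mulE; set X := row_mx _ _.
  have hX i l : d 0 l %| X i l.
    rewrite /d /X !mxE; case: splitP => l' _; rewrite !mxE; apply: dvdp_Eop; [exact: hA1|exact: hA2].
  move: X d hX {mulE} => X d hX; exists (\matrix_(i, l) (X i l %/ d 0 l)).
  by apply/matrixP => i l; rewrite mul_mx_diag !mxE divpK.
have : (1 + 'X) ^+ ('C(k1, 2) + 'C(k2, 2)) %| \det (row_mx M1 M2) * \det A.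
  rewrite -det_mulmx hN det_mulmx det_diag big_split_ord /=.
  rewrite dvdp_mull // (eq_bigr (fun i : 'I_k1 => (1 + 'X) ^+ i)); last first.
    by move=> i _; rewrite row_mxEl mxE.
  rewrite [X in _ %| _ * X](eq_bigr (fun i : 'I_k2 => (1 + 'X) ^+ i)); last first.
    by move=> i _; rewrite row_mxEr mxE.
  by rewrite !prodrXr -exprD -!bin2_sum !big_mkord dvdpp.
rewrite dA mulrC mul_polyC dvdpZr //.
Qed.

End EulerMatrix.

(** * Existence of the exceptional polynomials *)

Section Existence.
Variable R : realType.
Implicit Types (a b c x : R) (p q : {poly R}) (la mu L M : seq nat).

Lemma poly_extP (f : R -> R) p : (forall x, -1 < x < 1 -> p.[x] = f x) ->
  forall x, -1 < x < 1 -> (poly_ext f).[x] = f x.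
Proof. by move=> h; apply: (@xgetPex _ 0 [set p : {poly R} | forall x, -1 < x < 1 -> p.[x] = f x]); exists p. Qed.

Lemma poly_ext_neq0 (f : R -> R) : poly_ext f != 0 ->
  forall x, -1 < x < 1 -> (poly_ext f).[x] = f x.
Proof.
rewrite /poly_ext; case: xgetP => [p -> hp _|_]; first exact: hp.
by rewrite eqxx.
Qed.

Definition jacobi_terms a b L M : seq (R * {poly R}) :=
  [seq (0, jacobi a b n) | n <- L] ++ [seq (b, jacobi a (- b) m) | m <- M].

Lemma size_jacobi_terms a b L M : size (jacobi_terms a b L M) = (size L + size M)%N.
Proof. by rewrite size_cat !size_map. Qed.

Lemma qfam_jacobi a b x : (forall n, qfam (0, jacobi a b n) x = (jacobi a b n).[x]) /\
  (forall m, qfam (b, jacobi a (- b) m) x = (1 + x) `^ (- b) * (jacobi a (- b) m).[x]).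
Proof. by split=> n; rewrite /qfam /qf /= ?oppr0 !powRr0 ?mul1r ?mulr1. Qed.

Lemma jacobi_familyE a b la mu :
  jacobi_family a b la mu = map (@qfam R) (jacobi_terms a b (assoc_seq la) (assoc_seq mu)).
Proof.
rewrite /jacobi_family map_cat -!map_comp; congr (_ ++ _); apply: eq_map => n;
  by apply/funext => x; have [h1 h2] := qfam_jacobi a b x; rewrite /= ?h1 ?h2.
Qed.

Lemma bin2D k1 k2 : ('C(k1 + k2, 2) = 'C(k1, 2) + 'C(k2, 2) + k1 * k2)%N.
Proof.
elim: k2 => [|k2 IH]; first by rewrite addn0 muln0 !addn0.
by rewrite addnS !binS IH !bin1 mulnS; lia.
Qed.

Lemma wexp_jacobi_terms a b L M :
  wexp (jacobi_terms a b L M) = - (b * (size M)%:R) - ('C(size L + size M, 2))%:R.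
Proof.
rewrite /wexp size_jacobi_terms -bin2_sum big_mkord natr_sum /jacobi_terms big_cat !big_map /=.
by rewrite big1_eq add0r big_const_seq count_predT iter_addr addr0 mulr_natr.
Qed.

(** Since C(r1+r2, 2) = C(r1, 2) + C(r2, 2) + r1 r2, the normalization leaves the exponent -C(r1, 2)
    - C(r2, 2) of 1 + x, which the divisibility of the determinant compensates exactly. *)
Lemma wronskian_terms_poly a b L M : exists q, forall x, -1 < x < 1 ->
  q.[x] = (1 + x) `^ ((b + (size L)%:R) * (size M)%:R) *
    wronskian (map (@qfam R) (jacobi_terms a b L M)) x.
Proof.
set cs := jacobi_terms a b L M; pose k1 := size L; pose k2 := size M.
have hd : (1 + 'X) ^+ ('C(k1, 2) + 'C(k2, 2)) %| \det (Emx (k1 + k2) cs).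
  have := dvdp_det_Emx b (fun i : 'I_k1 => jacobi a b (nth 0%N L i)) (fun i : 'I_k2 => jacobi a (- b) (nth 0%N M i)).
  congr (_ %| \det _); apply/matrixP => i j; rewrite !mxE nth_cat size_map.
  case: splitP => l ->; rewrite !mxE.
    by rewrite (nth_map 0%N).
  by rewrite addKn (nth_map 0%N).
have /dvdpP[q hq] := hd; exists q => x Ix; have [x1 _] := I11_gt0 Ix.
rewrite wronskian_Emx // wexp_jacobi_terms size_jacobi_terms hq hornerM horner_exp.
have -> : (1 + 'X : {poly R}).[x] = 1 + x by rewrite -polyC1 hornerD hornerX hornerC.
rewrite -powR_mulrn ?ltW // mulrA -powRD_gt0 //.
rewrite mulrCA -powRD_gt0 //.
rewrite [X in _ `^ X](_ : _ = 0) ?powRr0 ?mulr1 // (bin2D (size L) (size M)) !natrD natrM.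
by rewrite -/k1 -/k2; ring.
Qed.

(** Moving P_s into the first family makes the Wronskian of P_n an instance of
    [wronskian_terms_poly] with r_1 + 1 functions there. *)
Lemma wronskian_terms_rcons a b L M s : exists2 e : R, e != 0 & forall x,
  wronskian (map (@qfam R) (jacobi_terms a b (rcons L s) M)) x =
  e * wronskian (map (@qfam R) (rcons (jacobi_terms a b L M) (0, jacobi a b s))) x.
Proof.
apply: wronskian_perm; rewrite /jacobi_terms map_rcons -cats1 -[rcons (_ ++ _) _]cats1 -!catA.
by rewrite perm_cat2l perm_catC.
Qed.

Lemma exceptional_jacobiE a b la mu n x : -1 < x < 1 ->
  (exceptional_jacobi a b la mu n).[x] =
  (1 + x) `^ ((b + (size la)%:R + 1) * (size mu)%:R) *
  wronskian (map (@qfam R) (rcons (jacobi_terms a b (assoc_seq la) (assoc_seq mu))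
    (0, jacobi a b (shifted_degree la mu n)))) x.
Proof.
move=> Ix; set s := shifted_degree _ _ _.
have E : rcons (jacobi_family a b la mu) (horner (jacobi a b s)) =
   map (@qfam R) (rcons (jacobi_terms a b (assoc_seq la) (assoc_seq mu)) (0, jacobi a b s)).
  rewrite map_rcons jacobi_familyE; congr (rcons _ _).
  by apply/funext => y; have [-> _] := qfam_jacobi a b y.
rewrite -E; have [q hq] := wronskian_terms_poly a b (rcons (assoc_seq la) s) (assoc_seq mu).
have [e e0 he] := wronskian_terms_rcons a b (assoc_seq la) (assoc_seq mu) s.
apply: (@poly_extP _ (e^-1 *: q)) Ix => y Iy.
rewrite hornerZ hq // he E mulrCA mulKf //.
by rewrite size_rcons !size_map !size_iota -[(size la).+1%:R]natr1 addrA.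
Qed.

End Existence.

(** * The limit at 1 *)

Section Limits.
Variable R : realType.
Implicit Types (a b c x : R) (p q : {poly R}) (la mu L M : seq nat).

Lemma eq_at1 (f : R -> R) : {for 1, continuous f} -> (forall x, I11 x -> f x = 0) -> f 1 = 0.
Proof.
move=> cf f0; apply/eqP/negP => /negP f1; have [d d0 hd] := cont_neq0 cf f1.
pose y : R := 1 - Num.min 1 (d / 2).
have m0 : 0 < Num.min 1 (d / 2) by rewrite lt_min ltr01 divr_gt0.
have m1 : Num.min 1 (d / 2) <= 1 by rewrite ge_min lexx.
have m2 : Num.min 1 (d / 2) <= d / 2 by rewrite ge_min lexx orbT.
have : f y != 0 by apply: hd; rewrite /y addrAC subrr sub0r normrN gtr0_norm //; lra.
by rewrite f0 ?eqxx // /I11 /y /=; apply/andP; split; lra.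
Qed.

(** A power of 1 + x is continuous at 1, so the identity on (-1, 1) extends to the endpoint; a power
    of 1 - x would not allow this. *)
Lemma wsim_at1 (p q : {poly R}) : (exists C e, forall x, I11 x ->
    p.[x] = C * qf e 0 1 x * q.[x]) -> p.[1] != 0 -> q.[1] != 0.
Proof.
move=> [C [e h]]; apply: contra_neq => q1.
have := @eq_at1 (fun x => p.[x] - C * (1 + x) `^ e * q.[x]).
rewrite q1 mulr0 subr0; apply.
  have d1 : is_derive (1 : R) 1 (fun y : R => (1 + y) `^ e) (e * (1 + 1) `^ (e - 1) * 1).
    apply: (@is_derive1_comp _ (fun z => z `^ e) (fun y => 1 + y)).
      by apply: is_derive1_powR; lra.
    by apply: (der_eq (derD (derC _ 1) (derId 1))); rewrite add0r.
  have := derD (is_derive_poly p 1) (derN (derM (derM (derC C 1) d1) (is_derive_poly q 1))).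
  exact: der_cont.
move=> x Ix; rewrite h // /qf powRr0 -polyC1 hornerC !mulr1; lra.
Qed.

Lemma wronskian_limit (cs : seq (R * {poly R})) a b k (p : nat -> {poly R}) :
  (\det (Emx (size cs) cs)).[1] != 0 -> (0 < k)%N ->
  (\forall s \near \oo, wsim (horner (p s))
     (wronskian (map (@qfam R) (rcons cs (0, jacobi a b s))))) ->
  (fun s : nat => s%:R * acos (zero_near_1 (p s) k)) @ \oo --> bessel_zero (a + (size cs)%:R) k.
Proof.
move=> D1 k0 hp; apply: (@core_limit _ a b (size cs) (Bfun cs)) => //.
  rewrite Bfun_last hornerM mulf_neq0 // horner_exp -polyC1 hornerD hornerX hornerC.
  by rewrite expf_neq0 //; lra.
apply: filterS hp => s [C [e [e' [C0 h]]]].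
pose E := wexp (rcons cs (0, jacobi a b s)).
exists (fun x => C * qf (e + E) e' 1 x) => x Ix; split.
- by have [] := derM (derC C x) (is_derive_qf (e + E) e' 1 Ix).
- by rewrite mulf_neq0 // qf_neq0.
- rewrite h // wronskian_Emx // size_rcons det_Emx_rcons -/(jacobi_comb _ _ _ _ _).
  have [x1 _] := I11_gt0 Ix.
  rewrite /qf -polyC1 hornerC -/E (powRD_gt0 _ _ x1).
  ring.
Qed.

(** With n = s + off the ratio n / s tends to 1, and a limit along all n is a limit within N. *)
Lemma cvg_shift_degree (N : set nat) (off : nat) (z : nat -> R) (l : R) :
  (fun s : nat => s%:R * z (s + off)%N) @ \oo --> l ->
  (fun n : nat => n%:R * z n) @ within N \oo --> l.
Proof.
move=> h; apply: (@cvg_trans _ ((fun n : nat => n%:R * z n) @ \oo)).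
  by apply: cvg_app; exact: cvg_within.
rewrite -(cvg_shiftn off).
have : (fun s : nat => (s%:R + off%:R) / (s%:R + 0) * (s%:R * z (s + off)%N)) @ \oo --> 1 * l.
  by apply: cvgM => //; exact: cvg_ratio.
rewrite mul1r; apply: cvg_trans; apply: near_eq_cvg; near=> s.
have s0 : s%:R != 0 :> R by rewrite pnatr_eq0 -lt0n; near: s; exact: nbhs_infty_gt.
by rewrite /= natrD addr0; field.
Unshelve. all: by end_near.
Qed.

Definition degree_off la mu := (sumn la + sumn mu - size la)%N.

Lemma size_le_sumn la : is_partition la -> (size la <= sumn la)%N.
Proof.
move=> /andP[_]; elim: la => //= n la IH; rewrite inE negb_or => /andP[n0 /IH].
by case: n n0 => // n _ h; rewrite addSn ltnS (leq_trans h) // leq_addl.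
Qed.

Lemma shifted_degree_off la mu s : is_partition la ->
  shifted_degree la mu (s + degree_off la mu) = s.
Proof. by move=> /size_le_sumn; rewrite /shifted_degree /degree_off; lia. Qed.

Lemma degree_seq_off la mu n : is_partition la -> degree_seq la mu n ->
  n = (shifted_degree la mu n + degree_off la mu)%N.
Proof. by move=> /size_le_sumn h [h1 _]; rewrite /shifted_degree /degree_off; lia. Qed.

Lemma degree_seq_large la mu : is_partition la ->
  exists n0, forall n, (n0 <= n)%N -> degree_seq la mu n.
Proof.
move=> /size_le_sumn h; exists (sumn la + sumn mu + sumn la)%N => n hn.
split; first by lia.
move=> j _; have hj : (nth 0%N la j <= sumn la)%N.
  elim: la j {h hn} => [|m s IH] [|j] //=; first exact: leq_addr.
  by rewrite (leq_trans (IH j)) // leq_addl.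
by apply/eqP; lia.
Qed.

Lemma exceptional_jacobi_wsim a b la mu s : is_partition la ->
  wsim (horner (exceptional_jacobi a b la mu (s + degree_off la mu)))
    (wronskian (map (@qfam R) (rcons (jacobi_terms a b (assoc_seq la) (assoc_seq mu)) (0, jacobi a b s)))).
Proof.
move=> hla; exists 1, ((b + (size la)%:R + 1) * (size mu)%:R), 0; split; first exact: oner_neq0.
move=> x Ix; rewrite exceptional_jacobiE // shifted_degree_off //.
by rewrite /qf powRr0 -polyC1 hornerC !mulr1 mul1r.
Qed.

Lemma limit_near_1 a b la mu k : is_partition la -> (0 < k)%N ->
  (Omega a b la mu).[1] != 0 ->
  (fun n : nat => n%:R * acos (zero_near_1 (exceptional_jacobi a b la mu n) k))
    @ within (degree_seq la mu) \oo --> bessel_zero (a + (size la)%:R + (size mu)%:R) k.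
Proof.
move=> hla k0 O1; apply: (@cvg_shift_degree _ (degree_off la mu)).
set cs := jacobi_terms a b (assoc_seq la) (assoc_seq mu).
have -> : a + (size la)%:R + (size mu)%:R = a + (size cs)%:R.
  by rewrite size_jacobi_terms !size_map !size_iota natrD addrA.
apply: (@wronskian_limit cs a b k (fun s => exceptional_jacobi a b la mu (s + degree_off la mu))) => //.
  apply: (@wsim_at1 (Omega a b la mu)); last exact: O1.
  exists 1, ((b + (size la)%:R) * (size mu)%:R + wexp cs) => x Ix.
  rewrite /Omega poly_ext_neq0 //; last by apply: contra_neq O1; rewrite /Omega => ->; rewrite horner0.
  have [x1 _] := I11_gt0 Ix.
  rewrite jacobi_familyE wronskian_Emx // mulrA -powRD_gt0 //.
  by rewrite /qf powRr0 -polyC1 hornerC !mulr1 mul1r.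
by apply: nearW => s; exact: exceptional_jacobi_wsim.
Qed.

End Limits.

(** * The limit at -1 *)

Section Conjugate.

(** Both sides say that the cell (j, i) lies in the Young diagram of s, read by rows and by
    columns. *)
Lemma nth_gt_count (s : seq nat) i j : sorted geq s -> (j < size s)%N ->
  (i < nth 0 s j)%N = (j < count (fun l => i < l) s)%N.
Proof.
elim: s j => //= x s IH j ss js.
have sx : all (fun y => y <= x)%N s.
  have tr : transitive geq by move=> u v w /= h1 h2; exact: (leq_trans h2 h1).
  by have := order_path_min tr ss; apply: sub_all.
have c0 : (x <= i)%N -> count (fun l => i < l)%N s = 0%N.
  move=> xi; apply/eqP; rewrite -leqn0 leqNgt -has_count; apply/hasPn => y /(allP sx) yx.
  by rewrite -leqNgt (leq_trans yx).
case: j js => [|j] js /=; first by case: ltnP => [|/c0 ->].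
case: (ltnP i x) => xi; first by rewrite IH // (path_sorted ss).
rewrite c0 //; apply/negbTE; rewrite -leqNgt (leq_trans _ xi) //.
by apply: (allP sx); rewrite mem_nth.
Qed.

Lemma size_assoc_seq s : size (assoc_seq s) = size s.
Proof. by rewrite size_map size_iota. Qed.

Lemma nth_assoc_seq s i : (i < size s)%N ->
  nth 0%N (assoc_seq s) i = (nth 0 s i + (size s - i.+1))%N.
Proof. by move=> si; rewrite (nth_map 0%N) ?size_iota // nth_iota. Qed.

Lemma assoc_seqP s m : reflect (exists2 i, (i < size s)%N & m = (nth 0 s i + (size s - i.+1))%N)
  (m \in assoc_seq s).
Proof.
apply: (iffP (nthP 0%N)) => [[i]|[i si ->]].
  by rewrite size_assoc_seq => si <-; exists i => //; rewrite nth_assoc_seq.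
by exists i; rewrite ?size_assoc_seq // nth_assoc_seq.
Qed.

Lemma partition_nth_le mu i j : sorted geq mu -> (i <= j < size mu)%N -> (nth 0 mu j <= nth 0 mu i)%N.
Proof.
move=> ss /andP[ij js]; rewrite leqNgt; apply/negP => h.
have := nth_gt_count (nth 0%N mu i) ss js; rewrite h => /esym h2.
have := nth_gt_count (nth 0%N mu i) ss (leq_ltn_trans ij js).
by rewrite ltnn => /esym/negbT; rewrite -leqNgt => h3; have := leq_trans h2 h3; rewrite ltnNge ij.
Qed.

Lemma uniq_assoc_seq mu : sorted geq mu -> uniq (assoc_seq mu).
Proof.
move=> ss; apply/(uniqP 0%N) => i j; rewrite !inE size_assoc_seq => si sj.
rewrite !nth_assoc_seq //.
case: (ltngtP i j) => // ij.
  by have := @partition_nth_le mu i j ss; lia.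
by have := @partition_nth_le mu j i ss; lia.
Qed.

Lemma assoc_seq_ltn mu m : sorted geq mu -> m \in assoc_seq mu -> (m < head 0 mu + size mu)%N.
Proof.
move=> ss /assoc_seqP[i si ->]; have := @partition_nth_le mu 0 i ss.
by rewrite si -nth0 => /(_ isT); lia.
Qed.

(** With T = mu_1 + r_2, the numbers t_i = i + r_2 - mu'_(i+1), i < mu_1, avoid [assoc_seq mu] and
    are distinct, so by counting both lists together exhaust {0, ..., T - 1}. Moreover T - 1 - t_i
    is the term of index i in the associated sequence of mu'. *)
Lemma perm_conj_dual mu : is_partition mu ->
  perm_eq (assoc_seq (conj_part mu)) (dual_set (head 0%N mu + size mu) (assoc_seq mu)).
Proof.
move=> /andP[ss _]; set T := (_ + _)%N; pose c := head 0%N mu; pose r := size mu.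
pose nu i := count (fun l => i < l)%N mu.
have nur i : (nu i <= r)%N by exact: count_size.
have nule i j : (i <= j)%N -> (nu j <= nu i)%N.
  by move=> ij; apply: sub_count => l /=; exact: leq_ltn_trans.
have szc : size (conj_part mu) = c by rewrite size_map size_iota.
have nthc i : (i < c)%N -> nth 0%N (conj_part mu) i = nu i.
  by move=> ic; rewrite (nth_map 0%N) ?size_iota // nth_iota.
pose t i := (i + (r - nu i))%N.
have tM i : t i \notin assoc_seq mu.
  apply/negP => /assoc_seqP[j jr]; rewrite /t -/r => E.
  have := nth_gt_count i ss jr; rewrite -/(nu i); have := nur i; move: jr; rewrite -/r.
  by case: (ltnP i (nth 0%N mu j)); lia.
have tT i : (i < c)%N -> (t i < T)%N by rewrite /t /T -/c -/r; lia.
have tinc i j : (i < j)%N -> (t i < t j)%N.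
  by move=> ij; have := nule i j (ltnW ij); rewrite /t; lia.
have uM := uniq_assoc_seq ss.
have ut : uniq (map t (iota 0 c)).
  rewrite map_inj_in_uniq ?iota_uniq // => i j _ _ tij.
  by case: (ltngtP i j) => // /tinc; rewrite tij ltnn.
have us : uniq (assoc_seq mu ++ map t (iota 0 c)).
  rewrite cat_uniq uM ut andbT; apply/hasPn => x /mapP[i _ ->]; exact: tM.
have sub : {subset assoc_seq mu ++ map t (iota 0 c) <= iota 0 T}.
  move=> x; rewrite mem_cat mem_iota => /orP[xm|/mapP[i]]; first exact: assoc_seq_ltn.
  by rewrite mem_iota => /andP[_ ic] ->; exact: tT.
have [|_ E] := uniq_min_size us sub.
  by rewrite size_cat !size_map !size_iota addnC.
apply: uniq_perm.
- apply: uniq_assoc_seq; rewrite /conj_part; apply: (homo_sorted (e := leq)); last exact: iota_sorted.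
  exact: nule.
- rewrite map_inj_in_uniq; first by rewrite filter_uniq // iota_uniq.
  by move=> x y; rewrite !mem_filter !mem_iota => /andP[_ hx] /andP[_ hy]; lia.
move=> x; apply/assoc_seqP/mapP => [[i]|[y]].
  rewrite szc => ic ->; exists (t i).
    by rewrite mem_filter tM mem_iota /= tT.
  by rewrite nthc // /T -/c -/r /t; have := nur i; lia.
rewrite mem_filter -E mem_cat => /andP[/negPf -> /= /mapP[i]]; rewrite mem_iota => /andP[_ ic] -> ->.
exists i; rewrite szc // nthc // /T -/c -/r /t; have := nur i; lia.
Qed.

End Conjugate.

(** * The reflection x -> -x *)

Section Flip.
Variable R : realType.
Implicit Types (a b c x : R) (p q : {poly R}) (la mu L M K : seq nat).

Lemma horner_comp_oppX p x : (p \Po (- 'X)).[x] = p.[- x].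
Proof. by rewrite horner_comp hornerN hornerX. Qed.

Lemma comp_oppXK p : (p \Po (- 'X)) \Po (- 'X) = p.
Proof. by rewrite -comp_polyA raddfN /= comp_polyX opprK comp_polyXr. Qed.

Lemma mup_comp_oppX p x : p != 0 -> mup x (p \Po (- 'X)) = mup (- x) p.
Proof.
move=> p0; have c0 : p \Po (- 'X) != 0.
  by apply: contra_neq p0 => c0; rewrite -[p]comp_oppXK c0 comp_poly0.
have E (y : R) : ('X - y%:P) \Po (- 'X) = - ('X - (- y)%:P).
  by rewrite comp_polyB comp_polyX comp_polyC polyCN opprD opprK.
have D (q : {poly R}) (y : R) n : ('X - y%:P) ^+ n %| q -> ('X - (- y)%:P) ^+ n %| q \Po (- 'X).
  move=> /(dvdp_comp_poly (- 'X)); rewrite rmorphXn /= E -mulN1r exprMn.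
  by rewrite -polyC1 -polyCN -rmorphXn /= mul_polyC dvdpZl // expf_neq0 // oppr_eq0 oner_neq0.
apply/eqP; rewrite eqn_leq !mup_geq //; apply/andP; split.
  by rewrite -[p in _ %| p]comp_oppXK; apply: D; rewrite -mup_geq.
by rewrite -[x in 'X - x%:P]opprK; apply: D; rewrite -mup_geq.
Qed.

Lemma zeros_comp_oppX p : zeros (p \Po (- 'X)) = rev (map -%R (zeros p)).
Proof.
apply: lt_sorted_eq; first exact: polyrcf.sorted_roots.
  rewrite rev_sorted sorted_map; apply: (sub_sorted (e := <%R)); last exact: polyrcf.sorted_roots.
  by move=> x y xy; rewrite /relpre /= ltrN2.
move=> x; rewrite mem_rev -{2}[x]opprK (mem_map (@oppr_inj _)) !polyrcf.in_roots /root horner_comp_oppX.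
rewrite !in_itv /=; congr [&& _, _ & _]; first by apply/andP/andP => -[]; split; lra.
congr (~~ _); apply/eqP/eqP => [c0|->]; last exact: comp_poly0.
by rewrite -[p]comp_oppXK c0 comp_poly0.
Qed.

Lemma zero_near_m1E p k : zero_near_m1 p k = - zero_near_1 (p \Po (- 'X)) k.
Proof.
rewrite /zero_near_m1 /zero_near_1 /zeros_mult zeros_comp_oppX.
have -> : [seq nseq (mup x (p \Po - 'X)) x | x <- rev [seq - i | i <- zeros p]] =
   rev [seq map -%R (nseq (mup x p) x) | x <- zeros p].
  rewrite map_rev -map_comp; congr rev; apply/eq_in_map => x /=.
  rewrite polyrcf.in_roots => /and3P[_ _ p0]; rewrite map_nseq.
  by have := mup_comp_oppX (- x) p0; rewrite opprK => ->.
set s := flatten [seq nseq _ _ | x <- _].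
have -> : rev (flatten (rev [seq map -%R (nseq (mup x p) x) | x <- zeros p])) = map -%R s.
  rewrite rev_flatten map_rev revK -map_comp map_flatten -[in RHS]map_comp; congr flatten.
  by apply: eq_map => x /=; rewrite map_nseq rev_nseq.
(* Beyond the number of zeros both sides are the default 0. *)
case: (ltnP k.-1 (size s)) => ks; first by rewrite (nth_map 0) ?opprK.
by rewrite !nth_default ?size_map // oppr0.
Qed.

(** Reflection exchanges the parameters and turns (1-x)^(-a) into (1+x)^(-a): tag 2 for (a, b)
    becomes the second family for (b, a), so the result has the form treated at 1. *)
Lemma wronskian_fam_flip a b L K : exists2 C : R, C != 0 & forall x, I11 x ->
  wronskian (map (jacobi_fam a b) (tagged3 L [::] K)) (- x) =
  C * wronskian (map (@qfam R) (jacobi_terms b a L K)) x.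
Proof.
have sI (x : R) : I11 x -> I11 (- x) by rewrite /I11 /= => /andP[h1 h2]; apply/andP; split; lra.
have [e e0 he] := wronskian_flip (s := tagged3 L [::] K) (@open_I11 R) sI (fun i _ => @smooth_jacobi_fam R a b i).
pose G (i : nat * nat) := qfam (if i.1 is 0%N then (0, jacobi b a i.2) else (a, jacobi b (- a) i.2)).
pose kk (i : nat * nat) : R := (-1) ^+ i.2.
have k0 : \prod_(i <- tagged3 L [::] K) kk i != 0.
  by apply: (big_ind (fun z : R => z != 0)) => [|u v|i _]; [exact: oner_neq0|exact: mulf_neq0|by rewrite signr_eq0].
exists (e^-1 * \prod_(i <- tagged3 L [::] K) kk i); first by rewrite mulf_neq0 // invr_eq0.
move=> x Ix; apply: (mulfI e0); rewrite -he // mulrA mulVKf //.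
rewrite (_ : map _ (jacobi_terms b a L K) = map G (tagged3 L [::] K)); last first.
  by rewrite /jacobi_terms /tagged3 !map_cat -!map_comp.
rewrite -(wronskianZ kk (@open_I11 R) Ix); last by move=> i _; exact: smooth_qf.
apply: (wronskian_eq_on (@open_I11 R)) => // i y /mem_tagged3 hi Iy.
case: hi => -[n _ ->] //; rewrite /jacobi_fam /G /kk /qfam /qf /= -[in LHS]horner_comp_oppX jacobi_flip hornerZ opprK ?oppr0.
  by rewrite !powRr0; ring.
by rewrite !powRr0; ring.
Qed.

End Flip.

Section Limits.
Variable R : realType.
Implicit Types (a b c x : R) (p q : {poly R}) (la mu L M K : seq nat).

Lemma wsim_comp_opp (f g : R -> R) : wsim f g -> wsim (fun x => f (- x)) (fun x => g (- x)).
Proof.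
move=> [C [e [e' [C0 h]]]]; exists C, e', e; split=> // x Ix.
have Ix' : I11 (- x) by move: Ix; rewrite /I11 /= => /andP[h1 h2]; apply/andP; split; lra.
by rewrite h // /qf -polyC1 !hornerC opprK; ring.
Qed.

Lemma jacobi_terms_fam a b L M :
  map (@qfam R) (jacobi_terms a b L M) = map (jacobi_fam a b) (tagged3 L M [::]).
Proof.
rewrite /jacobi_terms /tagged3 cats0 !map_cat -!map_comp; congr (_ ++ _).
by apply: eq_map => n; apply/funext => x; rewrite /= /qfam /jacobi_fam /= oppr0.
Qed.

Lemma wsim_terms_rcons a b L M s :
  wsim (wronskian (map (@qfam R) (rcons (jacobi_terms a b L M) (0, jacobi a b s))))
    (wronskian (map (@qfam R) (jacobi_terms a b (rcons L s) M))).
Proof.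
apply: wsim_sym; have [e e0 h] := wronskian_terms_rcons a b L M s.
by apply: (wsim_scale e0) => x _.
Qed.

Lemma near_natD_neq0 (c : R) : \forall s \near \oo, s%:R + c != 0.
Proof. by apply: filterS (near_addr_gt0 c) => s; move/gt_eqF => ->. Qed.

(** P_s goes through the duality as a member of the first family. Its constants are nonzero for
    large s; those of the other functions are nonzero by the hypotheses, translated through m' = T -
    1 - t. *)
Lemma exceptional_jacobi_dual a b la mu : is_partition la -> is_partition mu ->
  let a' := a + (head 0%N mu)%:R + (size mu)%:R in
  let b' := b - (head 0%N mu)%:R - (size mu)%:R in
  (forall m, m \in assoc_seq mu -> avoids (a - b + m%:R) m) ->
  (forall n m, n \in assoc_seq la -> m \in assoc_seq mu -> b != m%:R - n%:R) ->
  (forall m, m \in assoc_seq (conj_part mu) -> avoids (- a' + b' + m%:R) m) ->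
  (forall i m, i \in assoc_seq la -> m \in assoc_seq (conj_part mu) -> a' != m%:R - i%:R) ->
  \forall s \near \oo, wsim
    (horner (exceptional_jacobi a b la mu (s + degree_off la mu) \Po (- 'X)))
    (wronskian (map (@qfam R) (rcons (jacobi_terms b' a' (assoc_seq la) (assoc_seq (conj_part mu)))
       (0, jacobi b' a' s)))).
Proof.
move=> hla hmu a' b' h2 h3 hM hL; have /andP[smu _] := hmu.
pose T := (head 0%N mu + size mu)%N.
have aE : a' = a + T%:R by rewrite /a' /T natrD addrA.
have bE : b' = b - T%:R by rewrite /b' /T natrD opprD addrA.
have dualP t : (t < T)%N -> t \notin assoc_seq mu ->
    (T.-1 - t)%N \in assoc_seq (conj_part mu) /\ (T.-1 - t)%N%:R = T%:R - 1 - t%:R :> R.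
  move=> tT tM; split; last first.
    by rewrite natrB; [rewrite -subn1 natrB //; lia | lia].
  by rewrite (perm_mem (perm_conj_dual hmu)); apply: map_f; rewrite mem_filter tM mem_iota.
near=> s.
have sb t : (t < T)%N -> s%:R + b - t%:R != 0.
  have : 0 < s%:R + (b - T%:R) by near: s; exact: near_addr_gt0.
  rewrite -(ltr_nat R); move: (T%:R : R) (t%:R : R) (s%:R : R) => x y z hx hy; apply/eqP; lra.
have sa t : s%:R + a + t%:R + 1 != 0.
  have : 0 < s%:R + a by near: s; exact: near_addr_gt0.
  have : 0 <= t%:R :> R by [].
  move: (t%:R : R) (s%:R : R) => y z hx hy; apply/eqP; lra.
apply: (@wsim_trans _ _ (fun x => wronskian (map (@qfam R) (rcons (jacobi_terms a b (assoc_seq la) (assoc_seq mu)) (0, jacobi a b s))) (- x))).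
  apply: (@wsim_trans _ _ (fun x => (exceptional_jacobi a b la mu (s + degree_off la mu)).[- x])).
    by apply: wsim_eq_on => x _; rewrite horner_comp_oppX.
  apply: wsim_comp_opp; exact: exceptional_jacobi_wsim.
apply: (wsim_trans (wsim_comp_opp (wsim_terms_rcons a b _ _ s))).
rewrite jacobi_terms_fam.
apply: (@wsim_trans _ _ (fun x => wronskian (map (jacobi_fam a' b') (tagged3 (rcons (assoc_seq la) s) [::] (assoc_seq (conj_part mu)))) (- x))).
  apply: wsim_comp_opp.
  apply: (@wsim_trans _ _ (wronskian (map (jacobi_fam a' b')
      (tagged3 (rcons (assoc_seq la) s) [::] (dual_set T (assoc_seq mu) ++ map (addn T) [::]))))).
    rewrite aE bE; apply: jacobi_duality => //.
    - exact: uniq_assoc_seq.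
    - by move=> m; exact: assoc_seq_ltn.
    - move=> n t; rewrite mem_rcons inE => /orP[/eqP-> tM|nL tM]; first by apply/sb/assoc_seq_ltn.
      by have := h3 n t nL tM; apply: contra_neq; lra.
    - move=> n t; rewrite mem_rcons inE => /orP[/eqP-> _ _ |nL tT tM]; first exact: sa.
      have [mem E] := dualP t tT tM; have := hL n _ nL mem; rewrite aE E.
      by apply: contra_neq; lra.
    - move=> m t mM tM tm; have := h2 m mM t.+1; rewrite ltnS tm => /(_ isT).
      by apply: contra_neq; rewrite -[t.+1%:R]natr1; lra.
    move=> t t' tt' t'T tM t'M; have [mem E] := dualP t (ltn_trans tt' t'T) tM.
    (* For m' = T - 1 - t and i = T - t', the condition -a' + b' + m' <> -i reads b - a - t - t' - 1
       <> 0. *)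
    have D : (0 < T - t' <= T.-1 - t)%N by lia.
    have := hM _ mem _ D; rewrite E aE bE (natrB _ (ltnW t'T)).
    by apply: contra_neq; lra.
  apply: wsim_perm; rewrite /tagged3 cats0 /= perm_cat2l; apply: perm_map.
  by rewrite perm_sym; exact: perm_conj_dual.
apply: (wsim_trans _ (wsim_sym (wsim_terms_rcons b' a' _ _ s))).
have [C C0 h] := wronskian_fam_flip a' b' (rcons (assoc_seq la) s) (assoc_seq (conj_part mu)).
exact: (wsim_scale C0).
Unshelve. all: by end_near.
Qed.

Lemma Omega_bar_dual a b la K (cs := jacobi_terms b a (assoc_seq la) (assoc_seq K)) :
  (Omega_bar a b la K).[-1] != 0 -> (\det (Emx (size cs) cs)).[1] != 0.
Proof.
move=> O1; apply: (@wsim_at1 _ (Omega_bar a b la K \Po (- 'X))); last by rewrite horner_comp_oppX.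
have [C C0 h] := wronskian_fam_flip a b (assoc_seq la) (assoc_seq K).
exists C, ((a + (size la)%:R) * (size K)%:R + wexp cs) => x Ix; rewrite horner_comp_oppX.
have Ix' : I11 (- x) by move: Ix; rewrite /I11 /= => /andP[h1 h2]; apply/andP; split; lra.
rewrite /Omega_bar poly_ext_neq0 //; last by apply: contra_neq O1; rewrite /Omega_bar => ->; rewrite horner0.
have -> : [seq horner (jacobi a b n) | n <- assoc_seq la] ++
    [seq (fun y => (1 - y) `^ (- a) * (jacobi (- a) b k).[y]) | k <- assoc_seq K] =
    map (jacobi_fam a b) (tagged3 (assoc_seq la) [::] (assoc_seq K)).
  rewrite /tagged3 /= map_cat -!map_comp; congr (_ ++ _); apply: eq_map => n;
    by apply/funext => y; rewrite /jacobi_fam /qf /= !powRr0 !mul1r.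
rewrite h // opprK -/cs wronskian_Emx //; have [x1 _] := I11_gt0 Ix.
rewrite /qf powRr0 -polyC1 hornerC !mulr1.
rewrite (powRD_gt0 ((a + (size la)%:R) * (size K)%:R) _ x1).
ring.
Qed.

Lemma limit_near_m1 a b la mu k : is_partition la -> is_partition mu -> (0 < k)%N ->
  let a' := a + (head 0%N mu)%:R + (size mu)%:R in
  let b' := b - (head 0%N mu)%:R - (size mu)%:R in
  (forall m, m \in assoc_seq mu -> avoids (a - b + m%:R) m) ->
  (forall n m, n \in assoc_seq la -> m \in assoc_seq mu -> b != m%:R - n%:R) ->
  (forall m, m \in assoc_seq (conj_part mu) -> avoids (- a' + b' + m%:R) m) ->
  (forall i m, i \in assoc_seq la -> m \in assoc_seq (conj_part mu) -> a' != m%:R - i%:R) ->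
  (Omega_bar a' b' la (conj_part mu)).[-1] != 0 ->
  (fun n : nat => n%:R * acos (- zero_near_m1 (exceptional_jacobi a b la mu n) k))
    @ within (degree_seq la mu) \oo --> bessel_zero (b + (size la)%:R - (size mu)%:R) k.
Proof.
move=> hla hmu k0 a' b' h2 h3 hM hL O1; apply: (@cvg_shift_degree _ _ (degree_off la mu)).
set cs := jacobi_terms b' a' (assoc_seq la) (assoc_seq (conj_part mu)).
(* The length of mu' is mu_1, so b' + r_1 + mu_1 = b + r_1 - r_2. *)
have -> : b + (size la)%:R - (size mu)%:R = b' + (size cs)%:R.
  by rewrite size_jacobi_terms !size_assoc_seq size_map size_iota natrD /b'; ring.
rewrite (_ : (fun s => _) = fun s => s%:R * acos (zero_near_1
   (exceptional_jacobi a b la mu (s + degree_off la mu) \Po (- 'X)) k)); last first.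
  by apply/funext => s; rewrite zero_near_m1E opprK.
apply: (@wronskian_limit _ cs b' a' k (fun s => exceptional_jacobi a b la mu (s + degree_off la mu) \Po (- 'X))) => //.
  exact: Omega_bar_dual.
exact: exceptional_jacobi_dual.
Qed.

End Limits.

(** * The number of zeros *)

Section Rolle.
Variable R : realType.
Implicit Types (a b c x d : R) (p q : {poly R}) (f : R * {poly R}).

(** Zeros are counted close to 1: there the successive divisors of Rolle's argument do not vanish,
    while P_s has as many zeros as wanted. *)
Definition near1 d : set R := [set x | 1 - d < x < 1].

Lemma open_near1 d : open (near1 d).
Proof.
rewrite (_ : near1 d = [set` `](1 - d), 1[]); first exact: interval_open.
by apply/seteqP; split=> x; rewrite /near1 /= in_itv.
Qed.

Lemma near1_sub d d' x : d <= d' -> near1 d x -> near1 d' x.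
Proof. by rewrite /near1 /= => dd /andP[h1 h2]; apply/andP; split; lra. Qed.

Lemma near1_I11 d x : d <= 1 -> near1 d x -> I11 x.
Proof. by rewrite /near1 /I11 /= => dd /andP[h1 h2]; apply/andP; split; lra. Qed.

Lemma poly_neq0_near1 p : p != 0 -> exists2 d, 0 < d <= 1 & forall x, near1 d x -> p.[x] != 0.
Proof.
move=> p0; have [m [q q1 pE]] : exists m, exists2 q, ~~ root q 1 & p = q * ('X - 1%:P) ^+ m.
  by have [m [q + pE]] := multiplicity_XsubC p 1; rewrite p0 => q1; exists m, q.
have cq : {for 1, continuous (horner q)} by exact: der_cont (is_derive_poly q 1).
have [d d0 hd] := cont_neq0 cq q1.
exists (Num.min d 1) => [|x /=]; first by rewrite lt_min d0 ltr01 /= ge_min lexx orbT.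
rewrite /near1 /= => /andP[h1 h2].
have hm : Num.min d 1 <= d by rewrite ge_min lexx.
rewrite pE hornerM horner_exp hornerXsubC mulf_neq0 ?expf_neq0 ?subr_eq0 ?(lt_eqF h2) //.
by apply: hd; rewrite ltr0_norm; lra.
Qed.

Lemma smooth_on_sub (U V : set R) (g : R -> R) : (forall x, U x -> V x) ->
  smooth_on V g -> smooth_on U g.
Proof. by move=> UV sg i x /UV; exact: sg. Qed.

Lemma smooth_polyV (U : set R) p : open U -> (forall x, U x -> p.[x] != 0) ->
  smooth_on U (fun x => p.[x]^-1).
Proof.
move=> oU pU; pose Q := fix Q n : {poly R} := if n is m.+1 then (Q m)^`() * p - m.+1%:R *: (Q m * p^`()) else 1.
have [|_] := @derive1n_tower R U (fun n x => (Q n).[x] * p.[x]^-1 ^+ n.+1) oU.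
  move=> n x Ux; have := derM (is_derive_poly (Q n) x) (derX n.+1 (derV (is_derive_poly p x) (pU x Ux))).
  move/der_eq; apply; rewrite [Q n.+1]/= hornerD hornerN hornerZ !hornerM.
  have := pU x Ux; move: (p.[x]) (_^`().[x]) (_^`().[x]) ((Q n).[x]) => P P1 Q1 Q0 P0.
  rewrite [n.+1.-1]/= !exprS; have : P^-1 * P = 1 by rewrite mulVf.
  rewrite expr0 mulr1 invfM; move: (P^-1) (n.+1%:R : R) => W N WP; move: (W ^+ n) => V.
  apply/eqP; rewrite -subr_eq0; apply/eqP.
  transitivity (Q1 * W * V * (1 - W * P)); last by rewrite WP subrr mulr0.
  ring.
congr smooth_on; apply/funext => x.
by rewrite [Q 0%N]/= -polyC1 hornerC expr1 mul1r.
Qed.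

Lemma rolle_seq (g dg : R -> R) (u : R) (s : seq R) :
  (forall x, u <= x <= last u s -> is_derive x 1 g (dg x)) -> path <%R u s -> g u = 0 ->
  all (fun x => g x == 0) s -> exists s', [/\ size s' = size s, path <%R u s',
    all (fun x => dg x == 0) s' & all (fun x => x < last u s) s'].
Proof.
elim: s u => [|y s IH] u /= hd; first by exists [::].
move=> /andP[uy ys] gu /andP[/eqP gy gs].
have yl : y <= last y s.
  have := order_path_min lt_trans ys; case/lastP: (s) => // s' z; rewrite last_rcons all_rcons.
  by move=> /andP[/ltW].
have [|s' [ss' ps' ds' ls']] := IH y _ ys gy gs.
  by move=> x /andP[yx xl]; apply: hd; rewrite xl andbT (le_trans (ltW uy)).
have [|x /andP[ux xy] hx] := @der_mvt _ g dg u y uy.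
  by move=> x /andP[ux xy]; apply: hd; rewrite ux (le_trans xy).
exists (x :: s'); split=> /=; [by rewrite ss' | | | by rewrite ls' (lt_le_trans xy)].
  rewrite ux; case: s' ps' {ss' ds' ls'} => //= z s' /andP[yz ->].
  by rewrite (lt_trans xy yz).
rewrite ds' andbT; move: hx; rewrite gu gy subrr => /esym/eqP.
by rewrite mulf_eq0 subr_eq0 (gt_eqF uy) orbF.
Qed.

(** The exponent of growth at infinity of (1+x)^(-f.1) f.2. Distinct exponents act as a form of
    linear independence that is easy to carry through the divisions. *)
Definition inf_exp f : R := (size f.2).-1%:R - f.1.

(** Represents the derivative of f / f0 multiplied by the square of the polynomial [f0.2], see
    [qfam_quot]. *)
Definition quot_step f0 f : R * {poly R} :=
  (f.1 - f0.1 + 1,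
   (f0.1 - f.1) *: (f.2 * f0.2) + (1 + 'X) * (f.2^`() * f0.2 - f.2 * f0.2^`())).

Lemma coefM_top p q m n : (size p <= m.+1)%N -> (size q <= n.+1)%N ->
  (p * q)`_(m + n) = p`_m * q`_n.
Proof.
move=> pm qn; rewrite coefM.
have mn : (m < (m + n).+1)%N by rewrite ltnS leq_addr.
rewrite (bigD1 (Ordinal mn)) //= addKn big1 ?addr0 // => i im.
have {im} : (i != m :> nat) by apply: contra im => /eqP im; apply/eqP/val_inj.
rewrite neq_ltn => /orP[im|mi].
  rewrite [X in _ * X]nth_default ?mulr0 // (leq_trans qn) //; have := ltn_ord i; lia.
by rewrite [X in X * _]nth_default ?mul0r // (leq_trans pm).
Qed.

Lemma size_mul_top p q m n : (size p <= m.+1)%N -> (size q <= n.+1)%N ->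
  (size (p * q)%R <= (m + n).+1)%N.
Proof. by move=> pm qn; rewrite (leq_trans (size_polyMleq _ _)) //; lia. Qed.

Lemma euler_top p m : (size p <= m.+1)%N -> (size ((1 + 'X) * p^`())%R <= m.+1)%N /\
  ((1 + 'X) * p^`())`_m = m%:R * p`_m.
Proof.
move=> pm; split.
  case: (eqVneq p 0) => [->|p0]; first by rewrite deriv0 mulr0 size_poly0.
  rewrite (leq_trans (size_polyMleq _ _)) // addrC -polyC1 size_XaddC /=.
  by rewrite (leq_trans (lt_size_deriv p0)).
rewrite mulrDl mul1r coefD coefXM coef_deriv nth_default // mul0rn add0r.
case: m pm => [|m] pm; first by rewrite mul0r.
by rewrite /= coef_deriv mulr_natl.
Qed.

(** The top coefficient is the product of the two leading coefficients times the difference of the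
    exponents, hence nonzero. The exponent of f is shifted by an amount depending on f0 only, so
    distinct exponents stay distinct. *)
Lemma quot_step_exp f0 f : f0.2 != 0 -> f.2 != 0 -> inf_exp f != inf_exp f0 ->
  (quot_step f0 f).2 != 0 /\
  inf_exp (quot_step f0 f) = inf_exp f - inf_exp f0 + ((size f0.2).-1%:R *+ 2 - 1).
Proof.
case: f0 f => [b0 p0] [b p] /= p00 pn0; rewrite /inf_exp /quot_step /=.
set m := (size p).-1; set n := (size p0).-1 => ne.
have pm : (size p <= m.+1)%N by rewrite /m leqSpred.
have p0n : (size p0 <= n.+1)%N by rewrite /n leqSpred.
set q := _ + _; have [d1 e1] := euler_top pm; have [d2 e2] := euler_top p0n.
have qE : q = (b0 - b) *: (p * p0) + (((1 + 'X) * p^`()) * p0 - p * ((1 + 'X) * p0^`())).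
  by rewrite /q mulrBr [_ * (p * p0^`())]mulrCA !mulrA.
have sq : (size q <= (m + n).+1)%N.
  rewrite qE (leq_trans (size_polyD _ _)) // geq_max; apply/andP; split.
    by rewrite (leq_trans (size_scale_leq _ _)) // size_mul_top.
  by rewrite (leq_trans (size_polyD _ _)) // size_polyN geq_max !size_mul_top.
have cq : q`_(m + n) != 0.
  rewrite qE coefD coefZ coefB !coefM_top // e1 e2.
  rewrite (_ : _ + _ = (b0 - b + m%:R - n%:R) * (lead_coef p * lead_coef p0)).
    rewrite !mulf_neq0 ?lead_coef_eq0 //; apply: contra_neq ne; lra.
  by rewrite /lead_coef -/m -/n; ring.
have q0 : q != 0 by apply: contra_neq cq => ->; rewrite coef0.
split=> //; have -> : size q = (m + n).+1.
  apply/eqP; rewrite eqn_leq sq /= ltnNge; apply/negP => h.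
  by move: cq; rewrite nth_default ?eqxx.
by rewrite /= natrD; ring.
Qed.

Lemma qfam_quot f0 f x : I11 x -> f0.2.[x] != 0 ->
  is_derive x 1 (fun y => (qf f0.1 0 1 y * (f0.2).[y]^-1) * qfam f y)
    (f0.2.[x]^-1 ^+ 2 * qfam (quot_step f0 f) x).
Proof.
case: f0 f => [b0 p0] [b p] /= Ix p0x; rewrite /qfam /quot_step /=.
have D := derM (derM (is_derive_qf b0 0 1 Ix) (derV (is_derive_poly p0 x) p0x)) (is_derive_qf (- b) 0 p Ix).
apply: (der_eq D) => {D}.
have [x1 x2] := I11_gt0 Ix.
have E (c : R) (q : {poly R}) : qf (c - 1) (0 - 1) (dqf c 0 q) x = (1 + x) `^ (c - 1) * (c * q.[x] + (1 + x) * q^`().[x]).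
  rewrite -[LHS]/(qf (c - 1) (0 - 1) (dqf c 0 q) x).
  rewrite (_ : dqf c 0 q = (1 - 'X) * (c *: q + (1 + 'X) * q^`())); last first.
    rewrite /dqf polyC0 -mul_polyC; ring.
  rewrite qf_mulB // /qf powRr0 mulr1 hornerD hornerZ hornerM.
  by rewrite -polyC1 hornerD hornerX hornerC.
rewrite !E /qf !powRr0 !mulr1.
rewrite !(hornerD, hornerN, hornerZ, hornerM) -polyC1 derivC !hornerC hornerX.
rewrite (powRP b0 x1) (powRP (- b) x1) (_ : - (b - b0 + 1) = (b0 - 1) + (- b - 1) + 1); last by ring.
rewrite (powRS _ x1) (powRD_gt0 (b0 - 1) (- b - 1) x1).
move: (_ `^ (b0 - 1)) (_ `^ (- b - 1)) (p.[x]) (p^`().[x]) (p0^`().[x]) (p0.[x]) p0x => A B P P1 Q1 Q0 Q00.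
by field.
Qed.

(** This is [wronskian_step] with v = 1/f0 and w the inverse square of [f0.2], two functions without
    zeros on the interval. *)
Lemma wronskian_quot d f0 (fs : seq (R * {poly R})) x : d <= 1 ->
  (forall y, near1 d y -> f0.2.[y] != 0) -> near1 d x ->
  (wronskian (map (@qfam R) (f0 :: fs)) x == 0) =
  (wronskian (map (@qfam R) (map (quot_step f0) fs)) x == 0).
Proof.
move=> d1 p0n Ux; have sub := near1_I11 d1.
pose v (y : R) := qf f0.1 0 1 y * (f0.2).[y]^-1; pose w (y : R) := f0.2.[y]^-1 * f0.2.[y]^-1.
have oU := @open_near1 d; have sV := smooth_polyV oU p0n.
have sq c e p : smooth_on (near1 d) (qf c e p) by apply: (smooth_on_sub sub); exact: smooth_qf.
have sv : smooth_on (near1 d) v := smoothM oU (sq _ _ _) sV.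
have sw : smooth_on (near1 d) w := smoothM oU sV sV.
have := @wronskian_step R (near1 d) _ (@qfam R) (fun f => qfam (quot_step f0 f)) (qfam f0) v w (fun=> 1) fs oU
  (sq _ _ _) sv sw (fun _ _ => sq _ _ _) (fun _ _ => sq _ _ _).
move=> /(_ _ _ x Ux); rewrite big1 // mul1r -map_comp => h.
have vn : v x ^+ (size fs).+1 != 0.
  by rewrite expf_neq0 // mulf_neq0 ?invr_eq0 ?p0n // qf_neq0 //; exact: sub.
have wn : w x ^+ size fs != 0 by rewrite expf_neq0 // mulf_neq0 // invr_eq0 p0n.
have {h} E : v x ^+ (size fs).+1 * wronskian (map (@qfam R) (f0 :: fs)) x =
    w x ^+ size fs * wronskian (map (@qfam R \o quot_step f0) fs) x.
  apply: h => [y Uy|f y _ Uy].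
    rewrite /v /qfam mulrAC qfM; last exact: sub.
    by rewrite subrr add0r mul1r /qf !powRr0 !mul1r mulfV // p0n.
  rewrite derive1E mul1r; have [_ ->] := qfam_quot f (sub _ Uy) (p0n y Uy).
  by rewrite expr2.
by apply/eqP/eqP => h; move: E; rewrite h mulr0 => /eqP;
   rewrite ?[0 == _]eq_sym mulf_eq0 ?(negPf vn) ?(negPf wn) => /eqP.
Qed.

Lemma quot_step_all f0 (fs : seq (R * {poly R})) : f0.2 != 0 -> all (fun f => f.2 != 0) fs ->
  uniq (map inf_exp (f0 :: fs)) -> all (fun f => f.2 != 0) (map (quot_step f0) fs) /\
  uniq (map inf_exp (map (quot_step f0) fs)).
Proof.
move=> p0 pn /= /andP[ne un].
have Q f : f \in fs -> _ := fun fin => quot_step_exp p0 (allP pn f fin)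
   (contraNneq (fun e => etrans (congr1 (fun z => z \in map inf_exp fs) (esym e)) (map_f inf_exp fin)) ne).
split; first by rewrite all_map; apply/allP => f /Q[].
rewrite -map_comp (_ : map _ fs = map (fun z => z - inf_exp f0 + ((size f0.2).-1%:R *+ 2 - 1)) (map inf_exp fs)).
  by rewrite map_inj_uniq // => y z; lra.
by rewrite -map_comp; apply/eq_in_map => f /Q[].
Qed.

(** It will show that P_n is not the zero polynomial, for which [zeros] would be empty. *)
Lemma wronskian_neq0_near1 (fs : seq (R * {poly R})) : all (fun f => f.2 != 0) fs ->
  uniq (map inf_exp fs) -> exists2 d, 0 < d <= 1 &
  forall x, near1 d x -> wronskian (map (@qfam R) fs) x != 0.
Proof.
have [n] := ubnP (size fs); elim: n fs => // n IH [|f0 fs] sn.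
  by move=> _ _; exists 1; rewrite ?ltr01 ?lexx // => x _; rewrite /wronskian det_mx00 oner_neq0.
move=> /= /andP[p0 pn] un; have [pn' un'] := quot_step_all p0 pn un.
have [|d /andP[d0 d1] hd] := IH _ _ pn' un'; first by rewrite size_map.
have [e /andP[e0 e1] he] := poly_neq0_near1 p0.
pose m := Num.min d e; have md : m <= d by rewrite ge_min lexx.
have me : m <= e by rewrite ge_min lexx orbT.
exists m => [|x mx]; first by rewrite lt_min d0 e0 (le_trans md).
rewrite (@wronskian_quot m) ?(le_trans md) //; first by apply: hd; exact: near1_sub mx.
by move=> y my; apply: he; exact: near1_sub my.
Qed.

(** Each division by a function of [fs] costs one zero, by Rolle. The radius d0 depends on [fs]
    only, so it is fixed before f = P_s varies with s. *)
Lemma wronskian_zeros_near1 (fs : seq (R * {poly R})) : all (fun f => f.2 != 0) fs ->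
  uniq (map inf_exp fs) -> exists2 d0, 0 < d0 <= 1 &
  forall d N f s, 0 < d <= d0 -> size s = (N + size fs)%N -> sorted <%R s ->
   (forall x, x \in s -> near1 d x /\ qfam f x = 0) ->
   exists s', [/\ size s' = N, sorted <%R s' & forall x, x \in s' ->
      near1 d x /\ wronskian (map (@qfam R) (rcons fs f)) x = 0].
Proof.
have [n] := ubnP (size fs); elim: n fs => // n IH [|f0 fs] sn.
  move=> _ _; exists 1; rewrite ?ltr01 ?lexx // => d N f s _ sN ss hs.
  exists s; split=> //; first by rewrite sN addn0.
  by move=> x /hs[h1 h2]; split=> //; rewrite /wronskian det_mx11 mxE.
move=> /= /andP[p0 pn] un; have [pn' un'] := quot_step_all p0 pn un.
have [|d1 /andP[d10 d11] hd] := IH _ _ pn' un'; first by rewrite size_map.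
have [e /andP[e0 e1] he] := poly_neq0_near1 p0.
pose m := Num.min d1 e; have md : m <= d1 by rewrite ge_min lexx.
have me : m <= e by rewrite ge_min lexx orbT.
exists m; first by rewrite lt_min d10 e0 (le_trans md).
move=> d N f s /andP[d0 dm] sN ss hs.
have p0n y : near1 d y -> f0.2.[y] != 0.
  by move=> h; apply: he; apply: near1_sub h; exact: le_trans me.
have dd1 : d <= 1 by rewrite (le_trans dm) // (le_trans md).
pose g (y : R) := (qf f0.1 0 1 y * (f0.2).[y]^-1) * qfam f y.
pose dg (y : R) := f0.2.[y]^-1 ^+ 2 * qfam (quot_step f0 f) y.
case: s sN ss hs => [|u s]; first by rewrite addnS.
rewrite /= addnS => -[sN] ss hs.
have [u1 qu] := hs u (mem_head _ _).
have sI y : y \in s -> near1 d y by move=> ys; have [] := hs y; rewrite // inE ys orbT.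
have lI : near1 d (last u s).
  by case/lastP: (s) sI => // s' z; rewrite last_rcons; apply; rewrite mem_rcons mem_head.
have [|||s' [ss' ps' ds' ls']] := @rolle_seq g dg u s _ ss.
- move=> x /andP[ux xl]; have Ux : near1 d x.
    by move: u1 lI; rewrite /near1 /= => /andP[h1 _] /andP[_ h2]; rewrite (lt_le_trans h1) // (le_lt_trans xl).
  by apply: qfam_quot; [exact: near1_I11 Ux|exact: p0n].
- by rewrite /g qu mulr0.
- by apply/allP => y ys; have [|_ h] := hs y; [by rewrite inE ys orbT|rewrite /g h mulr0].
have [|||s'' [sN'' ss'' hs'']] := hd d N (quot_step f0 f) s' _ _ (path_sorted ps').
- by rewrite d0 (le_trans dm).
- by rewrite ss' sN size_map.
- move=> x xs; have Ux : near1 d x.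
    move: u1 lI; rewrite /near1 /= => /andP[h1 _] /andP[_ h2].
    have := allP (order_path_min lt_trans ps') x xs => ux.
    by rewrite (lt_trans h1 ux) (lt_trans (allP ls' x xs)).
  split=> //; move: (allP ds' x xs); rewrite mulf_eq0 expf_eq0 /= invr_eq0 (negPf (p0n x Ux)) /=.
  by move/eqP.
exists s''; split=> // x /hs''[Ux]; rewrite -map_rcons => h; split=> //.
by apply/eqP; rewrite (@wronskian_quot d) // h.
Qed.

End Rolle.

Section ManyZeros.
Variable R : realType.
Implicit Types (a b c x d : R) (p q : {poly R}).

Lemma size_jacobi_leq a b n : (size (jacobi a b n) <= n.+1)%N.
Proof.
rewrite jacobi_hsum (leq_trans (size_scale_leq _ _)) //.
rewrite (leq_trans (size_sum _ _ _)) //; apply/bigmax_leqP => j _.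
rewrite (leq_trans (size_scale_leq _ _)) // (leq_trans (size_polyMleq _ _)) //.
rewrite -polyC1 size_exp_XsubC -[1%:P]opprK -polyCN size_exp_XsubC addSn addnS /=.
by have := ltn_ord j; lia.
Qed.

(** The n-th derivative is the constant n! [gbinom (2n + a + b) n] / 2^n, whose binomial has the
    factors a + b + n + i, 1 <= i <= n, nonzero by assumption. *)
Lemma size_jacobi a b n : avoids (a + b + n%:R) n -> size (jacobi a b n) = n.+1.
Proof.
move=> h; apply/eqP; rewrite eqn_leq size_jacobi_leq /= ltnNge; apply/negP => sn.
have := congr1 (fun p : {poly R} => p.[0]) (derivn_jacobi a b (leqnn n)).
rewrite derivn_poly0 // subnn jacobi0 hornerZ -polyC1 !hornerC mulr1 => /esym/eqP.
have fn m : (m`!)%:R != 0 :> R by exact: fact_neq0.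
apply/negP; apply: mulf_neq0; last by rewrite invr_eq0 exp2_neq0.
apply: mulf_neq0 => //; apply: mulf_neq0; last by rewrite invr_eq0.
rewrite prodf_seq_neq0; apply/allP => i _ /=.
have := h (n - i)%N; rewrite natrB; last exact: ltnW.
have -> : (0 < n - i <= n)%N by have := ltn_ord i; lia.
by move=> /(_ isT); apply: contra_neq; lra.
Qed.

Lemma jacobi_neq0 a b n : avoids (a + b + n%:R) n -> jacobi a b n != 0.
Proof. by move=> /size_jacobi; rewrite -size_poly_eq0 => ->. Qed.

Lemma near_nat_notin (l : seq R) : \forall s \near \oo, s%:R \notin l.
Proof.
elim: l => [|x l IH]; first by apply: nearW.
near=> s; rewrite inE negb_or; apply/andP; split; last by near: s.
by rewrite -subr_eq0; near: s; exact: near_natD_neq0.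
Unshelve. all: by end_near.
Qed.

(** The case r = 0, B_0 = 1 of [jacobi_comb_roots]: the roots are 1 - 2t/s^2 with t < v, hence
    within d of 1 for large s. *)
Lemma jacobi_zeros_near1 a b k d : 0 < d -> \forall s \near \oo, exists xs : seq R,
  [/\ size xs = k, sorted <%R xs & forall x, x \in xs -> near1 d x /\ root (jacobi a b s) x].
Proof.
move=> d0; case: k => [|k]; first by apply: nearW => s; exists [::].
have B1 : (1 : {poly R}).[1] != 0 by rewrite -polyC1 hornerC oner_neq0.
have [ts [v [_ _ _ v0 /(_ 1 ltr01) h]]] := @jacobi_comb_roots R a b 0 (fun=> 1) B1 k.+1 (ltn0Sn k).
have hv : \forall s \near \oo, 2 * v / s%:R ^+ 2 < d.
  exact: (cvgr_lt _ (@cvg_natV_expn _ 2 (2 * v) isT)).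
near=> s; have s0 : 0 < s%:R :> R by rewrite ltr0n; near: s; exact: nbhs_infty_gt.
have [|rs [srs srt hr _ _]] := near h s; first by [].
have sd : 2 * v / s%:R ^+ 2 < d by near: s.
have w0 : 0 < 2 / s%:R ^+ 2 :> R by rewrite divr_gt0 // exprn_gt0.
exists (rev (map (fun t => 1 - 2 / s%:R ^+ 2 * t) rs)); split; first by rewrite size_rev size_map.
  rewrite rev_sorted sorted_map; apply: (sub_sorted (e := <%R)) srt => x y xy /=.
  by rewrite ltrD2l ltrN2 ltr_pM2l.
move=> x; rewrite mem_rev => /mapP[t trs ->]; move: trs; rewrite hr => /andP[/andP[t0 tv] rt].
split.
  rewrite /near1 /= ltrD2l ltrN2 gtrBl mulr_gt0 // andbT (lt_trans _ sd) //.
  by rewrite [2 * v / _]mulrAC ltr_pM2l.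
by move: rt; rewrite /jacobi_comb big_ord1 mul1r derivn0.
Unshelve. all: by end_near.
Qed.

Lemma many_zeros a b (la mu : seq nat) k : is_partition la -> is_partition mu ->
  (forall n, n \in assoc_seq la -> avoids (a + b + n%:R) n) ->
  (forall m, m \in assoc_seq mu -> avoids (a - b + m%:R) m) ->
  (forall n m, n \in assoc_seq la -> m \in assoc_seq mu -> b != m%:R - n%:R) ->
  exists n0 : nat, forall n : nat, degree_seq la mu n -> (n0 <= n)%N ->
     (k <= size (zeros (exceptional_jacobi a b la mu n)))%N.
Proof.
move=> hla hmu h1 h2 h3; have /andP[sla _] := hla; have /andP[smu _] := hmu.
pose fs := jacobi_terms a b (assoc_seq la) (assoc_seq mu).
have pfs : all (fun f => f.2 != 0) fs.
  by rewrite all_cat; apply/andP; split; apply/allP => f /mapP[n hn ->] /=; apply: jacobi_neq0;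
    [exact: h1 | exact: h2].
(* The exponents at infinity are the n_i and the m_j - b; [h3] separates the two families. *)
have E : map (@inf_exp R) fs = map (fun n => n%:R) (assoc_seq la) ++ map (fun m => m%:R - b) (assoc_seq mu).
  rewrite map_cat -(map_comp _ _ (assoc_seq la)) -(map_comp _ _ (assoc_seq mu)); congr (_ ++ _); apply/eq_in_map => n hn; rewrite /inf_exp /= size_jacobi ?subr0 //.
    exact: h1.
  exact: h2.
have inj : injective (fun n : nat => n%:R : R) by move=> m n /eqP; rewrite eqr_nat => /eqP.
have ufs : uniq (map (@inf_exp R) fs).
  have inj' : injective (fun m : nat => m%:R - b) by move=> m n /addIr; exact: inj.
  rewrite E cat_uniq (map_inj_uniq inj) (map_inj_uniq inj') !uniq_assoc_seq // andbT /=; apply/hasPn => x /mapP[m hm ->]; apply/mapP => -[n hn e].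
  by have := h3 n m hn hm; rewrite -e => /eqP; apply; ring.
have [d /andP[d0 d1] hd] := wronskian_zeros_near1 pfs ufs.
have key : \forall s \near \oo, (k <= size (zeros (exceptional_jacobi a b la mu (s + degree_off la mu))))%N.
  near=> s; set P := exceptional_jacobi _ _ _ _ _; pose f : R * {poly R} := (0, jacobi a b s).
  have [xs [sxs ssx hx]] : exists xs : seq R, [/\ size xs = (k + size fs)%N, sorted <%R xs &
      forall x, x \in xs -> near1 d x /\ root (jacobi a b s) x].
    by near: s; exact: jacobi_zeros_near1.
  have [||ys [sys ssy hy]] := hd d k f xs _ sxs ssx; first by rewrite d0 lexx.
    by move=> x /hx[h /rootP r]; split=> //; rewrite /qfam /qf r mulr0.
  have sab : avoids (a + b + s%:R) s.
    have s0 : 0 < s%:R + (a + b) by near: s; exact: near_addr_gt0.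
    by move=> i _; apply/eqP => e; have : 0 <= i%:R :> R by []; lra.
  have sn : s%:R \notin map (@inf_exp R) fs by near: s; exact: near_nat_notin.
  have [||e /andP[e0 e1] he] := @wronskian_neq0_near1 R (rcons fs f).
  - by rewrite all_rcons pfs andbT jacobi_neq0.
  - by rewrite map_rcons rcons_uniq ufs andbT /inf_exp /= size_jacobi //= subr0.
  have PE x : I11 x -> exists2 c, c != 0 & P.[x] = c * wronskian (map (@qfam R) (rcons fs f)) x.
    move=> Ix; rewrite /P exceptional_jacobiE // shifted_degree_off //; eexists; last reflexivity.
    by rewrite gt_eqF // powR_gt0; have [] := I11_gt0 Ix.
  have P0 : P != 0.
    have U : near1 e (1 - e / 2) by rewrite /near1 /=; apply/andP; split; lra.
    apply/eqP => Pz; have [c c0] := PE _ (near1_I11 e1 U).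
    by rewrite Pz horner0 => /esym/eqP; rewrite mulf_eq0 (negPf c0) (negPf (he _ U)).
  rewrite -sys; apply: uniq_leq_size; first exact: (sorted_uniq lt_trans ltxx).
  move=> x /hy[Ux wx]; rewrite polyrcf.in_roots P0 andbT in_itv /=; have Ix := near1_I11 d1 Ux.
  have [c _ e'] := PE x Ix; rewrite Ix andbT; apply/rootP; rewrite e' wx mulr0 //.
have [s0 _ hs0] := key; exists (s0 + degree_off la mu)%N => n hn nn.
rewrite (degree_seq_off hla hn); apply: hs0 => /=.
by have := degree_seq_off hla hn; lia.
Unshelve. all: by end_near.
Qed.

End ManyZeros.

Unset Implicit Arguments.

Theorem corollary6p4 (R : realType) (la mu : seq nat) (a b : R)
    (hla : is_partition la) (hmu : is_partition mu)
    (h1 : forall n, n \in assoc_seq la -> avoids (a + b + n%:R) n)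
    (h2 : forall m, m \in assoc_seq mu -> avoids (a - b + m%:R) m)
    (h3 : forall n m, n \in assoc_seq la -> m \in assoc_seq mu ->
      b != m%:R - n%:R)
    (ha : a + (size la + size mu)%:R > -1)
    (hb : b + (size la + size mu)%:R > -1)
    (k : nat) (hk : (0 < k)%N) :
  let P := exceptional_jacobi a b la mu in
  let N := degree_seq la mu in
  let a' := a + (head 0%N mu)%:R + (size mu)%:R in
  let b' := b - (head 0%N mu)%:R - (size mu)%:R in
  let mu' := conj_part mu in
  (exists n0 : nat, forall n : nat, N n -> (n0 <= n)%N ->
     (k <= size (zeros (P n)))%N) /\
  ((Omega a b la mu).[1] != 0 ->
     (fun n : nat => n%:R * acos (zero_near_1 (P n) k))
       @ within N \oo --> bessel_zero (a + (size la)%:R + (size mu)%:R) k) /\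
  ((exists n1 : nat, forall n : nat, N n -> (n1 <= n)%N ->
      let s := shifted_degree la mu n in
      [/\ (forall i, i \in assoc_seq la -> avoids (a' + b' + i%:R) i),
          avoids (a' + b' + s%:R) s,
          (forall m, m \in assoc_seq mu' -> avoids (- a' + b' + m%:R) m),
          (forall i m, i \in assoc_seq la -> m \in assoc_seq mu' ->
             a' != m%:R - i%:R) &
          (forall m, m \in assoc_seq mu' -> a' != m%:R - s%:R)]) ->
   (Omega_bar a' b' la mu').[-1] != 0 ->
     (fun n : nat => n%:R * acos (- zero_near_m1 (P n) k))
       @ within N \oo --> bessel_zero (b + (size la)%:R - (size mu)%:R) k).
Proof.
move=> P N a' b' mu'; split; first exact: many_zeros.
split; first exact: limit_near_1.
move=> [n1 hn1] O1.
(* The conditions that do not involve s are read off at one degree beyond [n1]. *)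
have [n0 hn0] := degree_seq_large mu hla.
have [c1 _ c3 c4 _] := hn1 (maxn n0 n1) (hn0 _ (leq_maxl _ _)) (leq_maxr _ _).
exact: limit_near_m1.
Qed.
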